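(* For every $C>0$ there exists $C'>0$ such that, for every $\varepsilon\in(0,1]$ and every $u_0\in H^{1/2}(\mathbb T)$ with $\Pi_+u_0=u_0$ and $\|u_0\|_{H^{1/2}}\le C\varepsilon$, the solution $u$ of $$i\partial_tu-|D|u=|u|^2u,\qquad u(0,\cdot)=u_0,$$ satisfies $$\sup_{t\in\mathbb R}\|\Pi_-u(t)\|_{H^{1/2}}\le C'\varepsilon^2 .$$
   Context: $\mathbb T=\mathbb R/2\pi\mathbb Z$. For $u=\sum_{k\in\mathbb Z}u_ke^{ikx}$: $|D|u=\sum_k|k|\,u_ke^{ikx}$, $\Pi_+u=\sum_{k\ge0}u_ke^{ikx}$, $\Pi_-u=u-\Pi_+u=\sum_{k<0}u_ke^{ikx}$, and $\|u\|_{H^{1/2}}^2=\sum_k(1+k^2)^{1/2}|u_k|^2$. Functions are complex valued. For every $u_0\in H^{1/2}(\mathbb T)$, the equation $i\partial_tu-|D|u=|u|^2u$, $u(0)=u_0$, has a unique global solution $u\in C(\mathbb R,H^{1/2}(\mathbb T))$; this is the solution meant in the statement. *)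

(* Defs.v *)
(* MathComp-Analysis, with the complex numbers R[i] of mathcomp-real-closed. *)
From HB Require Import structures.
From mathcomp Require Import all_boot all_order all_algebra.
From mathcomp Require Import all_classical all_reals all_analysis.
From mathcomp Require Import complex.

Set Implicit Arguments.
Unset Strict Implicit.
Unset Printing Implicit Defensive.

Import Order.TTheory GRing.Theory Num.Theory.
Import numFieldNormedType.Exports.

Local Open Scope classical_set_scope.
Local Open Scope ring_scope.
Local Open Scope complex_scope.

(* A function on T = R / 2 pi Z is a 2 pi-periodic function R -> R[i].  A
   distribution on T, u = \sum_k u_k e^{ikx}, is given by the family
   (u_k : int -> R[i]); |D|, Pi_+, Pi_- and the H^{1/2} norm act on such
   families, and functions enter through [fourier]. *)

Section torus.
Context {R : realType}.

Definition period : set R := `[0, pi *+ 2].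

Definition torus_int (f : R -> R[i]) : R[i] :=
  (\int[lebesgue_measure]_(x in period) complex.Re (f x))%R +i*
  (\int[lebesgue_measure]_(x in period) complex.Im (f x))%R.

Definition expi (y : R) : R[i] := cos y +i* sin y.

Definition fourier (f : R -> R[i]) (k : int) : R[i] :=
  ((pi *+ 2)^-1)%:C * torus_int (fun x => f x * expi (- (k%:~R * x))).

Definition absD (c : int -> R[i]) (k : int) : R[i] := (`|k|%:~R : R)%:C * c k.

Definition Pi_plus (c : int -> R[i]) (k : int) : R[i] :=
  if 0 <= k then c k else 0.

Definition Pi_minus (c : int -> R[i]) (k : int) : R[i] := c k - Pi_plus c k.

(* Takes the value +oo outside H^{1/2}. *)
Definition H12_norm (c : int -> R[i]) : \bar R :=
  sqrte (\esum_(k in [set: int])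
    (Num.sqrt (1 + k%:~R ^+ 2) * ComplexField.Normc.normc (c k) ^+ 2)%:E).

Definition in_L2 (f : R -> R[i]) : Prop :=
  [/\ periodic f (pi *+ 2),
      measurable_fun [set: R] (fun x => complex.Re (f x)),
      measurable_fun [set: R] (fun x => complex.Im (f x)) &
      (\int[lebesgue_measure]_(x in period)
         (ComplexField.Normc.normc (f x) ^+ 2)%:E < +oo)%E].

Definition in_H12 (f : R -> R[i]) : Prop :=
  in_L2 f /\ (H12_norm (fourier f) < +oo)%E.

Definition is_Cderive (g : R -> R[i]) (t : R) (d : R[i]) : Prop :=
  is_derive t (1 : R) (fun s => complex.Re (g s)) (complex.Re d) /\
  is_derive t (1 : R) (fun s => complex.Im (g s)) (complex.Im d).

Definition cubic (f : R -> R[i]) (x : R) : R[i] := `|f x| ^+ 2 * f x.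

(* u \in C(R, H^{1/2}(T)), where u t is a representative of its a.e. class. *)
Definition continuous_H12 (u : R -> R -> R[i]) : Prop :=
  (forall t, in_H12 (u t)) /\
  (forall t0, H12_norm (fourier (u t \- u t0)) @[t --> t0] --> 0%E).

(* i d_t u - |D| u = |u|^2 u as distributions on T, i.e. tested against each
   e^{ikx}; |u|^2 u is the pointwise product. *)
Definition solution (u0 : R -> R[i]) (u : R -> R -> R[i]) : Prop :=
  [/\ continuous_H12 u,
      (\forall x \ae lebesgue_measure, u 0 x = u0 x) &
      forall (t : R) (k : int), exists2 d : R[i],
        is_Cderive (fun s => fourier (u s) k) t d &
        'i%C * d - absD (fourier (u t)) k = fourier (cubic (u t)) k].

End torus.

(* Main.v *)
(* With E the Hamiltonian and P the momentum, E - P / 2 equals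
   \sum_(k < 0) |k| |u_k|^2 + (mean of |u|^4) / 4.  It is conserved, and at t = 0 only
   the quartic term is present, which is O(eps^4) since H^{1/2} embeds in L^4.

   At the regularity H^{1/2} conservation needs an argument, as the pairing of
   |D| u with |u|^2 u is not defined.  Let F_N be the functional of the sharp
   truncation of u to the frequencies |k| <= N.  By the symmetries of the Galerkin
   system, F_N' only involves frequency quadruples with one entry |a| > N and one
   entry |e| <= N, with a weight |e|.  Averaging over N <= K with the weights 1 / N turns
   this weight into about sqrt(|a||e|) min(1, |a + e| / |a|), and a Hilbert-Schmidt
   estimate bounds the sum of the defects by O(sqrt(log K)), against a total weight
   log K; so the average of F_N is constant in the limit K -> oo.

   To express the Fourier coefficients of |u|^2 u through those of u, partial
   Fourier sums of u converge almost everywhere along a subsequence, dominated in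
   L^4, to a function with the coefficients of u, which is u by uniqueness. *)
Require Import Defs.
From HB Require Import structures.
From mathcomp Require Import all_boot all_order all_algebra.
From mathcomp Require Import all_classical all_reals all_analysis.
From mathcomp Require Import measurable_realfun complex ring lra zify.
Set Implicit Arguments.
Unset Strict Implicit.
Unset Printing Implicit Defensive.
Import Order.TTheory GRing.Theory Num.Theory.
Import numFieldNormedType.Exports.
Local Open Scope classical_set_scope.
Local Open Scope ring_scope.

(** * Trigonometric kernels and uniqueness of Fourier coefficients *)

(** The truncated energies of the solution are only almost conserved, and the size of the defect
    depends on an unspecified bound B for the H^{1/2} norm on the time interval between -|t| and
    |t|. That bound enters the defect alone, which becomes negligible after division by the total
    weight as K grows, so the final constant only sees the data at time 0. The defect pairs the
    gradient of the truncated energy with the difference between |u|^2 u and its truncated version.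
    The linear part of the gradient carries the weight |e| and gives the resonant sum. The cubic
    part carries no weight: its contribution at the cut-off N is O(N^(-1/8)), so with the weights 1
    / N it sums to a constant. The embedding of H^{1/2} in L^4 is the case K = 1 of the weighted
    convolution estimate that controls the resonant sum. *)

Section cosine_kernel.
Context {R : realType}.
Implicit Types (l : seq (R * int)) (s x a : R).

(** Lists of pairs (amplitude, frequency) make primitives computable term by term; frequencies may
    repeat and may be negative. *)
Definition cossum l s : R := \sum_(c <- l) c.1 * cos (c.2%:~R * s).

(* The primitive of [cossum l] vanishing at 0; it is a trigonometric polynomial
   up to the linear term [cosmean l * s]. *)
Definition cosprim_term (c : R * int) s : R :=
  if c.2 == 0 then c.1 * s else c.1 / c.2%:~R * sin (c.2%:~R * s).

Definition cosprim l s : R := \sum_(c <- l) cosprim_term c s.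

Definition cosmean l : R := \sum_(c <- l | c.2 == 0) c.1.

(** These kernels concentrate at 0 modulo 2 pi as n grows. One more factor (1 + cos s) / 2 sends the
    frequency k to half of itself plus a quarter of each neighbour k + 1 and k - 1. *)
Lemma kernel_cossum (n : nat) :
  exists l, forall s, cossum l s = ((1 + cos s) / 2) ^+ n.
Proof.
elim: n => [|n [l IH]].
  by exists [:: (1, 0)] => s; rewrite /cossum big_seq1/= mul0r cos0 mulr1 expr0.
exists ([seq (c.1 / 2, c.2) | c <- l] ++
        [seq (c.1 / 4, c.2 + 1) | c <- l] ++ [seq (c.1 / 4, c.2 - 1) | c <- l]) => s.
rewrite exprS -IH /cossum !big_cat/= !big_map/= -!big_split/= mulr_sumr.
apply: eq_bigr => c _.
rewrite !rmorphD !rmorphN !rmorph1 !(mulrDl _ _ s) !mulN1r !mul1r cosB cosD.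
by field.
Qed.

Lemma is_derive_cosprim l s : is_derive s 1 (cosprim l) (cossum l s).
Proof.
elim: l => [|c l IH].
  rewrite (_ : cosprim [::] = cst 0); last first.
    by apply/funext => x; rewrite /cosprim big_nil.
  by rewrite /cossum big_nil; exact: is_derive_cst.
rewrite (_ : cosprim (c :: l) = cosprim_term c \+ cosprim l); last first.
  by apply/funext => x; rewrite /cosprim big_cons.
rewrite /cossum big_cons; apply: is_deriveD; rewrite /cosprim_term.
case: eqVneq => [->|c0].
  rewrite (_ : (fun s => _) = c.1 \*: (@id R))//.
  by apply: is_derive_eq; rewrite mul0r cos0 /GRing.scale.
rewrite (_ : (fun s => _) = (c.1 / c.2%:~R) \*: (@sin R \o (c.2%:~R \*: (@id R))))//.
apply: is_derive_eq; rewrite /GRing.scale /=.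
by have : c.2%:~R != 0 :> R by [rewrite intr_eq0]; move=> ?; field.
Qed.

Lemma cosprim0 l : cosprim l 0 = 0.
Proof.
rewrite /cosprim big1// => c _; rewrite /cosprim_term.
by case: ifP; rewrite ?mulr0// sin0 mulr0.
Qed.

Lemma cosprimN l s : cosprim l (- s) = - cosprim l s.
Proof.
rewrite /cosprim -sumrN; apply: eq_bigr => c _; rewrite /cosprim_term.
by case: ifP; rewrite mulrN// sinN mulrN.
Qed.

Lemma sin_int_pi2 (k : int) : sin (k%:~R * (pi *+ 2)) = 0 :> R.
Proof.
have H (n : nat) : sin (n%:R * (pi *+ 2)) = 0 :> R.
  by rewrite mulr_natl -[_ *+ n]add0r periodicn ?sin0//; exact: sinD2pi.
by case: k => n; rewrite ?NegzE ?mulrNz ?mulNr ?sinN -pmulrn H ?oppr0.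
Qed.

Lemma cos_int_pi2 (k : int) : cos (k%:~R * (pi *+ 2)) = 1 :> R.
Proof.
have H (n : nat) : cos (n%:R * (pi *+ 2)) = 1 :> R.
  by rewrite mulr_natl -[_ *+ n]add0r periodicn ?cos0//; exact: cosD2pi.
by case: k => n; rewrite ?NegzE ?mulrNz ?mulNr ?cosN -pmulrn H ?oppr0.
Qed.

Lemma cosprim_pi2 l : cosprim l (pi *+ 2) = pi *+ 2 * cosmean l.
Proof.
rewrite /cosprim /cosmean mulr_sumr [RHS]big_mkcond; apply: eq_bigr => c _.
by rewrite /cosprim_term; case: ifP; rewrite ?sin_int_pi2 ?mulr0// mulrC.
Qed.

Lemma cosprim_pi2B l s : cosprim l (pi *+ 2 - s) = cosprim l (pi *+ 2) - cosprim l s.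
Proof.
rewrite /cosprim -sumrB; apply: eq_bigr => c _; rewrite /cosprim_term.
case: ifP; first by rewrite mulrBr.
rewrite mulrBr sinB sin_int_pi2 cos_int_pi2 mul0r mul1r => _; ring.
Qed.

Lemma cosprim_mvt l a b : a <= b ->
  exists2 c, c \in `[a, b]%R & cosprim l b - cosprim l a = cossum l c * (b - a).
Proof.
move=> ab; apply: MVT_segment => //.
  by move=> x _; exact: is_derive_cosprim.
apply: continuous_subspaceT => x; apply/differentiable_continuous.
by apply/derivable1_diffP; case: (is_derive_cosprim l x).
Qed.

Lemma kernel_prim_ndecr l n : (forall s, cossum l s = ((1 + cos s) / 2) ^+ n) ->
  {homo cosprim l : a b / a <= b}.
Proof.
move=> ln a b ab; have [c _ E] := cosprim_mvt l ab.
rewrite -subr_ge0 E mulr_ge0 ?subr_ge0// ln exprn_ge0// divr_ge0//.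
Qed.

Lemma kernel_prim_pi2_gt0 l n : (forall s, cossum l s = ((1 + cos s) / 2) ^+ n) ->
  0 < cosprim l (pi *+ 2).
Proof.
move=> ln; apply: (@lt_le_trans _ _ (cosprim l 2^-1)); last first.
  by apply: (kernel_prim_ndecr ln); have := @pi_ge2 R; lra.
have h0 : (0 : R) <= 2^-1 by [].
have [c] := cosprim_mvt l h0.
rewrite cosprim0 !subr0 => c01 ->; rewrite ln mulr_gt0// exprn_gt0// divr_gt0//.
apply: addr_gt0 => //; apply: cos_gt0_pihalf.
move: c01; rewrite in_itv/=; have := @pihalf_ge1 R; lra.
Qed.

End cosine_kernel.

Section uniqueness.
Context {R : realType}.
Notation mu := (@lebesgue_measure R).
Notation D := (@period R).
Implicit Types (p h : R -> R) (l : seq (R * int)).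

(* The Borel structure is spelled out because [lebesgue_measure] lives on
   [g_sigma_algebraType], whose display differs from the default one on R. *)
Lemma measurable_period :
  @measurable _ (g_sigma_algebraType (R.-ocitv.-measurable)) D.
Proof. exact: measurable_itv. Qed.

Lemma integrable_period_cst (r : R) : mu.-integrable D (EFin \o cst r).
Proof.
apply: (@continuous_compact_integrable R (cst r)); first exact: segment_compact.
by apply: continuous_subspaceT => x; exact: cvg_cst.
Qed.

Lemma integrable_scale (k : R) p : mu.-integrable D (EFin \o p) ->
  mu.-integrable D (EFin \o (fun x => k * p x)).
Proof.
by move=> ip; have := integrableZl measurable_period k ip.
Qed.

Lemma integrable_mul_bounded p h M : mu.-integrable D (EFin \o p) ->
  measurable_fun D h -> (forall x, D x -> `|h x| <= M) ->
  mu.-integrable D (EFin \o (fun x => p x * h x)).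
Proof.
move=> ip mh hM; have := @integrableMl _ _ _ mu D measurable_period _ h ip mh.
apply; exists M; split; first exact: num_real.
by move=> y My x Dx; apply: (le_trans (hM x Dx)); exact: ltW.
Qed.

Lemma measurable_sin_shift (k : int) (a : R) :
  measurable_fun D (fun x : R => sin (k%:~R * (x - a))).
Proof.
apply: (@measurable_funS _ _ _ _ setT) => //.
apply: continuous_measurable_fun => x.
apply: (@continuous_comp _ _ _ (fun x => k%:~R * (x - a)) sin); last exact: continuous_sin.
by apply: cvgM; [exact: cvg_cst|apply: cvgB; [exact: cvg_id|exact: cvg_cst]].
Qed.

Lemma measurable_cos_shift (k : int) (a : R) :
  measurable_fun D (fun x : R => cos (k%:~R * (x - a))).
Proof.
apply: (@measurable_funS _ _ _ _ setT) => //.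
apply: continuous_measurable_fun => x.
apply: (@continuous_comp _ _ _ (fun x => k%:~R * (x - a)) cos); last exact: continuous_cos.
by apply: cvgM; [exact: cvg_cst|apply: cvgB; [exact: cvg_id|exact: cvg_cst]].
Qed.

Lemma kernel_prim_bound (s : R) l n :
  (forall s, cossum l s = ((1 + cos s) / 2) ^+ n) -> `|s| <= pi *+ 2 ->
  `|cosprim l s / cosprim l (pi *+ 2)| <= 1.
Proof.
move=> ln; rewrite ler_norml => /andP[s1 s2].
have L0 := kernel_prim_pi2_gt0 ln.
rewrite normrM normfV (gtr0_norm L0) ler_pdivrMr// mul1r ler_norml -cosprimN.
by rewrite !(kernel_prim_ndecr ln).
Qed.

Lemma cos_le_sym (s c : R) : 0 <= s <= pi -> s <= c <= pi *+ 2 - s -> cos c <= cos s.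
Proof.
move=> /andP[s0 spi] /andP[sc cs].
have mono (x y : R) : 0 <= x -> x <= y -> y <= pi -> cos y <= cos x.
  move=> x0; rewrite le_eqVlt => /predU1P[->//|xy] yp; apply: ltW.
  by rewrite ltr_cos// in_itv/=; lra.
have [cp|cp] := leP c pi; first exact: mono.
rewrite -[cos c]cosN -[cos (- c)]cosD2pi; apply: mono => //; lra.
Qed.

(** By reflection, L - 2 [cosprim l s] is the mass of the kernel on [s, 2 pi - s], where the kernel
    is at most its value at s. The total mass L is at least the mass on [0, s / 2], where the kernel
    is at least its value at s / 2. The ratio of the two values is less than 1 and is raised to the
    power n. *)
Lemma kernel_prim_half_dist (s : R) l n :
  (forall s, cossum l s = ((1 + cos s) / 2) ^+ n) -> 0 < s <= pi ->
  `|cosprim l s / cosprim l (pi *+ 2) - 1 / 2| <=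
    2 * pi / s * ((1 + cos s) / (1 + cos (s / 2))) ^+ n.
Proof.
move=> ln /andP[s0 sp]; set L := cosprim l (pi *+ 2).
have L0 : 0 < L := kernel_prim_pi2_gt0 ln.
have c2 : 0 <= cos (s / 2) by apply: cos_ge0_pihalf; lra.
have cs : 0 <= 1 + cos s by have := cos_geN1 s; lra.
set X := (1 + cos s) / 2; set Y := (1 + cos (s / 2)) / 2.
have X0 : 0 <= X by rewrite /X; lra.
have Y0 : 0 < Y by rewrite /Y; lra.
have -> : (1 + cos s) / (1 + cos (s / 2)) = X / Y.
  by rewrite /X /Y; field; lra.
have [c /[!in_itv]/= cI E1] : exists2 c, c \in `[s, pi *+ 2 - s]%R &
    L - 2 * cosprim l s = cossum l c * (pi *+ 2 - s - s).
  have [|c cI E] := @cosprim_mvt _ l s (pi *+ 2 - s); first by lra.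
  by exists c => //; rewrite -E cosprim_pi2B -/L; ring.
have [c' /[!in_itv]/= c'I E2] : exists2 c', c' \in `[0, s / 2]%R &
    cosprim l (s / 2) = cossum l c' * (s / 2).
  have [|c' cJ E] := @cosprim_mvt _ l 0 (s / 2); first by lra.
  by exists c' => //; move: E; rewrite cosprim0 !subr0.
have X_ge : cossum l c <= X ^+ n.
  have H : cos c <= cos s by apply: cos_le_sym; lra.
  by rewrite ln lerXn2r ?nnegrE//; have := cos_geN1 c; rewrite /X; lra.
have Y_le : Y ^+ n <= cossum l c'.
  have H : cos (s / 2) <= cos c' by apply: cos_le_sym; lra.
  by rewrite ln lerXn2r ?nnegrE//; have := cos_geN1 c'; rewrite /Y; lra.
have Yn0 : 0 < Y ^+ n by rewrite exprn_gt0.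
have LY : Y ^+ n * (s / 2) <= L.
  apply: (@le_trans _ _ (cosprim l (s / 2))); first by rewrite E2 ler_wpM2r//; lra.
  by apply: (kernel_prim_ndecr ln); lra.
have K0 : 0 <= cossum l c.
  by rewrite ln exprn_ge0//; have := cos_geN1 c; lra.
have num : 0 <= L - 2 * cosprim l s <= X ^+ n * (2 * pi).
  rewrite E1; apply/andP; split; first by rewrite mulr_ge0//; lra.
  by apply: ler_pM => //; lra.
have -> : cosprim l s / L - 1 / 2 = - ((L - 2 * cosprim l s) / (2 * L)).
  by field; lra.
rewrite normrN ger0_norm; last by apply: divr_ge0; lra.
rewrite expr_div_n ler_pdivrMr; last by lra.
case/andP: num => _ /le_trans; apply.
have -> : 2 * pi / s * (X ^+ n / Y ^+ n) * (2 * L) =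
   X ^+ n * (2 * pi) * (L / (Y ^+ n * (s / 2))) by field; rewrite !gt_eqF.
rewrite -[leLHS]mulr1 ler_wpM2l//.
  by rewrite mulr_ge0 ?exprn_ge0// mulr_ge0// pi_ge0.
by rewrite ler_pdivlMr ?mul1r// mulr_gt0//; lra.
Qed.

Section kernel_limits.
Variable l_ : nat -> seq (R * int).
Hypothesis l_P : forall n s, cossum (l_ n) s = ((1 + cos s) / 2) ^+ n.

Let A n s : R := cosprim (l_ n) s / cosprim (l_ n) (pi *+ 2).

Let A_pi (s : R) : 0 < s <= pi -> A n s @[n --> \oo] --> (1 / 2 : R).
Proof.
move=> s0p; apply/cvgrPdist_le => e e0.
pose r := (1 + cos s) / (1 + cos (s / 2)).
have [s0 sp] := andP s0p.
have c2 : 0 <= cos (s / 2) by apply: cos_ge0_pihalf; lra.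
have r0 : 0 <= r by rewrite divr_ge0//; have := cos_geN1 s; lra.
have r1 : r < 1.
  rewrite ltr_pdivrMr ?mul1r ?ltrD2l; last by lra.
  by rewrite ltr_cos ?in_itv/=; lra.
have : (2 * pi / s) * r ^+ n @[n --> \oo] --> (2 * pi / s) * 0.
  by apply: cvgM; [exact: cvg_cst|apply: cvg_expr; rewrite ger0_norm].
rewrite mulr0 => /cvgrPdist_le/(_ _ e0); apply: filterS => n.
rewrite sub0r normrN => H; rewrite distrC.
by apply: le_trans (le_trans (ler_norm _) H); exact: kernel_prim_half_dist.
Qed.

Lemma kernel_prim_cvg_pos (s : R) : 0 < s < pi *+ 2 -> A n s @[n --> \oo] --> (1 / 2 : R).
Proof.
move=> /andP[s0 s2]; have [sp|ps] := leP s pi; first by apply: A_pi; rewrite s0.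
rewrite (_ : (fun n => A n s) = (fun n => 1 - A n (pi *+ 2 - s))); last first.
  apply/funext => n; rewrite /A cosprim_pi2B.
  by field; rewrite gt_eqF// (kernel_prim_pi2_gt0 (l_P n)).
have -> : 1 / 2 = 1 - 1 / 2 :> R by lra.
by apply: cvgB; [exact: cvg_cst|apply: A_pi; lra].
Qed.

Lemma kernel_prim_cvg_neg (s : R) : - (pi *+ 2) < s < 0 -> A n s @[n --> \oo] --> (- (1 / 2) : R).
Proof.
move=> sI; rewrite (_ : (fun n => A n s) = (fun n => - A n (- s))); last first.
  by apply/funext => n; rewrite /A cosprimN mulNr opprK.
by apply: cvgN; apply: kernel_prim_cvg_pos; lra.
Qed.

End kernel_limits.

Section vanishing_coefficients.
Variable p : R -> R.
Hypothesis ip : mu.-integrable D (EFin \o p).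
Hypothesis pcos : forall k : int, \int[mu]_(x in D) (p x * cos (k%:~R * x)) = 0.
Hypothesis psin : forall k : int, \int[mu]_(x in D) (p x * sin (k%:~R * x)) = 0.

Let isin k a : mu.-integrable D (EFin \o (fun x => p x * sin (k%:~R * (x - a)))).
Proof.
apply: (@integrable_mul_bounded _ _ 1 ip); first exact: measurable_sin_shift.
by move=> x _; exact: sin_max.
Qed.

Let int_sin_shift k a : \int[mu]_(x in D) (p x * sin (k%:~R * (x - a))) = 0.
Proof.
have mP := measurable_period.
transitivity (\int[mu]_(x in D) (cos (k%:~R * a) * (p x * sin (k%:~R * x)) -
                                 sin (k%:~R * a) * (p x * cos (k%:~R * x)))).
  by apply: eq_Rintegral => x _; rewrite mulrBr sinB; ring.
have i1 : mu.-integrable D (EFin \o (fun x => p x * sin (k%:~R * x))).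
  by have := isin k 0; under eq_fun do rewrite subr0.
have i2 : mu.-integrable D (EFin \o (fun x => p x * cos (k%:~R * x))).
  apply: (@integrable_mul_bounded _ _ 1 ip); last by move=> x _; exact: cos_max.
  by have := measurable_cos_shift k 0; under eq_fun do rewrite subr0.
rewrite RintegralB//.
- by rewrite !RintegralZl// pcos psin !mulr0 subr0.
- exact: integrable_scale.
- exact: integrable_scale.
Qed.

(** What remains of the primitive without its linear part is a sum of sines, and p is orthogonal to
    all translates of sines. *)
Let sinpart l s : R := cosprim l s - cosmean l * s.

Let sinpart_cons c l s :
  sinpart (c :: l) s = (if c.2 == 0 then 0 else c.1 / c.2%:~R) * sin (c.2%:~R * s)
                       + sinpart l s.
Proof.
rewrite /sinpart /cosprim /cosmean !big_cons /cosprim_term; case: ifP => _; ring.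
Qed.

Let int_sinpart l a :
  mu.-integrable D (EFin \o (fun x => p x * sinpart l (x - a))) /\
  \int[mu]_(x in D) (p x * sinpart l (x - a)) = 0.
Proof.
have mP := measurable_period.
elim: l => [|c l [IH1 IH2]].
  under eq_fun do rewrite /sinpart /cosprim /cosmean !big_nil mul0r subr0 mulr0.
  by split; [exact: integrable0|rewrite Rintegral_cst// mul0r].
set r := (if c.2 == 0 then 0 else c.1 / c.2%:~R : R).
have E x : p x * sinpart (c :: l) (x - a) =
    r * (p x * sin (c.2%:~R * (x - a))) + p x * sinpart l (x - a).
  by rewrite sinpart_cons -/r; ring.
have ir : mu.-integrable D (EFin \o (fun x => r * (p x * sin (c.2%:~R * (x - a))))).
  apply: integrable_scale; exact: isin.
under eq_fun do rewrite E.
split; first exact: (integrableD mP ir IH1).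
rewrite RintegralD// RintegralZl ?int_sin_shift// ?IH2 ?mulr0 ?addr0//.
Qed.


Section kernel_seq.
Variable l_ : nat -> seq (R * int).
Hypothesis l_P : forall n s, cossum (l_ n) s = ((1 + cos s) / 2) ^+ n.

(** After normalization by the total mass the linear part of the primitive has slope 1 / (2 pi) for
    every n, so subtracting it leaves a multiple of [sinpart]. *)
Let phi n s : R := cosprim (l_ n) s / cosprim (l_ n) (pi *+ 2) - s / (pi *+ 2).

Let phiE n s : phi n s = (cosprim (l_ n) (pi *+ 2))^-1 * sinpart (l_ n) s.
Proof.
have := kernel_prim_pi2_gt0 (l_P n); rewrite /phi /sinpart cosprim_pi2 => L0.
have m0 : cosmean (l_ n) != 0.
  by apply: contraTN L0 => /eqP ->; rewrite mulr0 ltxx.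
have p0 : (pi : R) != 0 by rewrite gt_eqF// pi_gt0.
move: (pi : R) p0 (cosmean _) m0 {L0} => q q0 m m0.
by field; rewrite m0.
Qed.

Let phi_le n x a : D x -> D a -> `|phi n (x - a)| <= 2.
Proof.
rewrite /period /= !in_itv/= => /andP[x0 x2] /andP[a0 a2].
have xa : `|x - a| <= pi *+ 2 by rewrite ler_norml; lra.
have p0 : 0 < (pi *+ 2 : R) by rewrite mulrn_wgt0// pi_gt0.
apply: le_trans (ler_normB _ _) _; rewrite -[2]/(1 + 1) lerD//.
  exact: kernel_prim_bound (l_P n) xa.
by rewrite normrM normfV (gtr0_norm p0) ler_pdivrMr// mul1r.
Qed.

Let int_phi n a :
  mu.-integrable D (EFin \o (fun x => p x * phi n (x - a))) /\
  \int[mu]_(x in D) (p x * phi n (x - a)) = 0.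
Proof.
have mP := measurable_period; have [i0 z0] := int_sinpart (l_ n) a.
under eq_fun do rewrite phiE mulrCA.
by split; [exact: integrable_scale|rewrite RintegralZl// z0 mulr0].
Qed.

(** The limit of [phi n (x - a)] for x in the period different from a, when 0 < a < 2 pi. *)
Let step (a x : R) : R := \1_(`]a, +oo[%classic : set R) x - 1 / 2 - (x - a) / (pi *+ 2).

Let int_step a : 0 < a < pi *+ 2 -> \int[mu]_(x in D) (p x * step a x) = 0.
Proof.
move=> aI; have mP := measurable_period.
have Da : D a by rewrite /period /= in_itv/=; lra.
have mp : measurable_fun D p by apply/measurable_EFinP; exact: measurable_int ip.
have mstep : measurable_fun D (step a).
  apply: (@measurable_funS _ _ _ _ setT) => //.
  apply: measurable_funB.
    by apply: measurable_funB; [exact: measurable_indic|exact: measurable_cst].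
  by apply: continuous_measurable_fun => x; apply: cvgM; [apply: cvgB|]; exact: cvg_cst || exact: cvg_id.
have [] := @dominated_convergence _ _ _ mu D mP
  (fun n x => (p x * phi n (x - a))%:E) (fun x => (p x * step a x)%:E)
  (fun x => (2 * `|p x|)%:E).
- by move=> n; apply: measurable_int; exact: (int_phi n a).1.
- by apply/measurable_EFinP; exact: measurable_funM.
(* At x = a the functions [phi n (x - a)] vanish while [step] takes the value - 1 / 2, so this point
   is left out. *)
- have : mu.-negligible [set a] by apply/negligibleP => //; exact: lebesgue_measure_set1.
  apply: negligibleS => x /= /not_implyP[Dx]; apply: contra_notP => xa.
  apply/cvg_EFin; first by apply: nearW.
  rewrite /comp /=; apply: cvgM; first exact: cvg_cst.
  apply: cvgB; last exact: cvg_cst.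
  move: Dx; rewrite /period /= in_itv/= => /andP[x0 x2].
  rewrite indicE; have [ax|ax|ax] := ltgtP a x.
  - rewrite mem_set/=; last by rewrite in_itv/= ax.
    have -> : 1%:R - 1 / 2 = 1 / 2 :> R by lra.
    by apply: (kernel_prim_cvg_pos l_P); lra.
  - rewrite memNset/=; last by rewrite in_itv/= andbT; apply/negP; rewrite -leNgt ltW.
    have -> : 0%:R - 1 / 2 = - (1 / 2) :> R by lra.
    by apply: (kernel_prim_cvg_neg l_P); lra.
  - by exfalso; apply: xa.
- by apply: integrable_scale; exact: integrable_norm.
- apply: aeW => x n Dx; rewrite /= lee_fin normrM mulrC ler_wpM2r//.
  exact: phi_le.
move=> istep _ cv; rewrite /Rintegral.
have : (fun n => \int[mu]_(x in D) (p x * phi n (x - a))%:E)%E @ \oo --> 0%E.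
  apply: cvg_near_cst; apply: nearW => n.
  have [i0 z0] := int_phi n a.
  rewrite -[LHS]fineK; last exact: integrable_fin_num i0.
  by move: z0; rewrite /Rintegral => ->.
by move=> /(cvg_unique _ cv) -> //.
Qed.

Let F (a : R) := \int[mu]_(x in `]-oo, a]) (p \_ D) x.

Let F_const : exists K, forall a, 0 < a < pi *+ 2 -> F a = K.
Proof.
have mP := measurable_period.
exists (- \int[mu]_(x in D) (p x * (x / (pi *+ 2)))) => a aI.
have mp : measurable_fun D p by apply/measurable_EFinP; exact: measurable_int ip.
have ix : mu.-integrable D (EFin \o (fun x => p x * (x / (pi *+ 2)))).
  apply: (@integrable_mul_bounded _ _ 1 ip).
    apply: (@measurable_funS _ _ _ _ setT) => //.
    by apply: continuous_measurable_fun => x; apply: cvgM; exact: cvg_cst || exact: cvg_id.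
  move=> x; rewrite /period /= in_itv/= => /andP[x0 x2].
  have p0 : 0 < (pi *+ 2 : R) by rewrite mulrn_wgt0// pi_gt0.
  by rewrite ger0_norm ?divr_ge0 ?(ltW p0)// ler_pdivrMr// mul1r.
have iI : mu.-integrable D (EFin \o (fun x => p x * \1_(`]-oo, a]%classic : set R) x)).
  apply: (@integrable_mul_bounded _ _ 1 ip); first exact: measurable_indic.
  by move=> x _; rewrite indicE; case: (_ \in _); rewrite ?normr1 ?normr0.
have p1 : \int[mu]_(x in D) p x = 0.
  by rewrite -(pcos 0); apply: eq_Rintegral => x _; rewrite mul0r cos0 mulr1.
transitivity (\int[mu]_(x in D) (p x * \1_(`]-oo, a]%classic : set R) x)).
  rewrite /F Rintegral_mkcond [RHS]Rintegral_mkcond; apply: eq_Rintegral => x _.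
  rewrite !patchE indicE; case: ifPn => [xa|xa]; case: ifPn => // _;
   by rewrite ?mulr1 ?mulr0.
have p0 : (pi *+ 2 : R) != 0 by rewrite gt_eqF// mulrn_wgt0// pi_gt0.
apply/eqP; rewrite -addr_eq0 -RintegralD//; apply/eqP.
transitivity (- \int[mu]_(x in D) (p x * step a x)); last by rewrite int_step// oppr0.
(* The indicator of x > a is 1 minus that of x <= a. The coefficient depending on a then multiplies
   p alone, which has mean zero. *)
transitivity (- \int[mu]_(x in D) ((1 / 2 + a / (pi *+ 2)) * p x -
    (p x * \1_(`]-oo, a]%classic : set R) x + p x * (x / (pi *+ 2))))); last first.
  congr (- _); apply: eq_Rintegral => x _; rewrite /step !indicE.
  have -> : (x \in (`]a, +oo[%classic : set R)) = ~~ (x \in (`]-oo, a]%classic : set R)).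
    by rewrite !mem_setE !in_itv/= andbT ltNge.
  by move: (pi *+ 2 : R) p0 => q q0; case: (x \in _) => /=; field.
rewrite RintegralB//; [|exact: integrable_scale|exact: (integrableD mP iI ix)].
by rewrite RintegralZl// p1 mulr0 sub0r opprK.
Qed.

(* Testing p against the primitives of the kernels shows that its integral over
   [0, a] does not depend on a. *)
Lemma fourier_kernel_uniq : {ae mu, forall x, D x -> p x = 0}.
Proof.
have mP := measurable_period.
have iR : mu.-integrable [set: R] (EFin \o (p \_ D)).
  rewrite -restrict_EFin; apply/integrable_restrict => //; rewrite setTI//.
have [K FK] := F_const.
have : {ae mu, forall x, derivable F x 1 /\ (F^`())%classic x = (p \_ D) x}.
  apply: FTC1Ny; last exact: integrable_locally_restrict.
  by move=> y; apply: integrableS iR.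
have : {ae mu, forall x, x <> 0 /\ x <> pi *+ 2}.
  have : mu.-negligible ([set 0] `|` [set pi *+ 2]).
    by apply: negligibleU; apply/negligibleP => //; exact: lebesgue_measure_set1.
  apply: negligibleS => x /= /not_andP[]/contrapT ->; by [left|right].
apply: (@filterS2 _ _ (ae_filter_ringOfSetsType mu)) => x [x0 x2] [dF FE] Dx.
have xI : x \in `]0, pi *+ 2[%R.
  move: Dx; rewrite /period /= !in_itv/= => /andP[x0' x2'].
  by rewrite !lt_neqAle x0' x2' !andbT; apply/andP; split; apply/eqP => // /esym.
have <- : (p \_ D) x = p x by rewrite patchE mem_set.
rewrite -FE derive1E -(@near_eq_derive _ _ _ (cst K) F) ?derive_cst//.
apply: filterS (near_in_itvoo xI) => y; rewrite in_itv/= => yI.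
by rewrite FK.
Qed.

End kernel_seq.

Lemma fourier_uniq_real : {ae mu, forall x, D x -> p x = 0}.
Proof.
have /choice[l_ l_P] := @kernel_cossum R; exact: fourier_kernel_uniq l_P.
Qed.

End vanishing_coefficients.

End uniqueness.

(** * Sums over frequency windows *)

(** The frequency window |k| <= n, listed by opposite pairs so that passing from n to n + 1 adds two
    terms at the head. *)
Fixpoint zr (n : nat) : seq int :=
  if n is m.+1 then n%:Z :: - n%:Z :: zr m else [:: 0].

Lemma mem_zr n (k : int) : (k \in zr n) = (`|k| <= n)%N.
Proof. by elim: n => [|n IH]; rewrite ?inE ?in_cons ?IH; lia. Qed.

Lemma zr_uniq n : uniq (zr n).
Proof.
elim: n => [//|n IH]; rewrite [zr _]/= !cons_uniq IH !in_cons !mem_zr; lia.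
Qed.

Section zsums.
Context {V : zmodType}.
Implicit Types F : int -> V.

Lemma big_zrS (n : nat) F :
  \sum_(k <- zr n.+1) F k = F n.+1%:Z + (F (- n.+1%:Z) + \sum_(k <- zr n) F k).
Proof. by rewrite [zr _]/= !big_cons. Qed.

(** Both sums reduce to the entries common to s and t. Shifts and reflections of windows thereby
    become questions about supports. *)
Lemma sum_supp_eq (s t : seq int) F : uniq s -> uniq t ->
  (forall k, F k != 0 -> (k \in s) && (k \in t)) ->
  \sum_(k <- s) F k = \sum_(k <- t) F k.
Proof.
move=> us ut H.
have red (r r' : seq int) : (forall k, F k != 0 -> k \in r') ->
    \sum_(k <- r) F k = \sum_(k <- [seq k <- r | k \in r']) F k.
  move=> Hr; rewrite big_filter [RHS]big_mkcond; apply: eq_bigr => k _.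
  by case: ifPn => // kr; apply/eqP; apply: contraNT kr; exact: Hr.
rewrite (red s t) ?(red t s); try by move=> k /H/andP[].
apply: perm_big; apply: uniq_perm; rewrite ?filter_uniq// => k.
by rewrite !mem_filter andbC.
Qed.

Lemma sum_zr_widen n m F : (n <= m)%N -> (forall k, (n < `|k|)%N -> F k = 0) ->
  \sum_(k <- zr m) F k = \sum_(k <- zr n) F k.
Proof.
move=> nm F0; apply: sum_supp_eq; rewrite ?zr_uniq// => k Fk.
suff : (`|k| <= n)%N by rewrite !mem_zr; lia.
by rewrite leqNgt; apply: contraNN Fk => /F0 ->.
Qed.

Lemma sum_zrN n F : \sum_(k <- zr n) F (- k) = \sum_(k <- zr n) F k.
Proof.
elim: n => [|n IH]; first by rewrite /zr !big_seq1 oppr0.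
by rewrite !big_zrS IH opprK addrCA.
Qed.

Lemma sum_zr_shift n m (j : int) F : (n + `|j| <= m)%N ->
  (forall k, (n < `|k|)%N -> F k = 0) ->
  \sum_(k <- zr m) F (k - j) = \sum_(k <- zr n) F k.
Proof.
move=> nm F0; rewrite -(big_map (fun k => k - j) xpredT F).
apply: sum_supp_eq; rewrite ?zr_uniq ?map_inj_uniq ?zr_uniq//; first exact: addIr.
move=> k Fk; have kn : (`|k| <= n)%N.
  by rewrite leqNgt; apply: contraNN Fk => /F0 ->.
rewrite mem_zr kn andbT; apply/mapP; exists (k + j); rewrite ?addrK// mem_zr; lia.
Qed.

Lemma sum_zr_flip n m (j : int) F : (n + `|j| <= m)%N ->
  (forall k, (n < `|k|)%N -> F k = 0) ->
  \sum_(k <- zr m) F (j - k) = \sum_(k <- zr n) F k.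
Proof.
move=> nm F0; rewrite -sum_zrN -[RHS](@sum_zr_shift n m (- j) F) ?abszN//.
by apply: eq_bigr => k _; rewrite !opprK addrC.
Qed.


End zsums.

Section rsums.
Context {R : realType}.
Implicit Types (F y : int -> R) (phi : nat -> R).

Definition jap (k : int) : R := 1 + `|k|%:R.

Definition harmonic_sum (K : nat) : R := \sum_(m < K) m.+1%:R^-1.

Lemma jap_ge1 k : 1 <= jap k. Proof. by rewrite lerDl. Qed.

Lemma jap_gt0 k : 0 < jap k. Proof. exact: lt_le_trans (jap_ge1 k). Qed.

(** The weights may all vanish, so the total weight is kept as a factor instead of being divided
    out; the induction treats a zero total separately. *)
Lemma jensen (I : eqType) (r : seq I) (P : pred I) (w x : I -> R) :
  (forall i, 0 <= w i) ->
  (\sum_(i <- r | P i) w i * x i) ^+ 2 <=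
  (\sum_(i <- r | P i) w i) * \sum_(i <- r | P i) w i * x i ^+ 2.
Proof.
move=> w0; elim: r => [|i r IH]; first by rewrite !big_nil mulr0 expr0n.
rewrite !big_cons; case: ifP => // _.
move: IH; set a := \sum_(j <- r | _) _; set b := \sum_(j <- r | _) _.
set c := \sum_(j <- r | _) _ => IH.
have b0 : 0 <= b by apply: sumr_ge0.
have c0 : 0 <= c by apply: sumr_ge0 => *; rewrite mulr_ge0// sqr_ge0.
have := w0 i; set u := w i; set v := x i => u0.
suff : 2 * u * v * a <= u * c + u * v ^+ 2 * b by nra.
suff : 2 * v * a <= c + v ^+ 2 * b by nra.
have [b00|bn0] := eqVneq b 0.
  have -> : a = 0 by apply/eqP; rewrite -sqrf_eq0 eq_le sqr_ge0 andbT; nra.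
  by rewrite b00; lra.
have {bn0}b0 : 0 < b by rewrite lt_neqAle eq_sym bn0.
have : 0 <= (v * b - a) ^+ 2 by exact: sqr_ge0.
have : b * (2 * v * a) <= b * (c + v ^+ 2 * b) -> 2 * v * a <= c + v ^+ 2 * b.
  by rewrite ler_pM2l.
move=> H1 H2; apply: H1; nra.
Qed.

Lemma cauchy_weight (I : eqType) (r : seq I) (P : pred I) (q x z : I -> R) :
  (forall i, 0 < q i) ->
  (\sum_(i <- r | P i) x i * z i) ^+ 2 <=
  (\sum_(i <- r | P i) q i * x i ^+ 2) * \sum_(i <- r | P i) z i ^+ 2 / q i.
Proof.
move=> q0; elim: r => [|i r IH]; first by rewrite !big_nil mulr0 expr0n.
rewrite !big_cons; case: ifP => // _.
move: IH; set a := \sum_(j <- r | _) _; set b := \sum_(j <- r | _) _.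
set c := \sum_(j <- r | _) _ => IH.
have b0 : 0 <= b by apply: sumr_ge0 => j _; rewrite mulr_ge0 ?sqr_ge0// ltW.
have c0 : 0 <= c by apply: sumr_ge0 => j _; rewrite divr_ge0 ?sqr_ge0// ltW.
have qi := q0 i.
have -> : (x i * z i + a) ^+ 2 = (x i * z i) ^+ 2 + 2 * (x i * z i) * a + a ^+ 2 by ring.
have -> : (q i * x i ^+ 2 + b) * (z i ^+ 2 / q i + c) =
   (x i * z i) ^+ 2 + (q i * x i ^+ 2 * c + b * (z i ^+ 2 / q i)) + b * c.
  by field; rewrite gt_eqF.
rewrite lerD// lerD2l.
set s := q i * x i ^+ 2 * c; set t := b * (z i ^+ 2 / q i).
have s0 : 0 <= s by rewrite /s mulr_ge0// mulr_ge0 ?sqr_ge0// ltW.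
have t0 : 0 <= t by rewrite /t mulr_ge0// divr_ge0 ?sqr_ge0// ltW.
have st : (x i * z i * a) ^+ 2 <= s * t.
  rewrite /s /t exprMn; have -> : q i * x i ^+ 2 * c * (b * (z i ^+ 2 / q i)) =
    (x i * z i) ^+ 2 * (b * c) by field; rewrite gt_eqF.
  by rewrite ler_wpM2l// sqr_ge0.
have : (2 * (x i * z i) * a) ^+ 2 <= (s + t) ^+ 2.
  have := sqr_ge0 (s - t); nra.
move=> H; apply: le_trans (ler_norm _) _.
by rewrite -ler_sqr ?nnegrE ?addr_ge0// real_normK ?num_real.
Qed.

Lemma sum_zr_abs n phi : (forall m, 0 <= phi m) ->
  \sum_(k <- zr n) phi `|k|%N <= 2 * \sum_(m < n.+1) phi m.
Proof.
move=> phi0; elim: n => [|n IH].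
  by rewrite /zr big_seq1 big_ord1 ler_peMl// ler1n.
rewrite big_zrS abszN absz_nat big_ord_recr mulrDr /=; lra.
Qed.

Lemma harmonic_sum_ge0 K : 0 <= harmonic_sum K.
Proof. by apply: sumr_ge0. Qed.

(** The terms are 1 / (m + 1) - 1 / (K + m + 1). The negative parts, shifted by K, cancel everything
    in the harmonic sum up to K + n beyond its first K terms. *)
Lemma harmonic_telescope K n :
  \sum_(m < n) (K%:R / (m.+1%:R * (K%:R + m.+1%:R))) <= harmonic_sum K.
Proof.
rewrite (eq_bigr (fun m : 'I_n => m.+1%:R^-1 - (K + m).+1%:R^-1)); last first.
  move=> m _; rewrite -addnS natrD.
  have a0 : m.+1%:R != 0 :> R by rewrite pnatr_eq0.
  have b0 : K%:R + m.+1%:R != 0 :> R by rewrite -natrD pnatr_eq0 addnS.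
  by move: (m.+1%:R) (K%:R) a0 b0 => x z x0 xz0; field; rewrite xz0.
rewrite sumrB lerBlDr.
have -> : harmonic_sum K + \sum_(m < n) (K + m).+1%:R^-1 = harmonic_sum (K + n).
  by rewrite /harmonic_sum big_split_ord.
rewrite addnC [leRHS]/harmonic_sum big_split_ord/= lerDl.
by apply: sumr_ge0.
Qed.

End rsums.

(** * Convolution estimates *)

Section convolution_estimates.
Context {R : realType}.
Local Notation jap := (@jap R).
Variables (n : nat) (y : int -> R).
Hypothesis y0 : forall k, 0 <= y k.
Hypothesis y_supp : forall k, (n < `|k|)%N -> y k = 0.

Definition selfconv (z : int -> R) (m : nat) (j : int) : R :=
  \sum_(d <- zr m) z d * z (j - d).

Let g := selfconv y n.

Definition h12sq (z : int -> R) (m : nat) : R := \sum_(k <- zr m) jap k * z k ^+ 2.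

Let E := h12sq y n.

(* Comparable to min(K, 1 + |j|), but smooth enough to telescope. *)
Definition capw (K : nat) (j : int) : R := K%:R * jap j / (K%:R + jap j).

Let g_ge0 j : 0 <= g j.
Proof. by apply: sumr_ge0 => d _; rewrite mulr_ge0. Qed.

Let E_ge0 : 0 <= E.
Proof. by apply: sumr_ge0 => d _; rewrite mulr_ge0 ?sqr_ge0// ltW// jap_gt0. Qed.

Lemma selfconv_supp j : (n + n < `|j|)%N -> g j = 0.
Proof.
move=> jn; rewrite /g /selfconv big_seq big1// => d; rewrite mem_zr => dn.
by rewrite (y_supp (k := j - d)) ?mulr0//; lia.
Qed.

(* Half of the convolution: by symmetry the second factor may be taken at the
   larger frequency, which then absorbs the weight [capw K j]. *)
Let h j : R := \sum_(d <- zr n | (`|d| <= `|j - d|)%N) y d * y (j - d).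

Let g_le_h j : g j <= 2 * h j.
Proof.
have gE : g j = \sum_(d <- zr (n + `|j|)) y d * y (j - d).
  rewrite [RHS](@sum_zr_widen _ n)// ?leq_addr// => k nk.
  by rewrite y_supp// mul0r.
have hE : h j = \sum_(d <- zr (n + `|j|))
    (if (`|d| <= `|j - d|)%N then y d * y (j - d) else 0).
  rewrite [RHS](@sum_zr_widen _ n) ?leq_addr// -?big_mkcond// => k nk.
  by rewrite y_supp// mul0r if_same.
have hE' : h j = \sum_(d <- zr (n + `|j|))
    (if (`|j - d| <= `|d|)%N then y d * y (j - d) else 0).
  rewrite /h big_mkcond -(@sum_zr_flip _ n (n + `|j|) j)//.
    by apply: eq_bigr => d _; rewrite subKr mulrC.
  by move=> k nk; rewrite y_supp// mul0r if_same.
rewrite mulr2n mulrDl mul1r {1}hE hE' gE -big_split/=; apply: ler_sum => d _.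
have P : 0 <= y d * y (j - d) by rewrite mulr_ge0.
by case: ifPn => ?; case: ifPn => ?; rewrite ?addr0 ?add0r ?lerDl//; lia.
Qed.

Variable K : nat.
Hypothesis K0 : (0 < K)%N.

(** A damping of the low factor of the convolution. It is strong enough that the sum of
    [rho d ^+ 2 / jap d] is logarithmic in K, and weak enough that [capw K j] is still absorbed by
    the high factor. *)
Let rho d : R := Num.sqrt (K%:R / (K%:R + jap d)).

Let KR : 0 < K%:R :> R. Proof. by rewrite ltr0n. Qed.

Let rho_gt0 d : 0 < rho d.
Proof. by rewrite sqrtr_gt0 divr_gt0// addr_gt0// jap_gt0. Qed.

Let rho_sq d : rho d ^+ 2 = K%:R / (K%:R + jap d).
Proof. by rewrite sqr_sqrtr// divr_ge0 ?ltW// addr_gt0// jap_gt0. Qed.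

Lemma capw_ge0 j : 0 <= capw K j.
Proof. by rewrite divr_ge0 ?mulr_ge0// ?addr_ge0// ltW// jap_gt0. Qed.

(** The high frequency j - d dominates d and at least half of j. Cleared of denominators, the
    inequality needs only these two comparisons. *)
Let capw_rho (j d : int) : (`|d| <= `|j - d|)%N ->
  capw K j <= 2 * rho d ^+ 2 * jap (j - d).
Proof.
move=> dj; rewrite rho_sq /capw.
have j1 := @jap_gt0 R j; have d1 := @jap_gt0 R d; have e1 := @jap_gt0 R (j - d).
have jle : jap j <= 2 * jap (j - d).
  have : (`|j|%N%:R : R) <= 2 * `|j - d|%N%:R by rewrite -natrM ler_nat; lia.
  by rewrite /jap; move: (`|j|%N%:R) (`|j - d|%N%:R) => a b; lra.
have dle : jap d <= jap (j - d).
  by rewrite /jap lerD2l ler_nat.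
move: (jap j) (jap d) (jap (j - d)) (K%:R) KR j1 d1 e1 jle dle.
move=> a b e k k0 a0 b0 e0 ae be; rewrite ler_pdivrMr ?addr_gt0//.
have -> : 2 * (k / (k + b)) * e * (k + a) = (k * (2 * e) * (k + a)) / (k + b).
  by field; rewrite gt_eqF// addr_gt0.
rewrite ler_pdivlMr ?addr_gt0// -!mulrA ler_wpM2l ?(ltW k0)//.
nra.
Qed.

Let Z := \sum_(d <- zr n) y d * rho d.

Let Z_ge0 : 0 <= Z.
Proof. by apply: sumr_ge0 => d _; rewrite mulr_ge0// ltW. Qed.

Let h_sq j : capw K j * h j ^+ 2 <=
  2 * Z * \sum_(d <- zr n) y d * rho d * (jap (j - d) * y (j - d) ^+ 2).
Proof.
have -> : h j = \sum_(d <- zr n | (`|d| <= `|j - d|)%N) y d * rho d * (y (j - d) / rho d).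
  by apply: eq_bigr => d _; field; rewrite gt_eqF.
apply: (@le_trans _ _ (capw K j * (Z * \sum_(d <- zr n | (`|d| <= `|j - d|)%N)
     y d * rho d * (y (j - d) / rho d) ^+ 2))).
  have w0 d : 0 <= y d * rho d by rewrite mulr_ge0// ltW.
  rewrite ler_wpM2l ?capw_ge0//; apply: le_trans (jensen _ _ _ w0) _.
  apply: ler_wpM2r.
    by apply: sumr_ge0 => d _; rewrite mulr_ge0 ?sqr_ge0// mulr_ge0// ltW.
  rewrite /Z big_mkcond; by apply: ler_sum => d _; case: ifP.
rewrite mulrCA [leRHS]mulrAC [leRHS]mulrC ler_wpM2l// mulr_sumr mulr_sumr [leLHS]big_mkcond.
apply: ler_sum => d _; have R0 := rho_gt0 d.
have nn : 0 <= 2 * (y d * rho d * (jap (j - d) * y (j - d) ^+ 2)).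
  by rewrite !mulr_ge0 ?sqr_ge0// ltW// jap_gt0.
case: ifP => // dj.
have -> : capw K j * (y d * rho d * (y (j - d) / rho d) ^+ 2) =
  capw K j * (y d * rho d * y (j - d) ^+ 2 / rho d ^+ 2).
  by field; rewrite gt_eqF.
rewrite mulrA ler_pdivrMr ?exprn_gt0//.
have -> : 2 * (y d * rho d * (jap (j - d) * y (j - d) ^+ 2)) * rho d ^+ 2 =
  2 * rho d ^+ 2 * jap (j - d) * (y d * rho d * y (j - d) ^+ 2) by ring.
by rewrite ler_wpM2r ?capw_rho// !mulr_ge0 ?sqr_ge0// ltW.
Qed.

Let Z_sq : Z ^+ 2 <= E * (2 * harmonic_sum K).
Proof.
apply: le_trans (cauchy_weight _ _ _ _ (@jap_gt0 R)) _; rewrite ler_wpM2l//.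
apply: le_trans (_ : \sum_(k <- zr n) K%:R / (`|k|%N.+1%:R * (K%:R + `|k|%N.+1%:R)) <= _).
  apply: ler_sum => k _; rewrite rho_sq.
  have -> : `|k|%N.+1%:R = jap k by rewrite /jap -natr1 addrC natr_absz.
  move: (jap k) (@jap_gt0 R k) (K%:R) KR => x x0 z z0.
  rewrite le_eqVlt; apply/orP; left; apply/eqP; field.
  by rewrite !gt_eqF ?addr_gt0.
apply: le_trans (sum_zr_abs n (phi := fun m => K%:R / (m.+1%:R * (K%:R + m.+1%:R))) _) _.
  by move=> m; rewrite divr_ge0// mulr_ge0// addr_ge0.
by rewrite ler_wpM2l// harmonic_telescope.
Qed.

(** With the weight capped at K, squaring a function of H^{1/2} costs one logarithm of K. Summing
    [h_sq] over j and shifting by d yields Z * E, and [Z_sq] turns the remaining Z * Z into E times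
    the harmonic sum. The constant is 4 (from [g_le_h]) times 2 (from [h_sq]) times 2 (from
    [Z_sq]). *)
Lemma selfconv_capw : \sum_(j <- zr (n + n)) capw K j * g j ^+ 2 <=
  16 * E ^+ 2 * harmonic_sum K.
Proof.
apply: (@le_trans _ _ (\sum_(j <- zr (n + n)) 8 * Z *
    \sum_(d <- zr n) y d * rho d * (jap (j - d) * y (j - d) ^+ 2))).
  apply: ler_sum => j _; have H1 := h_sq j.
  apply: (@le_trans _ _ (4 * (capw K j * h j ^+ 2))); last first.
    by rewrite -!mulrA in H1 *; lra.
  rewrite [leRHS]mulrCA ler_wpM2l ?capw_ge0//.
  have -> : 4 * h j ^+ 2 = (2 * h j) ^+ 2 by ring.
  by rewrite ler_sqr ?nnegrE ?(le_trans (g_ge0 j)).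
rewrite -mulr_sumr exchange_big/=.
have -> : \sum_(d <- zr n) \sum_(j <- zr (n + n)) y d * rho d * (jap (j - d) * y (j - d) ^+ 2)
   = Z * E.
  rewrite /Z mulr_suml big_seq [RHS]big_seq; apply: eq_bigr => d; rewrite mem_zr => dn.
  rewrite -mulr_sumr (@sum_zr_shift _ n (n + n) d (fun k => jap k * y k ^+ 2))//.
    by rewrite leq_add2l.
  by move=> k nk; rewrite y_supp// expr0n mulr0.
have := Z_sq; have := E_ge0; set H := harmonic_sum K; move=> E0 ZE.
have -> : 8 * Z * (Z * E) = 8 * E * Z ^+ 2 by ring.
have -> : 16 * E ^+ 2 * H = 8 * E * (E * (2 * H)) by ring.
by rewrite ler_wpM2l// mulr_ge0.
Qed.

End convolution_estimates.

(** * Monotone windows and elementary bounds on sums of inverse powers *)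

Section growth.
Context {R : realType}.

Lemma sum_zr_le (n m : nat) (F : int -> R) : (forall k, 0 <= F k) -> (n <= m)%N ->
  \sum_(k <- zr n) F k <= \sum_(k <- zr m) F k.
Proof.
move=> F0; elim: m => [|m IH]; first by rewrite leqn0 => /eqP ->.
rewrite leq_eqVlt => /predU1P[->//|/IH H].
by rewrite big_zrS; have := F0 m.+1%:Z; have := F0 (- m.+1%:Z); lra.
Qed.

Lemma sum_zr_shift_le (n m : nat) (j : int) (F : int -> R) : (forall k, 0 <= F k) ->
  (n + `|j| <= m)%N -> \sum_(k <- zr n) F k <= \sum_(k <- zr m) F (k - j).
Proof.
move=> F0 nm.
pose G k := if (`|k| <= n)%N then F k else 0.
have -> : \sum_(k <- zr n) F k = \sum_(k <- zr n) G k.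
  by rewrite big_seq [RHS]big_seq; apply: eq_bigr => k; rewrite mem_zr /G => ->.
rewrite -(sum_zr_shift (F := G) nm); last by move=> k; rewrite /G ltnNge => /negbTE ->.
by apply: ler_sum => k _; rewrite /G; case: ifP.
Qed.

Lemma sum_zr_flip_le (n m : nat) (j : int) (F : int -> R) : (forall k, 0 <= F k) ->
  (n + `|j| <= m)%N -> \sum_(k <- zr n) F (j - k) <= \sum_(k <- zr m) F k.
Proof.
move=> F0 nm.
apply: le_trans (sum_zr_shift_le (F := fun k => F (j - k)) (m := m) (j := - j) _ _) _ => //.
  by rewrite abszN.
rewrite -[leRHS]sum_zrN; apply: ler_sum => k _.
by rewrite opprK opprD addrCA subrr addr0.
Qed.

(** Clamping the index of s between A and B keeps the selected increments and makes the full sum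
    over i < K telescope. *)
Lemma clip_sum (s : nat -> R) (A B K : nat) : {homo s : i j / (i <= j)%N >-> i <= j} ->
  (A <= B)%N ->
  \sum_(i < K | (A <= i.+1 < B)%N) (s i.+2 - s i.+1) <= s B - s A.
Proof.
move=> sh AB; pose t i := s (minn (maxn i A) B).
apply: (@le_trans _ _ (\sum_(i < K) (t i.+2 - t i.+1))).
  rewrite big_mkcond; apply: ler_sum => i _; case: ifP => [H|_].
    have -> : t i.+2 = s i.+2 by rewrite /t; congr s; lia.
    by have -> : t i.+1 = s i.+1 by rewrite /t; congr s; lia.
  by rewrite subr_ge0 /t; apply: sh; lia.
have -> : \sum_(i < K) (t i.+2 - t i.+1) = t K.+1 - t 1%N.
  elim: K => [|K IH]; first by rewrite big_ord0 subrr.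
  by rewrite big_ord_recr /= IH; ring.
by rewrite lerB//; apply: sh; lia.
Qed.

Lemma sqrt_diff_ge (m : nat) : (0 < m)%N ->
  1 / Num.sqrt m%:R <= 3 * (Num.sqrt m.+1%:R - Num.sqrt m%:R) :> R.
Proof.
move=> m0; have M1 : 1 <= m%:R :> R by rewrite ler1n.
have r0 : 0 < Num.sqrt m%:R :> R by rewrite sqrtr_gt0; lra.
have s0 : 0 <= Num.sqrt m.+1%:R :> R by rewrite sqrtr_ge0.
have r2 : Num.sqrt m%:R ^+ 2 = m%:R :> R by rewrite sqr_sqrtr//; lra.
have s2 : Num.sqrt m.+1%:R ^+ 2 = m%:R + 1 :> R by rewrite sqr_sqrtr ?ler0n// -natr1.
rewrite ler_pdivrMr//; move: (Num.sqrt m%:R) (Num.sqrt m.+1%:R) r0 s0 r2 s2 => r s r0 s0 r2 s2.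
have sr : s <= 2 * r by rewrite -ler_sqr ?nnegrE ?mulr_ge0 ?(ltW r0)// exprMn; lra.
have e : (s - r) * (s + r) = 1.
  by transitivity (s ^+ 2 - r ^+ 2); [ring|lra].
have d0 : 0 <= s - r by rewrite subr_ge0 -ler_sqr ?nnegrE ?(ltW r0)//; lra.
suff : (s - r) * (s + r) <= 3 * (s - r) * r by rewrite e.
rewrite -subr_ge0; have -> : 3 * (s - r) * r - (s - r) * (s + r) = (s - r) * (2 * r - s).
  by ring.
by rewrite mulr_ge0//; lra.
Qed.

(** The powers m^(1/4) and m^(1/8). Bounding the harmonic sum by a fourth root costs N^(3/8) in the
    cube of the l^1 norm, and against the tail N^(-1/2) this leaves N^(-1/8), which the weights 1 /
    N make summable. *)
Definition qroot (m : nat) : R := Num.sqrt (Num.sqrt m%:R).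
Definition oroot (m : nat) : R := Num.sqrt (qroot m).

Lemma qroot_ge0 m : 0 <= qroot m. Proof. exact: sqrtr_ge0. Qed.
Lemma oroot_ge0 m : 0 <= oroot m. Proof. exact: sqrtr_ge0. Qed.

Lemma oroot2 m : oroot m ^+ 2 = qroot m.
Proof. by rewrite sqr_sqrtr// qroot_ge0. Qed.

Lemma qroot4 m : qroot m ^+ 4 = m%:R.
Proof. by rewrite (exprM _ 2 2) !sqr_sqrtr// sqrtr_ge0. Qed.

Lemma qroot_le i j : (i <= j)%N -> qroot i <= qroot j.
Proof. by move=> ij; rewrite !ler_wsqrtr// ler_nat. Qed.

Lemma oroot_le i j : (i <= j)%N -> oroot i <= oroot j.
Proof. by move=> ij; rewrite ler_wsqrtr// qroot_le. Qed.

Lemma qroot1 : qroot 1 = 1. Proof. by rewrite /qroot !sqrtr1. Qed.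
Lemma oroot1 : oroot 1 = 1. Proof. by rewrite /oroot qroot1 sqrtr1. Qed.

(** With r and s the fourth roots of m and m + 1, s^4 - r^4 = 1 factors as (s - r) times a cubic
    form, which is at most 4 s^3 and hence at most 4 s^4. *)
Lemma harmonic_le_qroot m : harmonic_sum m <= 4 * qroot m :> R.
Proof.
elim: m => [|m IH]; first by rewrite /harmonic_sum big_ord0 mulr_ge0// qroot_ge0.
have -> : harmonic_sum m.+1 = harmonic_sum m + m.+1%:R^-1 :> R.
  by rewrite /harmonic_sum big_ord_recr.
suff : m.+1%:R^-1 <= 4 * (qroot m.+1 - qroot m).
  by move=> H; rewrite (le_trans (lerD IH H))// -mulrDr addrC subrK.
have rs := qroot_le (leqnSn m); have r0 := qroot_ge0 m.
have s1 : 1 <= qroot m.+1 by rewrite -qroot1 qroot_le.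
have s4 : qroot m.+1 ^+ 4 = qroot m ^+ 4 + 1 by rewrite !qroot4 natr1.
have -> : m.+1%:R = qroot m.+1 ^+ 4 :> R by rewrite qroot4.
rewrite -[_^-1]mul1r ler_pdivrMr ?exprn_gt0//; last by lra.
move: (qroot m) (qroot m.+1) rs r0 s1 s4 => r s rs r0 s1 s4.
have e : (s - r) * (s ^+ 3 + s ^+ 2 * r + s * r ^+ 2 + r ^+ 3) = 1.
  transitivity (s ^+ 4 - r ^+ 4); first by ring.
  by rewrite s4; ring.
rewrite -[leLHS]e; have -> : 4 * (s - r) * s ^+ 4 = (s - r) * (4 * s ^+ 4) by ring.
apply: ler_wpM2l; first by lra.
have s3 : s ^+ 3 <= s ^+ 4 by rewrite ler_weXn2l.
have a : s ^+ 2 * r <= s ^+ 3 by rewrite [leRHS]exprSr ler_wpM2l ?sqr_ge0.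
have r2 : r ^+ 2 <= s ^+ 2 by rewrite lerXn2r ?nnegrE//; lra.
have b : s * r ^+ 2 <= s ^+ 3 by rewrite [leRHS]exprS ler_wpM2l//; lra.
have c : r ^+ 3 <= s ^+ 3 by rewrite lerXn2r ?nnegrE//; lra.
lra.
Qed.

(** The discrete form of the fact that x^(-9/8) is the derivative of -8 x^(-1/8). It is derived
    algebraically by factoring s^8 - r^8 = 1 for consecutive eighth roots r and s. *)
Lemma oroot_telescope m : (0 < m)%N ->
  (m.+1%:R * oroot m.+1)^-1 <= 8 * ((oroot m)^-1 - (oroot m.+1)^-1).
Proof.
move=> m0; have rs := oroot_le (leqnSn m).
have r1 : 1 <= oroot m by rewrite -oroot1 oroot_le.
have s8 : oroot m.+1 ^+ 8 = oroot m ^+ 8 + 1.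
  by rewrite !(exprM _ 2 4) !oroot2 !qroot4 natr1.
have -> : m.+1%:R = oroot m.+1 ^+ 8 :> R by rewrite (exprM _ 2 4) oroot2 qroot4.
move: (oroot m) (oroot m.+1) rs r1 s8 => r s rs r1 s8.
have s0 : 0 < s by lra.
have r0 : 0 < r by lra.
have -> : 8 * (r^-1 - s^-1) = 8 * (s - r) / (r * s).
  by field; rewrite !gt_eqF.
rewrite ler_pdivlMr ?mulr_gt0// mulrC ler_pdivrMr ?mulr_gt0 ?exprn_gt0//.
have e : (s - r) * \sum_(i < 8) s ^+ (7 - i) * r ^+ i = 1.
  by rewrite -subrXX s8; ring.
rewrite -[leLHS]mulr1 -[X in _ * X <= _]e.
have -> : 8 * (s - r) * (s ^+ 8 * s) = (s - r) * (8 * s ^+ 9) by ring.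
rewrite mulrCA ler_wpM2l//; first by lra.
have : \sum_(i < 8) s ^+ (7 - i) * r ^+ i <= \sum_(i < 8) s ^+ 7.
  apply: ler_sum => i _; have -> : s ^+ 7 = s ^+ (7 - i) * s ^+ i.
    by rewrite -exprD subnK// -ltnS.
  by rewrite ler_wpM2l ?exprn_ge0 ?(ltW s0)// lerXn2r ?nnegrE ?(ltW s0) ?(ltW r0).
rewrite sumr_const card_ord => H.
have : r * s <= s ^+ 2 by rewrite expr2 ler_wpM2r// ltW.
have -> : 8 * s ^+ 9 = s ^+ 2 * (8 * s ^+ 7) by ring.
move=> H2; apply: ler_pM => //; first by rewrite mulr_ge0// ltW.
  by apply: sumr_ge0 => i _; rewrite mulr_ge0// exprn_ge0 ?(ltW s0) ?(ltW r0).
by rewrite mulr_natl.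
Qed.

Lemma oroot_series K : \sum_(i < K) (i.+1%:R * oroot i.+1)^-1 <= 9 :> R.
Proof.
case: K => [|K]; first by rewrite big_ord0.
(* The first term is 1 = 9 - 8, and each later one is bounded by an increment of the right-hand
   side. *)
suff : \sum_(i < K.+1) (i.+1%:R * oroot i.+1)^-1 <= 9 - 8 * (oroot K.+1)^-1.
  move/le_trans; apply; rewrite lerBlDr lerDl mulr_ge0// invr_ge0 oroot_ge0//.
elim: K => [|K IH]; first by rewrite big_ord1/= oroot1 mulr1 invr1; lra.
rewrite big_ord_recr/=; apply: le_trans (lerD IH (@oroot_telescope K.+1 isT)) _.
by rewrite mulrBr addrA subrK.
Qed.

End growth.

(** * Tails of the convolution and the averaged resonant sum *)

Section resonant_sums.
Context {R : realType}.
Local Notation jap := (@jap R).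
Local Notation harmonic_sum := (@harmonic_sum R).
Variables (n : nat) (y : int -> R).
Hypothesis y0 : forall k, 0 <= y k.
Hypothesis y_supp : forall k, (n < `|k|)%N -> y k = 0.

Let g := selfconv y n.
Let E := h12sq y n.

Let g_ge0 j : 0 <= g j.
Proof. by apply: sumr_ge0 => d _; rewrite mulr_ge0. Qed.

Let E_ge0 : 0 <= E.
Proof. by apply: sumr_ge0 => d _; rewrite mulr_ge0 ?sqr_ge0// ltW// jap_gt0. Qed.

(** For K = 1 the weight [capw] is at least 1 / 2 and the harmonic sum is 1. *)
Lemma selfconv_l2 : \sum_(j <- zr (n + n)) g j ^+ 2 <= 32 * E ^+ 2.
Proof.
have H := selfconv_capw y0 y_supp (K := 1) isT.
have h1 : harmonic_sum 1 = 1 by rewrite /harmonic_sum big_ord1 invr1.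
rewrite h1 mulr1 -/E in H.
have -> : 32 * E ^+ 2 = 2 * (16 * E ^+ 2) by ring.
apply: le_trans (_ : 2 * \sum_(j <- zr (n + n)) capw 1 j * g j ^+ 2 <= _); last first.
  by rewrite ler_wpM2l.
rewrite mulr_sumr; apply: ler_sum => j _.
rewrite mulrA -[leLHS]mul1r ler_wpM2r ?sqr_ge0// /capw mul1r.
have := @jap_ge1 R j; move: (jap j) => x x1.
by rewrite mulrA ler_pdivlMr; lra.
Qed.

(** Bounds the contribution to the cubic term at frequency k of the triples with a given entry above
    the cut-off N. *)
Definition tail_conv (N : nat) (k : int) : R :=
  \sum_(a <- zr n | (N < `|a|)%N) y a * g (a + k).

Lemma tail_conv_sq N k : tail_conv N k ^+ 2 <= 32 * E ^+ 3 / N.+1%:R.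
Proof.
apply: le_trans (cauchy_weight _ _ _ _ (@jap_gt0 R)) _.
have -> : 32 * E ^+ 3 / N.+1%:R = E * (32 * E ^+ 2 / N.+1%:R) by ring.
apply: ler_pM.
- by apply: sumr_ge0 => a _; rewrite mulr_ge0 ?sqr_ge0// ltW// jap_gt0.
- by apply: sumr_ge0 => a _; rewrite divr_ge0 ?sqr_ge0// ltW// jap_gt0.
- rewrite big_mkcond; apply: ler_sum => a _; case: ifP => // _.
  by rewrite mulr_ge0 ?sqr_ge0// ltW// jap_gt0.
apply: (@le_trans _ _ (\sum_(a <- zr n) g (a + k) ^+ 2 / N.+1%:R)).
  rewrite big_mkcond; apply: ler_sum => a _; case: ifPn => Na.
    rewrite ler_wpM2l ?sqr_ge0// lef_pV2 ?posrE ?jap_gt0 ?ltr0n//.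
    by rewrite /jap addrC natr1 ler_nat; lia.
  by rewrite divr_ge0 ?sqr_ge0.
rewrite -mulr_suml ler_wpM2r ?invr_ge0//.
apply: le_trans selfconv_l2.
apply: (@le_trans _ _ (\sum_(a <- zr (n + n + `|k|)) g (a + k) ^+ 2)).
  by apply: sum_zr_le; [move=> a; exact: sqr_ge0|rewrite -addnA leq_addr].
have -> : \sum_(a <- zr (n + n + `|k|)) g (a + k) ^+ 2 = \sum_(j <- zr (n + n)) g j ^+ 2.
  rewrite -(@sum_zr_shift _ (n + n) (n + n + `|k|) (- k) (fun j => g j ^+ 2)).
  - by apply: eq_bigr => a _; rewrite opprK.
  - by rewrite abszN.
  - by move=> j jn; rewrite /g selfconv_supp// expr0n.
by [].
Qed.

Lemma l1_bound N : (\sum_(k <- zr N) y k) ^+ 2 <= E * (2 * harmonic_sum N.+1).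
Proof.
rewrite (eq_bigr (fun k => y k * 1)); last by move=> k _; rewrite mulr1.
apply: le_trans (cauchy_weight _ _ _ _ (@jap_gt0 R)) _.
apply: ler_pM.
- by apply: sumr_ge0 => a _; rewrite mulr_ge0 ?sqr_ge0// ltW// jap_gt0.
- by apply: sumr_ge0 => a _; rewrite divr_ge0 ?sqr_ge0// ltW// jap_gt0.
- have F0 k : 0 <= jap k * y k ^+ 2 by rewrite mulr_ge0 ?sqr_ge0// ltW// jap_gt0.
  have [Nn|nN] := leqP N n; first exact: (sum_zr_le F0).
  rewrite /E /h12sq -[leRHS](@sum_zr_widen _ n N) ?(ltnW nN)//.
  by move=> k nk; rewrite y_supp// expr0n mulr0.
apply: le_trans (sum_zr_abs N (phi := fun m => m.+1%:R^-1) _); last by move=> m.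
apply: ler_sum => k _; rewrite expr1n mul1r /jap.
by rewrite addrC natr1.
Qed.

Section weighted.
Variable K : nat.

(* The harmonic average over the cut-offs N = i + 1 of |e| 1_(|e| <= N < |a|);
   averaging replaces |e| by roughly sqrt(|a||e|) min(1, |a + e| / |a|), which is
   what makes the resonant sum logarithmically smaller than harmonic_sum K. *)
Definition reso_weight (e a : int) : R :=
  \sum_(i < K | (`|e| <= i.+1 < `|a|)%N) `|e|%N%:R / i.+1%:R.

Let reso_weight_ge0 e a : 0 <= reso_weight e a.
Proof. by apply: sumr_ge0 => i _; rewrite divr_ge0. Qed.

Let reso_weight0 e a : ~~ [&& (0 < `|e|)%N, (`|e| < `|a|)%N & (`|e| <= K)%N] ->
  reso_weight e a = 0.
Proof.
move=> H; have [e0|e0] := posnP `|e|%N.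
  by apply: big1 => i _; rewrite e0 mul0r.
rewrite /reso_weight big_pred0// => i; apply/negbTE/negP => H2.
have := ltn_ord i; move: H; rewrite e0/=; lia.
Qed.

(** For N >= |e| the summand |e| / N is at most sqrt|e| / sqrt N, and 1 / sqrt N is at most three
    increments of the square root, which telescope from |e| to |a|. *)
Let reso_weight_sqrt e a : (0 < `|e|)%N -> (`|e| < `|a|)%N ->
  reso_weight e a <= 3 * Num.sqrt `|e|%N%:R *
    (Num.sqrt `|a|%N%:R - Num.sqrt `|e|%N%:R).
Proof.
move=> e0 ea.
have sh : {homo (fun m : nat => Num.sqrt (m%:R : R)) : i j / (i <= j)%N >-> i <= j}.
  by move=> i j ij; rewrite ler_wsqrtr// ler_nat.
have := clip_sum K sh (ltnW ea) => H.
apply: le_trans (ler_wpM2l (_ : 0 <= 3 * Num.sqrt `|e|%N%:R) H); last first.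
  by rewrite mulr_ge0// sqrtr_ge0.
rewrite mulr_sumr; apply: ler_sum => i /andP[ei ia].
have D := @sqrt_diff_ge R i.+1 isT.
have -> : `|e|%N%:R / i.+1%:R = Num.sqrt `|e|%N%:R * (Num.sqrt `|e|%N%:R / i.+1%:R) :> R.
  by rewrite mulrA -expr2 sqr_sqrtr.
rewrite [3 * _]mulrC -mulrA ler_wpM2l ?sqrtr_ge0//; apply: le_trans D.
have i0 : 0 < Num.sqrt (i.+1%:R : R) by rewrite sqrtr_gt0.
rewrite ler_pdivrMr// -[X in _ * X](@sqr_sqrtr _ i.+1%:R)// mul1r expr2 mulrA.
by rewrite mulVf ?gt_eqF// mul1r; exact: sh.
Qed.

(** The squared kernel left after Cauchy-Schwarz in e and in a, each with the weight [jap]; the 9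
    removes the square of the constant in [reso_weight_sqrt]. *)
Let Q e a := reso_weight e a ^+ 2 / (9 * (jap a * jap e)).

Let Q_ge0 e a : 0 <= Q e a.
Proof. by rewrite divr_ge0 ?sqr_ge0// !mulr_ge0// ltW// jap_gt0. Qed.

(* sqrt|a| - sqrt|e| <= (|a| - |e|) / sqrt|a| *)
Let Q_le e a : Q e a <= ((`|a|%N%:R - `|e|%N%:R) / `|a|%N%:R) ^+ 2.
Proof.
have [/and3P[e0 ea eK]|] := boolP [&& (0 < `|e|)%N, (`|e| < `|a|)%N & (`|e| <= K)%N];
  last by move=> H; rewrite /Q reso_weight0// expr0n mul0r sqr_ge0.
have W0 := reso_weight_ge0 e a; have W1 := reso_weight_sqrt e0 ea.
rewrite ler_pdivrMr ?mulr_gt0 ?jap_gt0//.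
have E0 : 0 < `|e|%N%:R :> R by rewrite ltr0n.
have EA : `|e|%N%:R < `|a|%N%:R :> R by rewrite ltr_nat.
rewrite /jap; move: (`|a|%N%:R) (`|e|%N%:R) E0 EA (reso_weight e a) W0 W1.
move=> x z z0 zx w w0 w1; have x0 : 0 < x by lra.
have s0 : 0 < Num.sqrt z by rewrite sqrtr_gt0.
have r0 : 0 < Num.sqrt x by rewrite sqrtr_gt0.
have s2 : Num.sqrt z ^+ 2 = z by rewrite sqr_sqrtr// ltW.
have r2 : Num.sqrt x ^+ 2 = x by rewrite sqr_sqrtr// ltW.
move: (Num.sqrt z) (Num.sqrt x) s0 r0 s2 r2 w1 => s r s0 r0 s2 r2 w1.
have sr : s < r by rewrite -ltr_sqr ?nnegrE ?ltW// s2 r2.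
apply: (@le_trans _ _ ((3 * s * (r - s)) ^+ 2)).
  by rewrite lerXn2r ?nnegrE// mulr_ge0 ?mulr_ge0//; lra.
apply: (@le_trans _ _ (((x - z) / x) ^+ 2 * (9 * (x * z)))); last first.
  by rewrite ler_wpM2l ?sqr_ge0// ler_wpM2l// ler_pM//; lra.
have -> : ((x - z) / x) ^+ 2 * (9 * (x * z)) = (3 * s * ((x - z) / r)) ^+ 2.
  by rewrite -r2 -s2; field; rewrite gt_eqF.
rewrite lerXn2r ?nnegrE//; try by rewrite !mulr_ge0 ?invr_ge0//; lra.
rewrite ler_wpM2l//; first by rewrite mulr_ge0// ltW.
rewrite ler_pdivlMr// -r2 -s2 (_ : r ^+ 2 - s ^+ 2 = (r - s) * (r + s)); last by ring.
by rewrite ler_wpM2l//; lra.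
Qed.

Let Q_le1 e a : Q e a <= (if (`|e| <= K)%N then 1 else 0).
Proof.
case: ifPn => eK; last by rewrite /Q reso_weight0 ?expr0n ?mul0r// (negbTE eK) !andbF.
have [/and3P[e0 ea _]|] := boolP [&& (0 < `|e|)%N, (`|e| < `|a|)%N & (`|e| <= K)%N];
  last by move=> H; rewrite /Q reso_weight0// expr0n mul0r.
apply: le_trans (Q_le _ _) _.
have EA : `|e|%N%:R < `|a|%N%:R :> R by rewrite ltr_nat.
have E0 : 0 <= `|e|%N%:R :> R by [].
rewrite expr_le1// ?ler_pdivrMr ?divr_ge0//; lra.
Qed.

(** A majorant with decay m^(-2) beyond J, written with consecutive factors so that its sum over m
    telescopes. For J = 0 the numerator vanishes, so the zero denominator at m = 0 is harmless. *)
Let psi (J m : nat) : R := 9 * J%:R ^+ 2 / ((m + J)%:R * (m + J).+1%:R).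

(** With J = |e + a|, the difference |a| - |e| is at most both |a| and J, so its quotient by |a| is
    at most 2 J / (|a| + J). Raising the constant 4 of the square to 9 pays for replacing a squared
    denominator by consecutive factors. *)
Let Q_psi e a : Q e a <= psi `|e + a| `|a|.
Proof.
have [/and3P[e0 ea _]|] := boolP [&& (0 < `|e|)%N, (`|e| < `|a|)%N & (`|e| <= K)%N];
  last by move=> H; rewrite /Q reso_weight0// expr0n mul0r /psi divr_ge0// mulr_ge0// sqr_ge0.
apply: le_trans (Q_le _ _) _; rewrite /psi -[(_ + _).+1%:R]natr1 natrD.
have E1 : 1 <= `|e|%N%:R :> R by rewrite ler1n.
have EA : `|e|%N%:R + 1 <= `|a|%N%:R :> R by rewrite natr1 ler_nat.
have DJ : `|a|%N%:R <= `|e|%N%:R + `|(e + a)%R|%N%:R :> R by rewrite -natrD ler_nat; lia.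
move: (`|a|%N%:R) (`|e|%N%:R) (`|(e + a)%R|%N%:R) E1 EA DJ => x z J z1 zx xJ.
have H1 : (x - z) / x <= 2 * J / (x + J).
  have A : (x - z) * x <= J * x by rewrite ler_wpM2r//; lra.
  have B : (x - z) * J <= x * J by rewrite ler_wpM2r//; lra.
  rewrite ler_pdivrMr; last by lra.
  by rewrite mulrAC ler_pdivlMr; lra.
have H0 : 0 <= (x - z) / x by apply: divr_ge0; lra.
apply: (@le_trans _ _ ((2 * J / (x + J)) ^+ 2)).
  by rewrite lerXn2r ?nnegrE//; apply: divr_ge0; lra.
rewrite expr_div_n ler_pdivlMr; last by apply: mulr_gt0; lra.
rewrite mulrAC ler_pdivrMr; last by apply: exprn_gt0; lra.
have -> : (2 * J) ^+ 2 * ((x + J) * (x + J + 1)) = (x + J) * J ^+ 2 * (4 * (x + J + 1)) by ring.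
have -> : 9 * J ^+ 2 * (x + J) ^+ 2 = (x + J) * J ^+ 2 * (9 * (x + J)) by ring.
by rewrite ler_wpM2l ?mulr_ge0 ?sqr_ge0//; lra.
Qed.

Let psi_sum J M : \sum_(m < M) psi J m <= 9 * J%:R.
Proof.
case: J => [|J]; first by rewrite big1 ?mulr0// => m _; rewrite /psi expr0n mulr0 mul0r.
suff -> : \sum_(m < M) psi J.+1 m = 9 * J.+1%:R ^+ 2 * (J.+1%:R^-1 - (M + J.+1)%:R^-1).
  rewrite mulrBr lerBlDr; apply: (@le_trans _ _ (9 * J.+1%:R)).
    by rewrite expr2 -!mulrA mulfV ?mulr1// pnatr_eq0.
  by rewrite lerDl mulr_ge0// mulr_ge0// sqr_ge0.
elim: M => [|M IH]; first by rewrite big_ord0 subrr mulr0.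
rewrite big_ord_recr/= IH /psi addSn -[(M + J.+1).+1%:R]natr1.
have a0 : (M + J.+1)%:R != 0 :> R by rewrite pnatr_eq0 addnS.
have b0 : (M + J.+1)%:R + 1 != 0 :> R by rewrite natr1 pnatr_eq0.
have c0 : J.+1%:R != 0 :> R by rewrite pnatr_eq0.
move: ((M + J.+1)%:R) (J.+1%:R) a0 b0 c0 => x z x0 x1 z0.
by field; rewrite x1 z0.
Qed.

Hypothesis K0 : (0 < K)%N.

Let T j := \sum_(e <- zr n) Q e (j - e).

(** Counting the frequencies |e| <= K bounds T by 4 K, and [psi] bounds it by 18 [jap j]. Using the
    second bound against K and the first against [jap j] in T (K + [jap j]) gives 18 + 4 = 22. *)
Let T_capw j : T j <= 22 * capw K j.
Proof.
have KR : 0 < K%:R :> R by rewrite ltr0n.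
have T1 : T j <= 4 * K%:R.
  apply: (@le_trans _ _ (\sum_(e <- zr n) (if (`|e| <= K)%N then 1 else 0))).
    by apply: ler_sum => e _; exact: Q_le1.
  apply: le_trans (sum_zr_abs n (phi := fun m => if (m <= K)%N then 1 else 0) _) _.
    by move=> m; case: ifP.
  have : \sum_(m < n.+1) (if (m <= K)%N then 1 else 0) <= K.+1%:R :> R.
    elim: n => [|m IH]; first by rewrite big_ord1/= ler1n.
    rewrite big_ord_recr/=; case: ifPn => mK; last by rewrite addr0.
    apply: (@le_trans _ _ (\sum_(i < m.+2) 1)).
      by rewrite [leRHS]big_ord_recr lerD2r; apply: ler_sum => i _; case: ifP.
    by rewrite sumr_const card_ord ler_nat.
  have : 1 <= K%:R :> R by rewrite ler1n.
  rewrite -natr1; lra.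
have T2 : T j <= 18 * jap j.
  apply: (@le_trans _ _ (\sum_(e <- zr n) (fun a => psi `|j| `|a|) (j - e))).
    apply: ler_sum => e _; apply: le_trans (Q_psi _ _) _.
    by rewrite addrCA subrr addr0.
  have psi0 m : 0 <= psi `|j| m by rewrite divr_ge0// mulr_ge0// sqr_ge0.
  apply: le_trans (@sum_zr_flip_le R n (n + `|j|) j (fun a => psi `|j| `|a|) _ _) _ => //.
  apply: le_trans (@sum_zr_abs R _ (psi `|j|) psi0) _.
  by have := psi_sum `|j| (n + `|j|).+1; rewrite /jap; lra.
rewrite /capw; have := @jap_gt0 R j; move: (jap j) T2 => x T2 x0.
rewrite mulrA ler_pdivlMr ?addr_gt0//; nra.
Qed.

(* Hilbert-Schmidt bound in the variable j = a + e. *)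
Lemma resonant_sum_sq :
  (\sum_(e <- zr n) \sum_(a <- zr n) y e * (y a * (reso_weight e a * g (a + e)))) ^+ 2
  <= 3168 * E ^+ 4 * harmonic_sum K.
Proof.
pose S e := \sum_(a <- zr n) y a * (reso_weight e a * g (a + e)).
rewrite (eq_bigr (fun e => y e * S e)); last by move=> e _; rewrite mulr_sumr.
apply: le_trans (cauchy_weight _ _ _ _ (@jap_gt0 R)) _.
rewrite -/(h12sq y n) -/E.
have S2 e : S e ^+ 2 <= E * \sum_(a <- zr n) (reso_weight e a * g (a + e)) ^+ 2 / jap a.
  exact: cauchy_weight (@jap_gt0 R).
(* The factors come from the normalization of [Q], from [T_capw] and from [selfconv_capw]. *)
have -> : 3168 * E ^+ 4 * harmonic_sum K = E * (9 * E * (22 * (16 * E ^+ 2 * harmonic_sum K))).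
  by ring.
rewrite ler_wpM2l//.
apply: (@le_trans _ _ (9 * E * \sum_(e <- zr n) \sum_(a <- zr n) Q e a * g (a + e) ^+ 2)).
  rewrite mulr_sumr; apply: ler_sum => e _.
  apply: (@le_trans _ _ ((E * \sum_(a <- zr n) (reso_weight e a * g (a + e)) ^+ 2 / jap a) / jap e)).
    by rewrite ler_wpM2r ?invr_ge0 ?(ltW (jap_gt0 _)).
  rewrite [9 * E]mulrC -!mulrA ler_wpM2l// mulr_suml mulr_sumr; apply: ler_sum => a _.
  rewrite /Q; have := @jap_gt0 R a; have := @jap_gt0 R e.
  move: (jap a) (jap e) => x z z0 x0; rewrite le_eqVlt; apply/orP; left; apply/eqP.
  by field; rewrite !gt_eqF.
rewrite ler_wpM2l ?mulr_ge0//.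
apply: (@le_trans _ _ (\sum_(e <- zr n) \sum_(j <- zr (n + n)) Q e (j - e) * g j ^+ 2)).
  rewrite big_seq [leRHS]big_seq; apply: ler_sum => e; rewrite mem_zr => en.
  apply: le_trans (@sum_zr_shift_le R n (n + n) e (fun a => Q e a * g (a + e) ^+ 2) _ _) _.
  - by move=> k; rewrite mulr_ge0 ?sqr_ge0.
  - by rewrite leq_add2l.
  by apply: ler_sum => j _; rewrite subrK.
rewrite exchange_big/=.
apply: (@le_trans _ _ (22 * \sum_(j <- zr (n + n)) capw K j * g j ^+ 2)).
  rewrite mulr_sumr; apply: ler_sum => j _; rewrite -mulr_suml mulrA.
  by rewrite ler_wpM2r ?sqr_ge0// T_capw.
by rewrite ler_wpM2l// selfconv_capw.
Qed.

End weighted.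

End resonant_sums.

(** * The cubic nonlinearity in Fourier variables *)

Section complex_basics.
Context {R : realType}.
Local Notation normc := (@ComplexField.Normc.normc R).
Implicit Types z w : R[i].

Lemma cReD z w : complex.Re (z + w) = complex.Re z + complex.Re w.
Proof. by case: z w => [a b] [c d]. Qed.

Lemma cImD z w : complex.Im (z + w) = complex.Im z + complex.Im w.
Proof. by case: z w => [a b] [c d]. Qed.

Lemma cReM z w : complex.Re (z * w) =
  complex.Re z * complex.Re w - complex.Im z * complex.Im w.
Proof. by case: z w => [a b] [c d]. Qed.

Lemma cImM z w : complex.Im (z * w) =
  complex.Re z * complex.Im w + complex.Im z * complex.Re w.
Proof. by case: z w => [a b] [c d]. Qed.

Lemma cReJ z : complex.Re (conjc z) = complex.Re z.
Proof. by case: z. Qed.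

Lemma cImJ z : complex.Im (conjc z) = - complex.Im z.
Proof. by case: z. Qed.

Lemma Re_sum (I : Type) (r : seq I) (P : pred I) (F : I -> R[i]) :
  complex.Re (\sum_(i <- r | P i) F i) = \sum_(i <- r | P i) complex.Re (F i).
Proof. by apply: (big_morph _ cReD). Qed.

Lemma Im_sum (I : Type) (r : seq I) (P : pred I) (F : I -> R[i]) :
  complex.Im (\sum_(i <- r | P i) F i) = \sum_(i <- r | P i) complex.Im (F i).
Proof. by apply: (big_morph _ cImD). Qed.

Lemma normc_sq z : normc z ^+ 2 = complex.Re z ^+ 2 + complex.Im z ^+ 2.
Proof. by case: z => a b /=; rewrite sqr_sqrtr// addr_ge0// sqr_ge0. Qed.

Lemma normc_ge0 z : 0 <= normc z.
Proof. by case: z => a b; exact: sqrtr_ge0. Qed.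

Lemma normc_conj z : normc (conjc z) = normc z.
Proof. by case: z => a b; rewrite /= sqrrN. Qed.

Lemma mulcJ z : z * conjc z = (normc z ^+ 2)%:C%C.
Proof.
rewrite normc_sq; case: z => a b; apply/eqP; rewrite eq_complex /=.
by apply/andP; split; apply/eqP; ring.
Qed.

Lemma Im_le_normc z : `|complex.Im z| <= normc z.
Proof.
rewrite -ler_sqr ?nnegrE ?normc_ge0// real_normK ?num_real// normc_sq.
by rewrite lerDr sqr_ge0.
Qed.

Lemma Re_le_normc z : `|complex.Re z| <= normc z.
Proof.
rewrite -ler_sqr ?nnegrE ?normc_ge0// real_normK ?num_real// normc_sq.
by rewrite lerDl sqr_ge0.
Qed.

Lemma normcD_le z w : normc (z + w) <= normc z + normc w.
Proof. exact: le_normcD. Qed.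

Lemma normc_sum (I : Type) (r : seq I) (P : pred I) (F : I -> R[i]) :
  normc (\sum_(i <- r | P i) F i) <= \sum_(i <- r | P i) normc (F i).
Proof.
elim/big_rec2: _ => [|i x z _ H]; first by rewrite ComplexField.Normc.normc0.
by apply: le_trans (normcD_le _ _) _; rewrite lerD2l.
Qed.

End complex_basics.

Section cubic_sums.
Context {R : realType}.
Local Notation normc := (@ComplexField.Normc.normc R).
Local Notation jap := (@jap R).
Local Notation harmonic_sum := (@harmonic_sum R).
Implicit Types c : int -> R[i].

Definition trunc (n : nat) c (k : int) : R[i] := if (`|k| <= n)%N then c k else 0.

(* The k-th Fourier coefficient of |S|^2 S for S = \sum_(|a| <= n) c_a e^{iax}. *)
Definition cub (n : nat) c (k : int) : R[i] :=
  \sum_(a <- zr n) \sum_(d <- zr n) c a * c d * conjc (trunc n c (a + d - k)).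

Definition cconv (n : nat) c (j : int) : R[i] :=
  \sum_(a <- zr n) c a * trunc n c (j - a).

(* The mean of |S|^4 over the circle, as the l^2 norm of the coefficients of S^2. *)
Definition quartic (n : nat) c : R := \sum_(j <- zr (n + n)) normc (cconv n c j) ^+ 2.

Lemma trunc_supp n c k : (n < `|k|)%N -> trunc n c k = 0.
Proof. by rewrite /trunc ltnNge => /negbTE ->. Qed.

Lemma sum_zr_trunc (V : zmodType) n c (F : int -> R[i] -> V) :
  \sum_(k <- zr n) F k (c k) = \sum_(k <- zr n) F k (trunc n c k).
Proof.
by rewrite big_seq [RHS]big_seq; apply: eq_bigr => k; rewrite mem_zr /trunc => ->.
Qed.

Lemma cub_cconv n c k :
  cub n c k = \sum_(j <- zr (n + n)) cconv n c j * conjc (trunc n c (j - k)).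
Proof.
under [RHS]eq_bigr do rewrite mulr_suml.
rewrite exchange_big/= /cub big_seq [RHS]big_seq; apply: eq_bigr => a; rewrite mem_zr => an.
rewrite (sum_zr_trunc n c (fun d z => c a * z * conjc (trunc n c (a + d - k)))).
rewrite -(@sum_zr_shift _ n (n + n) a
  (fun d => c a * trunc n c d * conjc (trunc n c (a + d - k)))).
- by apply: eq_bigr => j _; rewrite [a + _]addrC subrK.
- by rewrite leq_add2l.
- by move=> d dn; rewrite trunc_supp// mulr0 mul0r.
Qed.

(** Rewriting the pairing through the coefficients of S^2 makes its reality visible: w = 1 gives a
    sum of squared moduli, and w = k gives the momentum identity. *)
Lemma sum_conj_cub n c (w : int -> R[i]) :
  \sum_(k <- zr n) w k * conjc (c k) * cub n c k =
  \sum_(j <- zr (n + n)) cconv n c j *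
     \sum_(k <- zr n) w k * conjc (c k * trunc n c (j - k)).
Proof.
under eq_bigr do rewrite cub_cconv mulr_sumr.
rewrite exchange_big/=; apply: eq_bigr => j _; rewrite mulr_sumr.
by apply: eq_bigr => k _; rewrite rmorphM; ring.
Qed.

Lemma quarticE n c : (quartic n c)%:C%C = \sum_(k <- zr n) conjc (c k) * cub n c k.
Proof.
transitivity (\sum_(k <- zr n) 1 * conjc (c k) * cub n c k); last first.
  by apply: eq_bigr => k _; rewrite mul1r.
rewrite sum_conj_cub /quartic rmorph_sum; apply: eq_bigr => j _.
transitivity (cconv n c j * conjc (cconv n c j)); first by rewrite mulcJ.
congr (_ * _); rewrite /cconv rmorph_sum.
by apply: eq_bigr => k _; rewrite mul1r.
Qed.

Lemma quartic_ge0 n c : 0 <= quartic n c.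
Proof. by apply: sumr_ge0 => j _; exact: sqr_ge0. Qed.

(** This expresses the translation invariance of the quartic energy, which survives truncation: up
    to a factor 2 the sum is that of j |G_j|^2, with G_j the coefficients of S^2. *)
Lemma momentum_cub n c :
  complex.Im (\sum_(k <- zr n) k%:~R * conjc (c k) * cub n c k) = 0.
Proof.
rewrite sum_conj_cub; set S := \sum_(j <- _) _.
(* The symmetry k <-> j - k replaces the factor k by j / 2. *)
have half j : (\sum_(k <- zr n) k%:~R * conjc (c k * trunc n c (j - k))) *+ 2 =
    j%:~R * conjc (cconv n c j).
  pose F k := k%:~R * conjc (trunc n c k * trunc n c (j - k)).
  have FE : \sum_(k <- zr n) k%:~R * conjc (c k * trunc n c (j - k)) = \sum_(k <- zr n) F k.
    by rewrite (sum_zr_trunc n c (fun k z => k%:~R * conjc (z * trunc n c (j - k)))).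
  have FE' : \sum_(k <- zr n) F k = \sum_(k <- zr n) F (j - k).
    rewrite -(@sum_zr_flip _ n (n + `|j|) j F)//; last first.
      by move=> k kn; rewrite /F trunc_supp// mul0r conjc0 mulr0.
    rewrite [RHS](_ : _ = \sum_(k <- zr (n + `|j|)) F (j - k))//.
    symmetry; apply: (sum_zr_widen (F := fun k => F (j - k))); first exact: leq_addr.
    by move=> k kn; rewrite /F subKr (@trunc_supp n c k)// mulr0 conjc0 mulr0.
  rewrite mulr2n {1}FE FE FE' -{1}FE' -big_split/= /cconv.
  rewrite (sum_zr_trunc n c (fun k z => z * trunc n c (j - k))) rmorph_sum mulr_sumr.
  by apply: eq_bigr => k _; rewrite /F subKr !rmorphM rmorphB/=; ring.
have S2 : S *+ 2 = \sum_(j <- zr (n + n)) (j%:~R * normc (cconv n c j) ^+ 2)%:C%C.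
  rewrite -sumrMnl; apply: eq_bigr => j _.
  rewrite -mulrnAr half mulrCA mulcJ.
  by rewrite [RHS]rmorphM/= rmorph_int.
have : complex.Im (S *+ 2) = 0 by rewrite S2 Im_sum big1.
by rewrite mulr2n cImD; lra.
Qed.

End cubic_sums.

(** * Truncation errors of the cubic term, controlled by an even majorant of the coefficients *)

Section cubic_estimates.
Context {R : realType}.
Local Notation normc := (@ComplexField.Normc.normc R).
Local Notation jap := (@jap R).
Local Notation harmonic_sum := (@harmonic_sum R).
Variables (n : nat) (c : int -> R[i]) (y : int -> R).
Hypothesis y0 : forall k, 0 <= y k.
Hypothesis y_supp : forall k, (n < `|k|)%N -> y k = 0.
Hypothesis y_even : forall k, y (- k) = y k.
Hypothesis cy : forall k, (`|k| <= n)%N -> normc (c k) <= y k.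

Let g := selfconv y n.
Let E := h12sq y n.

Let E_ge0 : 0 <= E.
Proof. by apply: sumr_ge0 => d _; rewrite mulr_ge0 ?sqr_ge0// ltW// jap_gt0. Qed.

Let g_ge0 j : 0 <= g j.
Proof. by apply: sumr_ge0 => d _; rewrite mulr_ge0. Qed.

Let trunc_le N k : (N <= n)%N -> normc (trunc N c k) <= (if (`|k| <= N)%N then y k else 0).
Proof.
move=> Nn; rewrite /trunc; case: ifPn => kN; last by rewrite ComplexField.Normc.normc0.
by apply: cy; exact: leq_trans kN Nn.
Qed.

Let trunc_le_y N k : (N <= n)%N -> normc (trunc N c k) <= y k.
Proof. by move=> /(@trunc_le _ k)/le_trans; apply; case: ifP. Qed.

Let cub_trunc N k : (N <= n)%N -> cub N c k = \sum_(a <- zr n) \sum_(d <- zr n)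
  trunc N c a * trunc N c d * conjc (trunc N c (a + d - k)).
Proof.
move=> Nn; rewrite [RHS](@sum_zr_widen _ N)//; last first.
  by move=> a aN; apply: big1 => d _; rewrite (@trunc_supp _ N c a)// !mul0r.
rewrite /cub (sum_zr_trunc N c (fun a z => \sum_(d <- zr N)
   z * c d * conjc (trunc N c (a + d - k)))).
apply: eq_bigr => a _; rewrite [RHS](@sum_zr_widen _ N)//; last first.
  by move=> d dN; rewrite (@trunc_supp _ N c d)// mulr0 mul0r.
exact: (sum_zr_trunc N c (fun d z => trunc N c a * z * conjc (trunc N c (a + d - k)))).
Qed.

Let far N k : R := if (N < `|k|)%N then 1 else 0.

Let far_ge0 N k : 0 <= far N k. Proof. by rewrite /far; case: ifP. Qed.

Let term_diff N a d b : (N <= n)%N ->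
  normc (trunc n c a * trunc n c d * conjc (trunc n c b) -
         trunc N c a * trunc N c d * conjc (trunc N c b)) <=
  (far N a + far N d + far N b) * (y a * y d * y b).
Proof.
move=> Nn.
have P : normc (trunc n c a * trunc n c d * conjc (trunc n c b)) <= y a * y d * y b.
  rewrite !ComplexField.Normc.normcM normc_conj.
  by rewrite !ler_pM ?mulr_ge0 ?normc_ge0 ?trunc_le_y.
have Y0 : 0 <= y a * y d * y b by rewrite !mulr_ge0.
have big x : 0 <= x -> normc (trunc n c a * trunc n c d * conjc (trunc n c b)) <=
    (1 + x) * (y a * y d * y b).
  by move=> x0; apply: le_trans P _; rewrite ler_peMl// lerDl.
have [aN|aN] := leqP `|a| N; last first.
  rewrite (@trunc_supp _ N c a)// !mul0r subr0 {1}/far aN -!addrA.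
  by apply: big; rewrite addr_ge0.
have [dN|dN] := leqP `|d| N; last first.
  rewrite (@trunc_supp _ N c d)// mulr0 mul0r subr0 {2}/far dN addrAC addrC.
  by apply: big; rewrite addr_ge0.
have [bN|bN] := leqP `|b| N; last first.
  rewrite (@trunc_supp _ N c b)// conjc0 mulr0 subr0 {3}/far bN addrC.
  by apply: big; rewrite addr_ge0.
rewrite /trunc aN dN bN !(leq_trans _ Nn)// subrr ComplexField.Normc.normc0.
by rewrite mulr_ge0// !addr_ge0.
Qed.

Let tail_reflect N k : \sum_(a <- zr n) far N a * y a * g (k - a) = tail_conv n y N k.
Proof.
rewrite -[LHS]sum_zrN [RHS]big_mkcond; apply: eq_bigr => a _.
by rewrite /far abszN y_even opprK [k + a]addrC; case: ifP; rewrite ?mul1r ?mul0r.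
Qed.

(** A product of three coefficients changes under truncation only if one of its frequencies exceeds
    N. The three cases give the same [tail_conv]: the first two by symmetry in a and d, the
    conjugated one after a change of variable. Evenness of y makes the sign of the reflected
    frequencies irrelevant. *)
Lemma cub_dist N k : (N <= n)%N ->
  normc (cub n c k - cub N c k) <= 3 * tail_conv n y N k.
Proof.
move=> Nn; rewrite !cub_trunc// -sumrB.
apply: le_trans (normc_sum _ _ _) _.
apply: (@le_trans _ _ (\sum_(a <- zr n) \sum_(d <- zr n)
    (far N a + far N d + far N (a + d - k)) * (y a * y d * y (a + d - k)))).
  apply: ler_sum => a _; rewrite -sumrB; apply: le_trans (normc_sum _ _ _) _.
  by apply: ler_sum => d _; exact: term_diff.
have S1 : \sum_(a <- zr n) \sum_(d <- zr n) far N a * (y a * y d * y (a + d - k))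
    = tail_conv n y N k.
  rewrite -tail_reflect; apply: eq_bigr => a _; rewrite /g /selfconv mulr_sumr.
  apply: eq_bigr => d _; rewrite -(y_even (a + d - k)).
  by rewrite (_ : - (a + d - k) = k - a - d); [ring|lia].
have S2 : \sum_(a <- zr n) \sum_(d <- zr n) far N d * (y a * y d * y (a + d - k))
    = tail_conv n y N k.
  rewrite -S1 exchange_big; apply: eq_bigr => a _; apply: eq_bigr => d _.
  by rewrite [d + a]addrC; ring.
have S3 : \sum_(a <- zr n) \sum_(d <- zr n) far N (a + d - k) * (y a * y d * y (a + d - k))
    = tail_conv n y N k.
  transitivity (\sum_(a <- zr n) \sum_(b <- zr n) y a * (far N b * y b * y (b + k - a))).
    apply: eq_bigr => a _.
    pose F b := y a * (far N b * y b * y (b + k - a)).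
    rewrite -(@sum_zr_shift _ n (n + `|k - a|) (k - a) F)//; last first.
      by move=> b bn; rewrite /F (y_supp bn) mulr0 mul0r mulr0.
    rewrite [RHS](@sum_zr_widen _ n) ?leq_addr//.
      apply: eq_bigr => d _; rewrite /F (_ : d - (k - a) = a + d - k); last by lia.
      by rewrite (_ : a + d - k + k - a = d); [ring|lia].
    move=> d dn; rewrite /F (_ : d - (k - a) + k - a = d); last by lia.
    by rewrite (y_supp dn) !mulr0.
  rewrite exchange_big /tail_conv [RHS]big_mkcond; apply: eq_bigr => b _.
  transitivity (far N b * y b * \sum_(a <- zr n) y a * y (b + k - a)).
    by rewrite mulr_sumr; apply: eq_bigr => a _; ring.
  by rewrite /far; case: ifP => _; rewrite ?mul1r ?mul0r.
rewrite (eq_bigr (fun a => \sum_(d <- zr n) far N a * (y a * y d * y (a + d - k)) +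
   \sum_(d <- zr n) far N d * (y a * y d * y (a + d - k)) +
   \sum_(d <- zr n) far N (a + d - k) * (y a * y d * y (a + d - k)))); last first.
  by move=> a _; rewrite -!big_split/=; apply: eq_bigr => d _; ring.
by rewrite !big_split/= S1 S2 S3; lra.
Qed.

(** Young's inequality: for fixed a and d, the sum over k of the third factor is at most the whole
    l^1 norm. *)
Lemma cub_l1 N : (N <= n)%N ->
  \sum_(k <- zr N) normc (cub N c k) <= (\sum_(k <- zr N) y k) ^+ 3.
Proof.
move=> Nn; pose z k := if (`|k| <= N)%N then y k else 0.
have z0 k : 0 <= z k by rewrite /z; case: ifP.
have zE : \sum_(k <- zr N) y k = \sum_(k <- zr N) z k.
  by rewrite big_seq [RHS]big_seq; apply: eq_bigr => k; rewrite mem_zr /z => ->.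
apply: (@le_trans _ _ (\sum_(k <- zr N) \sum_(a <- zr N) \sum_(d <- zr N)
    z a * z d * z (a + d - k))).
  apply: ler_sum => k _; apply: le_trans (normc_sum _ _ _) _.
  rewrite big_seq [leRHS]big_seq; apply: ler_sum => a; rewrite mem_zr => aN.
  apply: le_trans (normc_sum _ _ _) _.
  rewrite big_seq [leRHS]big_seq; apply: ler_sum => d; rewrite mem_zr => dN.
  rewrite !ComplexField.Normc.normcM normc_conj /z aN dN -/(z (a + d - k)).
  rewrite !ler_pM ?mulr_ge0 ?normc_ge0 ?trunc_le//; apply: cy; exact: leq_trans Nn.
rewrite exchange_big/= zE; set W := \sum_(k <- zr N) z k.
apply: (@le_trans _ _ (\sum_(a <- zr N) \sum_(d <- zr N) z a * z d * W)); last first.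
  under eq_bigr do rewrite -mulr_suml -mulr_sumr.
  by rewrite -!mulr_suml -/W !exprS expr0 mulr1 mulrA.
apply: ler_sum => a _; rewrite exchange_big/=; apply: ler_sum => d _.
rewrite -mulr_sumr ler_wpM2l ?mulr_ge0//.
apply: le_trans (@sum_zr_flip_le R N (N + `|a + d|) (a + d) z _ _) _ => //.
rewrite (@sum_zr_widen _ N)// ?leq_addr// => k kN.
by rewrite /z leqNgt kN.
Qed.

(** The embedding of H^{1/2} in L^4, read off the coefficients of S^2. *)
Lemma quartic_le : quartic n c <= 32 * E ^+ 2.
Proof.
apply: le_trans (selfconv_l2 y0 y_supp); apply: ler_sum => j _.
rewrite lerXn2r ?nnegrE ?normc_ge0 ?g_ge0//; apply: le_trans (normc_sum _ _ _) _.
rewrite big_seq [leRHS]big_seq; apply: ler_sum => a; rewrite mem_zr => an.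
by rewrite ComplexField.Normc.normcM ler_pM ?normc_ge0 ?cy ?trunc_le_y.
Qed.

Let tail_ge0 N k : 0 <= tail_conv n y N k.
Proof. by apply: sumr_ge0 => a _; rewrite mulr_ge0// g_ge0. Qed.

Let tail_sup N : R := Num.sqrt (32 * E ^+ 3 / N.+1%:R).

Let tail_le_sup N k : tail_conv n y N k <= tail_sup N.
Proof.
have X0 : 0 <= 32 * E ^+ 3 / N.+1%:R by rewrite divr_ge0// mulr_ge0// exprn_ge0.
rewrite -ler_sqr ?nnegrE ?sqrtr_ge0// /tail_sup sqr_sqrtr//.
exact: tail_conv_sq.
Qed.

(** With p the eighth root of N + 1, the square of the left-hand side is at most (8 E p^2)^3 * 32
    E^3 / p^8, which is the square of 128 E^3 / p. *)
Lemma cub_l1_tail N : (0 < N)%N ->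
  (\sum_(k <- zr N) y k) ^+ 3 * tail_sup N <= 128 * E ^+ 3 / oroot N.
Proof.
move=> N0; have L0 : 0 <= \sum_(k <- zr N) y k by apply: sumr_ge0.
have X0 : 0 <= 32 * E ^+ 3 / N.+1%:R by rewrite divr_ge0// mulr_ge0// exprn_ge0.
have T0 : 0 <= tail_sup N by exact: sqrtr_ge0.
have T2 : tail_sup N ^+ 2 <= 32 * E ^+ 3 / N.+1%:R by rewrite sqr_sqrtr.
have L2 : (\sum_(k <- zr N) y k) ^+ 2 <= 8 * E * qroot N.+1.
  apply: le_trans (l1_bound y_supp N) _; rewrite -/E.
  have := @harmonic_le_qroot R N.+1; have -> : 8 * E * qroot N.+1 = E * (2 * (4 * qroot N.+1)).
    by ring.
  by move=> H; rewrite ler_wpM2l// ler_wpM2l.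
have q4 := @qroot4 R N.+1.
have p2 := @oroot2 R N.+1.
have p0 : 0 < @oroot R N.+1.
  by apply: lt_le_trans (oroot_le (_ : (1 <= N.+1)%N)); rewrite ?oroot1.
have pN0 : 0 < @oroot R N.
  by apply: lt_le_trans (oroot_le (_ : (1 <= N)%N)); rewrite ?oroot1.
apply: (@le_trans _ _ (128 * E ^+ 3 / oroot N.+1)); last first.
  rewrite ler_wpM2l ?mulr_ge0 ?exprn_ge0// lef_pV2 ?posrE//.
  exact: oroot_le.
rewrite -ler_sqr ?nnegrE ?mulr_ge0 ?exprn_ge0 ?invr_ge0 ?(ltW p0)//.
rewrite exprMn -exprM mulnC exprM.
apply: (@le_trans _ _ ((8 * E * qroot N.+1) ^+ 3 * (32 * E ^+ 3 / N.+1%:R))).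
  rewrite ler_pM ?exprn_ge0 ?sqr_ge0// lerXn2r ?nnegrE ?sqr_ge0//.
  by rewrite !mulr_ge0// qroot_ge0.
rewrite -q4 -p2; move: (oroot N.+1) p0 => p p0.
rewrite le_eqVlt; apply/orP; left; apply/eqP; field; rewrite gt_eqF//.
Qed.

Lemma cond_zr N (F : int -> R) : (N <= n)%N ->
  \sum_(k <- zr N) F k = \sum_(k <- zr n | (`|k| <= N)%N) F k.
Proof.
move=> Nn; rewrite [RHS]big_mkcond [RHS](@sum_zr_widen _ N)//.
  by rewrite big_seq [RHS]big_seq; apply: eq_bigr => k; rewrite mem_zr => ->.
by move=> k kN; rewrite leqNgt kN.
Qed.

(* [harmonic_sum K] is the total weight of the cut-offs, so the averaged defect
   is o(1) as K grows, uniformly in n. *)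
Lemma energy_defect_le K : (0 < K <= n)%N ->
  \sum_(i < K) i.+1%:R^-1 * \sum_(k <- zr i.+1)
    (2 * `|k|%N%:R * y k + normc (cub i.+1 c k)) * normc (cub n c k - cub i.+1 c k)
  <= 6 * Num.sqrt (3168 * E ^+ 4 * harmonic_sum K) + 3456 * E ^+ 3.
Proof.
move=> /andP[K0 Kn].
have iK (i : 'I_K) : (i.+1 <= n)%N by exact: leq_trans Kn.
(* The linear part of the gradient gives 6 = 2 * 3 and the cubic part 384 = 3 * 128, the 3 being
   that of [cub_dist]. *)
apply: (@le_trans _ _ (\sum_(i < K) (i.+1%:R^-1 * (\sum_(k <- zr i.+1)
    `|k|%N%:R * y k * tail_conv n y i.+1 k) * 6 +
    384 * E ^+ 3 * (i.+1%:R * oroot i.+1)^-1))).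
  apply: ler_sum => i _; have i0 : 0 < i.+1%:R :> R by rewrite ltr0n.
  have -> : i.+1%:R^-1 * (\sum_(k <- zr i.+1) `|k|%N%:R * y k * tail_conv n y i.+1 k) * 6 +
    384 * E ^+ 3 * (i.+1%:R * oroot i.+1)^-1 = i.+1%:R^-1 * ((\sum_(k <- zr i.+1)
       6 * (`|k|%N%:R * y k * tail_conv n y i.+1 k)) + 3 * (128 * E ^+ 3 / oroot i.+1)).
    by rewrite -mulr_sumr invfM; ring.
  rewrite ler_wpM2l ?invr_ge0//.
  apply: (@le_trans _ _ (\sum_(k <- zr i.+1) (6 * (`|k|%N%:R * y k * tail_conv n y i.+1 k) +
      3 * (normc (cub i.+1 c k) * tail_conv n y i.+1 k)))).
    apply: ler_sum => k _; have D := cub_dist k (iK i).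
    have -> : 6 * (`|k|%N%:R * y k * tail_conv n y i.+1 k) +
      3 * (normc (cub i.+1 c k) * tail_conv n y i.+1 k) =
      (2 * `|k|%N%:R * y k + normc (cub i.+1 c k)) * (3 * tail_conv n y i.+1 k) by ring.
    by rewrite ler_wpM2l// addr_ge0 ?normc_ge0// !mulr_ge0.
  rewrite big_split/= lerD2l -mulr_sumr ler_wpM2l//.
  apply: le_trans (cub_l1_tail (ltn0Sn i)).
  apply: (@le_trans _ _ (\sum_(k <- zr i.+1) normc (cub i.+1 c k) * tail_sup i.+1)).
    by apply: ler_sum => k _; rewrite ler_wpM2l ?normc_ge0.
  by rewrite -mulr_suml ler_wpM2r ?sqrtr_ge0// cub_l1.
rewrite big_split/= -mulr_suml -mulr_sumr.
(* Exchanging the sums collects, for each pair of frequencies e and a, all cut-offs separating them,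
   which is [reso_weight]. *)
have H1 : \sum_(i < K) i.+1%:R^-1 * (\sum_(k <- zr i.+1)
    `|k|%N%:R * y k * tail_conv n y i.+1 k) <= Num.sqrt (3168 * E ^+ 4 * harmonic_sum K).
  apply: le_trans (ler_norm _) _; rewrite -sqrtr_sqr ler_wsqrtr//.
  apply: le_trans (resonant_sum_sq y0 y_supp K0); rewrite le_eqVlt; apply/orP; left.
  apply/eqP; congr (_ ^+ 2).
  transitivity (\sum_(i < K) \sum_(e <- zr n) \sum_(a <- zr n)
     y e * (y a * ((if (`|e| <= i.+1 < `|a|)%N then `|e|%N%:R / i.+1%:R else 0) * g (a + e)))).
    apply: eq_bigr => i _; rewrite (cond_zr _ (iK i)) big_mkcond mulr_sumr.
    apply: eq_bigr => e _; case: ifPn => ei; last first.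
      by rewrite mulr0 big1// => a _; rewrite mul0r !mulr0.
    have -> : tail_conv n y i.+1 e = \sum_(a <- zr n)
        (if (i.+1 < `|a|)%N then y a * g (a + e) else 0).
      by rewrite /tail_conv big_mkcond.
    rewrite !mulr_sumr; apply: eq_bigr => a _.
    by rewrite /=; case: ifP => _; rewrite ?(mulr0, mul0r)//; field.
  rewrite exchange_big; apply: eq_bigr => e _; rewrite exchange_big; apply: eq_bigr => a _.
  have -> : @reso_weight R K e a = \sum_(i < K)
      (if (`|e| <= i.+1 < `|a|)%N then `|e|%N%:R / i.+1%:R else 0).
    by rewrite /reso_weight big_mkcond.
  by rewrite mulr_suml !mulr_sumr.
have H2 : 384 * E ^+ 3 * (\sum_(i < K) (i.+1%:R * oroot i.+1)^-1) <= 384 * E ^+ 3 * 9.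
  apply: ler_wpM2l; last exact: oroot_series.
  by apply: mulr_ge0; [exact: ler0n|exact: exprn_ge0].
have -> : 3456 * E ^+ 3 = 384 * E ^+ 3 * 9 by ring.
by rewrite lerD// mulrC ler_wpM2l.
Qed.

End cubic_estimates.

(** * Trigonometric polynomials on the circle *)

Section torus_integral.
Context {R : realType}.
Notation mu := (@lebesgue_measure R).
Notation D := (@period R).
Local Notation normc := (@ComplexField.Normc.normc R).
Implicit Types f g : R -> R[i].

Definition cintegrable f :=
  mu.-integrable D (EFin \o (fun x => complex.Re (f x))) /\
  mu.-integrable D (EFin \o (fun x => complex.Im (f x))).

Definition cmeasurable f :=
  measurable_fun D (fun x => complex.Re (f x)) /\
  measurable_fun D (fun x => complex.Im (f x)).

Definition cbounded f := exists M, forall x, D x -> normc (f x) <= M.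

Let mP := @measurable_period R.

Lemma integrable_addR (p q : R -> R) : mu.-integrable D (EFin \o p) ->
  mu.-integrable D (EFin \o q) -> mu.-integrable D (EFin \o (fun x => p x + q x)).
Proof. by move=> ip iq; exact: (integrableD mP ip iq). Qed.

Lemma integrable_oppR (p : R -> R) : mu.-integrable D (EFin \o p) ->
  mu.-integrable D (EFin \o (fun x => - p x)).
Proof.
move=> ip; have := @integrable_scale R (-1) p ip.
by under eq_fun do rewrite mulN1r.
Qed.

Lemma cmeasurableM f g : cmeasurable f -> cmeasurable g -> cmeasurable (fun x => f x * g x).
Proof.
move=> [f1 f2] [g1 g2]; split.
  by under eq_fun do rewrite cReM; apply: measurable_funB; exact: measurable_funM.
by under eq_fun do rewrite cImM; apply: measurable_funD; exact: measurable_funM.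
Qed.

Lemma cmeasurableD f g : cmeasurable f -> cmeasurable g -> cmeasurable (fun x => f x + g x).
Proof.
move=> [f1 f2] [g1 g2]; split.
  by under eq_fun do rewrite cReD; exact: measurable_funD.
by under eq_fun do rewrite cImD; exact: measurable_funD.
Qed.

Lemma cmeasurable_cst z : cmeasurable (fun=> z).
Proof. by split; exact: measurable_cst. Qed.

Lemma cmeasurableJ f : cmeasurable f -> cmeasurable (fun x => conjc (f x)).
Proof.
move=> [f1 f2]; split; first by under eq_fun do rewrite cReJ.
by under eq_fun do rewrite cImJ; exact: measurableT_comp.
Qed.

Lemma cmeasurable_sum (I : Type) (s : seq I) (F : I -> R -> R[i]) :
  (forall i, cmeasurable (F i)) -> cmeasurable (fun x => \sum_(i <- s) F i x).
Proof.
move=> mF; elim: s => [|i s IH].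
  by under eq_fun do rewrite big_nil; exact: cmeasurable_cst.
by under eq_fun do rewrite big_cons; exact: cmeasurableD.
Qed.

Lemma cboundedM f g : cbounded f -> cbounded g -> cbounded (fun x => f x * g x).
Proof.
move=> [M fM] [N gN]; exists (M * N) => x Dx.
by rewrite ComplexField.Normc.normcM ler_pM ?normc_ge0 ?fM ?gN.
Qed.

Lemma cboundedD f g : cbounded f -> cbounded g -> cbounded (fun x => f x + g x).
Proof.
move=> [M fM] [N gN]; exists (M + N) => x Dx.
by apply: le_trans (normcD_le _ _) _; rewrite lerD ?fM ?gN.
Qed.

Lemma cbounded_cst z : cbounded (fun=> z).
Proof. by exists (normc z). Qed.

Lemma cboundedJ f : cbounded f -> cbounded (fun x => conjc (f x)).
Proof. by move=> [M fM]; exists M => x Dx; rewrite normc_conj fM. Qed.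

Lemma cbounded_sum (I : Type) (s : seq I) (F : I -> R -> R[i]) :
  (forall i, cbounded (F i)) -> cbounded (fun x => \sum_(i <- s) F i x).
Proof.
move=> mF; elim: s => [|i s IH].
  by under eq_fun do rewrite big_nil; exact: cbounded_cst.
by under eq_fun do rewrite big_cons; exact: cboundedD.
Qed.

Lemma cintegrable_bounded f : cmeasurable f -> cbounded f -> cintegrable f.
Proof.
move=> [f1 f2] [M fM].
have i1 := @integrable_period_cst R 1.
split.
  have := @integrable_mul_bounded R (cst 1) _ M i1 f1; under eq_fun do rewrite mul1r.
  by apply => x Dx; apply: le_trans (Re_le_normc _) (fM _ Dx).
have := @integrable_mul_bounded R (cst 1) _ M i1 f2; under eq_fun do rewrite mul1r.
by apply => x Dx; apply: le_trans (Im_le_normc _) (fM _ Dx).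
Qed.

Lemma cintegrableD f g : cintegrable f -> cintegrable g -> cintegrable (fun x => f x + g x).
Proof.
move=> [f1 f2] [g1 g2]; split.
  by under eq_fun do rewrite cReD; exact: integrable_addR.
by under eq_fun do rewrite cImD; exact: integrable_addR.
Qed.

Lemma cintegrableM f g : cintegrable f -> cmeasurable g -> cbounded g ->
  cintegrable (fun x => f x * g x).
Proof.
move=> [f1 f2] [g1 g2] [M gM].
have b1 x : D x -> `|complex.Re (g x)| <= M.
  by move=> Dx; apply: le_trans (Re_le_normc _) (gM _ Dx).
have b2 x : D x -> `|complex.Im (g x)| <= M.
  by move=> Dx; apply: le_trans (Im_le_normc _) (gM _ Dx).
split.
  under eq_fun do rewrite cReM.
  by apply: integrable_addR; [|apply: integrable_oppR]; exact: (@integrable_mul_bounded R _ _ M).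
under eq_fun do rewrite cImM.
by apply: integrable_addR; exact: (@integrable_mul_bounded R _ _ M).
Qed.

Lemma torus_intD f g : cintegrable f -> cintegrable g ->
  torus_int (fun x => f x + g x) = torus_int f + torus_int g.
Proof.
move=> [f1 f2] [g1 g2]; rewrite /torus_int; apply/eqP; rewrite eq_complex /=.
by apply/andP; split; apply/eqP; rewrite -RintegralD//; apply: eq_Rintegral => x _;
  rewrite ?cReD ?cImD.
Qed.

Lemma torus_intZ z f : cintegrable f -> torus_int (fun x => z * f x) = z * torus_int f.
Proof.
move=> [f1 f2]; case: z => a b; rewrite /torus_int; apply/eqP; rewrite eq_complex /=.
have i1 := @integrable_scale R a _ f1; have i2 := @integrable_scale R b _ f1.
have i3 := @integrable_scale R a _ f2; have i4 := @integrable_scale R b _ f2.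
apply/andP; split; apply/eqP.
  rewrite -!RintegralZl// -RintegralB//.
  by apply: eq_Rintegral => x _; case: (f x).
rewrite -!RintegralZl// -RintegralD//.
by apply: eq_Rintegral => x _; case: (f x).
Qed.

Lemma eq_torus_int f g : (forall x, D x -> f x = g x) -> torus_int f = torus_int g.
Proof.
move=> fg; rewrite /torus_int; congr (_ +i* _)%C; apply: eq_Rintegral => x /set_mem Dx;
  by rewrite fg.
Qed.

Lemma torus_int0 : torus_int (fun=> 0 : R[i]) = 0 :> R[i].
Proof.
by rewrite /torus_int !Rintegral_cst ?mul0r.
Qed.

Lemma torus_int_sum (I : Type) (s : seq I) (F : I -> R -> R[i]) :
  (forall i, cmeasurable (F i)) -> (forall i, cbounded (F i)) ->
  torus_int (fun x => \sum_(i <- s) F i x) = \sum_(i <- s) torus_int (F i).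
Proof.
move=> mF bF; elim: s => [|i s IH].
  by rewrite big_nil -[RHS]torus_int0; apply: eq_torus_int => x _; rewrite big_nil.
rewrite big_cons -IH -torus_intD.
- by apply: eq_torus_int => x _; rewrite big_cons.
- exact: cintegrable_bounded.
- by apply: cintegrable_bounded; [exact: cmeasurable_sum|exact: cbounded_sum].
Qed.

End torus_integral.

Section exponentials.
Context {R : realType}.
Notation mu := (@lebesgue_measure R).
Notation D := (@period R).
Local Notation normc := (@ComplexField.Normc.normc R).
Implicit Types (k : int) (c : int -> R[i]).

Definition ek k (x : R) : R[i] := expi (k%:~R * x).

Lemma ek0 x : ek 0 x = 1.
Proof. by rewrite /ek /expi mul0r cos0 sin0. Qed.

Lemma ekD k l x : ek (k + l) x = ek k x * ek l x.
Proof.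
rewrite /ek /expi intrD mulrDl cosD sinD; apply/eqP; rewrite eq_complex /=.
by apply/andP; split; apply/eqP; ring.
Qed.

Lemma ekN k x : ek (- k) x = conjc (ek k x).
Proof. by rewrite /ek /expi mulrNz mulNr cosN sinN. Qed.

Lemma normc_ek k x : normc (ek k x) = 1.
Proof. by rewrite /ek /expi /= cos2Dsin2 sqrtr1. Qed.

Lemma cmeasurable_ek k : cmeasurable (ek k).
Proof.
split.
  by have := @measurable_cos_shift R k 0; under eq_fun do rewrite subr0.
by have := @measurable_sin_shift R k 0; under eq_fun do rewrite subr0.
Qed.

Lemma cbounded_ek k : cbounded (ek k).
Proof. by exists 1 => x _; rewrite normc_ek. Qed.

Lemma int_period_derive (F f : R -> R) : (forall x : R, is_derive x 1 F (f x)) ->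
  continuous f -> \int[mu]_(x in D) f x = F (pi *+ 2) - F 0.
Proof.
move=> dF cf.
have cF : continuous F.
  move=> x; apply/differentiable_continuous/derivable1_diffP.
  by case: (dF x).
have p0 : 0 < (pi *+ 2 : R) by rewrite mulrn_wgt0// pi_gt0.
have := @continuous_FTC2 R f F 0 (pi *+ 2) p0 (continuous_subspaceT cf).
rewrite /Rintegral /period => -> //.
  split; first by move=> x _; case: (dF x).
  - by apply: cvg_at_right_filter; exact: cF.
  - by apply: cvg_at_left_filter; exact: cF.
by move=> x _; rewrite derive1E; apply: derive_val.
Qed.

Lemma torus_int_ek k : torus_int (ek k) = if k == 0 then (pi *+ 2)%:C%C else 0.
Proof.
case: eqVneq => [->|k0].
  rewrite (@eq_torus_int R _ (fun=> 1)); last by move=> x _; exact: ek0.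
  transitivity ((1 * fine (mu D)) +i* (0 * fine (mu D)))%C.
    by rewrite -!Rintegral_cst//; exact: measurable_period.
  have p0 : 0 < (pi *+ 2 : R) by rewrite mulrn_wgt0// pi_gt0.
  by rewrite mul0r mul1r /period lebesgue_measure_itv/= lte_fin p0 sube0.
have kR : k%:~R != 0 :> R by rewrite intr_eq0.
have cc : continuous (fun x : R => cos (k%:~R * x)).
  move=> x; apply: (@continuous_comp _ _ _ (fun y : R => (k%:~R : R) * y) (@cos R)); last exact: continuous_cos.
  by apply: cvgM; [exact: cvg_cst|exact: cvg_id].
have cs : continuous (fun x : R => sin (k%:~R * x)).
  move=> x; apply: (@continuous_comp _ _ _ (fun y : R => (k%:~R : R) * y) (@sin R)); last exact: continuous_sin.
  by apply: cvgM; [exact: cvg_cst|exact: cvg_id].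
have dk (x : R) : is_derive x 1 (fun y : R => k%:~R * y) k%:~R.
  rewrite (_ : (fun y => _) = k%:~R \*: @id R)//.
  by apply: is_derive_eq; rewrite /GRing.scale/= mulr1.
rewrite /torus_int /=.
have d1 (x : R) : is_derive x 1 (fun x => k%:~R^-1 * sin (k%:~R * x) : R) (cos (k%:~R * x)).
  rewrite (_ : (fun x => _) = k%:~R^-1 \*: (@sin R \o (fun y => k%:~R * y)))//.
  by apply: is_derive_eq; rewrite /GRing.scale/= mulrCA mulVf ?mulr1.
have d2 (x : R) : is_derive x 1 (fun x => - k%:~R^-1 * cos (k%:~R * x) : R) (sin (k%:~R * x)).
  rewrite (_ : (fun x => _) = (- k%:~R^-1) \*: (@cos R \o (fun y => k%:~R * y)))//.
  apply: is_derive_eq; rewrite /GRing.scale/=.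
  by move: (sin _) => s; field.
rewrite (int_period_derive d1 cc) (int_period_derive d2 cs).
by rewrite sin_int_pi2 cos_int_pi2 !mulr0 sin0 cos0 mulr0 !subrr.
Qed.

Definition trigpoly (n : nat) c (x : R) : R[i] := \sum_(a <- zr n) c a * ek a x.

Lemma cmeasurable_trigpoly n c : cmeasurable (trigpoly n c).
Proof.
by apply: cmeasurable_sum => a; apply: cmeasurableM;
  [exact: cmeasurable_cst|exact: cmeasurable_ek].
Qed.

Lemma cbounded_trigpoly n c : cbounded (trigpoly n c).
Proof.
by apply: cbounded_sum => a; apply: cboundedM;
  [exact: cbounded_cst|exact: cbounded_ek].
Qed.

Lemma fourierE (f : R -> R[i]) k :
  fourier f k = ((pi *+ 2)^-1)%:C%C * torus_int (fun x => f x * ek (- k) x).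
Proof.
by rewrite /fourier; congr (_ * _); apply: eq_torus_int => x _; rewrite /ek mulrNz mulNr.
Qed.

Let p2 : (pi *+ 2 : R) != 0.
Proof. by rewrite gt_eqF// mulrn_wgt0// pi_gt0. Qed.

Let p2C : ((pi *+ 2)^-1)%:C%C * (pi *+ 2)%:C%C = 1 :> R[i].
Proof. by rewrite -rmorphM/= mulVf// rmorph1. Qed.

Lemma torus_int_scale_ek z k : ((pi *+ 2)^-1)%:C%C * torus_int (fun x => z * ek k x) =
  if k == 0 then z else 0.
Proof.
rewrite torus_intZ; last first.
  by apply: cintegrable_bounded; [exact: cmeasurable_ek|exact: cbounded_ek].
rewrite torus_int_ek; case: ifP => _; last by rewrite !mulr0.
by rewrite mulrCA p2C mulr1.
Qed.

Lemma sum_zr_pick n c k :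
  \sum_(a <- zr n) (if a == k then c a else 0) = trunc n c k.
Proof.
rewrite /trunc -big_mkcond; case: ifPn => kn.
  by rewrite -big_filter filter_pred1_uniq ?zr_uniq ?mem_zr// big_seq1.
rewrite big_seq_cond big_pred0// => a; rewrite mem_zr.
by case: eqVneq => [->|]; rewrite ?(negbTE kn) ?andbF.
Qed.

Let nice_term z k : cmeasurable (fun x => z * ek k x) /\ cbounded (fun x => z * ek k x).
Proof.
by split; [apply: cmeasurableM; [exact: cmeasurable_cst|exact: cmeasurable_ek]|
           apply: cboundedM; [exact: cbounded_cst|exact: cbounded_ek]].
Qed.

Lemma fourier_trigpoly n c k : fourier (trigpoly n c) k = trunc n c k.
Proof.
rewrite fourierE (@eq_torus_int R _ (fun x => \sum_(a <- zr n) c a * ek (a - k) x)); last first.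
  by move=> x _; rewrite /trigpoly mulr_suml; apply: eq_bigr => a _; rewrite -mulrA ekD.
rewrite torus_int_sum; [|by move=> a; apply: (nice_term _ _).1|by move=> a; apply: (nice_term _ _).2].
rewrite mulr_sumr -sum_zr_pick; apply: eq_bigr => a _.
by rewrite torus_int_scale_ek subr_eq0.
Qed.

Lemma cubicE (f : R -> R[i]) x : cubic f x = f x * f x * conjc (f x).
Proof. by rewrite /cubic sqr_normc; ring. Qed.

Lemma cmeasurable_cubic (f : R -> R[i]) : cmeasurable f -> cmeasurable (cubic f).
Proof.
move=> mf; rewrite (_ : cubic f = (fun x => f x * f x * conjc (f x))); last first.
  by apply/funext => x; rewrite cubicE.
by apply: cmeasurableM; [exact: cmeasurableM|exact: cmeasurableJ].
Qed.

Lemma cbounded_cubic (f : R -> R[i]) : cbounded f -> cbounded (cubic f).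
Proof.
move=> mf; rewrite (_ : cubic f = (fun x => f x * f x * conjc (f x))); last first.
  by apply/funext => x; rewrite cubicE.
by apply: cboundedM; [exact: cboundedM|exact: cboundedJ].
Qed.

Lemma fourier_cubic_trigpoly n c k : fourier (cubic (trigpoly n c)) k = cub n c k.
Proof.
rewrite fourierE (@eq_torus_int R _ (fun x => \sum_(a <- zr n) \sum_(d <- zr n) \sum_(b <- zr n)
   (c a * c d * conjc (c b)) * ek (a + d - b - k) x)); last first.
  move=> x _; rewrite cubicE {1}/trigpoly !mulr_suml; apply: eq_bigr => a _.
  rewrite {1}/trigpoly mulr_sumr !mulr_suml; apply: eq_bigr => d _.
  rewrite /trigpoly rmorph_sum mulr_sumr mulr_suml; apply: eq_bigr => b _.
  by rewrite !ekD !ekN rmorphM /=; ring.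
have n1 a d : cmeasurable (fun x => \sum_(b <- zr n)
   (c a * c d * conjc (c b)) * ek (a + d - b - k) x).
  by apply: cmeasurable_sum => b; apply: (nice_term _ _).1.
have n2 a d : cbounded (fun x => \sum_(b <- zr n)
   (c a * c d * conjc (c b)) * ek (a + d - b - k) x).
  by apply: cbounded_sum => b; apply: (nice_term _ _).2.
rewrite torus_int_sum; [|by move=> a; exact: cmeasurable_sum|by move=> a; exact: cbounded_sum].
rewrite mulr_sumr; apply: eq_bigr => a _.
rewrite torus_int_sum; [|by move=> d|by move=> d].
rewrite mulr_sumr; apply: eq_bigr => d _.
rewrite torus_int_sum; [|by move=> b; apply: (nice_term _ _).1|by move=> b; apply: (nice_term _ _).2].
transitivity (c a * c d * conjc (\sum_(b <- zr n) (if b == a + d - k then c b else 0))).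
  rewrite rmorph_sum mulr_sumr mulr_sumr; apply: eq_bigr => b _.
  rewrite torus_int_scale_ek (_ : (a + d - b - k == 0) = (b == a + d - k)); last by lia.
  by rewrite /=; case: ifP => _; rewrite ?rmorph0 ?mulr0.
by rewrite sum_zr_pick.
Qed.

(** Pairing |S|^2 S with the conjugate of S reduces the integral to Fourier coefficients already
    computed, and [quarticE] sums them. *)
Lemma int_quartic_trigpoly n c :
  \int[mu]_(x in D) normc (trigpoly n c x) ^+ 4 = pi *+ 2 * quartic n c.
Proof.
set S := trigpoly n c.
have mS : cmeasurable S by exact: cmeasurable_trigpoly.
have bS : cbounded S by exact: cbounded_trigpoly.
have E : torus_int (fun x => conjc (S x) * cubic S x) = (pi *+ 2 * quartic n c)%:C%C.
  rewrite (@eq_torus_int R _ (fun x => \sum_(k <- zr n) conjc (c k) * (cubic S x * ek (- k) x))); last first.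
    move=> x _; rewrite {1}/S /trigpoly rmorph_sum mulr_suml; apply: eq_bigr => k _.
    by rewrite rmorphM ekN /=; ring.
  have nk k : cmeasurable (fun x => cubic S x * ek (- k) x).
    by apply: cmeasurableM; [exact: cmeasurable_cubic|exact: cmeasurable_ek].
  have bk k : cbounded (fun x => cubic S x * ek (- k) x).
    by apply: cboundedM; [exact: cbounded_cubic|exact: cbounded_ek].
  rewrite torus_int_sum; last 2 first.
  - by move=> k; apply: cmeasurableM => //; exact: cmeasurable_cst.
  - by move=> k; apply: cboundedM => //; exact: cbounded_cst.
  rewrite rmorphM/= quarticE mulr_sumr; apply: eq_bigr => k _.
  rewrite torus_intZ; last exact: cintegrable_bounded.
  rewrite mulrCA; congr (_ * _).
  by rewrite -fourier_cubic_trigpoly fourierE mulrA [X in X * _]mulrC p2C mul1r.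
have -> : pi *+ 2 * quartic n c = complex.Re (torus_int (fun x => conjc (S x) * cubic S x)).
  by rewrite E.
rewrite /torus_int /=; apply: eq_Rintegral => x _; rewrite cubicE.
have -> : conjc (S x) * (S x * S x * conjc (S x)) = (S x * conjc (S x)) * (S x * conjc (S x)) by ring.
by rewrite mulcJ -rmorphM/= -exprD.
Qed.

End exponentials.

(** * Dominated convergence and uniqueness for complex-valued functions *)

Section fourier_uniqueness.
Context {R : realType}.
Notation mu := (@lebesgue_measure R).
Notation D := (@period R).
Local Notation normc := (@ComplexField.Normc.normc R).
Implicit Types f g h : R -> R[i].

Let mP := @measurable_period R.

Lemma torus_cdominated (h_ : nat -> R -> R[i]) h (H : R -> \bar R) :
  (forall n, cmeasurable (h_ n)) -> cmeasurable h ->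
  {ae mu, forall x, D x -> complex.Re (h_ n x) @[n --> \oo] --> complex.Re (h x) /\
                           complex.Im (h_ n x) @[n --> \oo] --> complex.Im (h x)} ->
  mu.-integrable D H ->
  {ae mu, forall x, D x -> forall n, ((normc (h_ n x))%:E <= H x)%E} ->
  [/\ cintegrable h,
      complex.Re (torus_int (h_ n)) @[n --> \oo] --> complex.Re (torus_int h) &
      complex.Im (torus_int (h_ n)) @[n --> \oo] --> complex.Im (torus_int h)].
Proof.
move=> mh_ mh ch iH hH.
have real_case (p_ : nat -> R -> R) (p : R -> R) :
    (forall n, measurable_fun D (p_ n)) -> measurable_fun D p ->
    {ae mu, forall x, D x -> p_ n x @[n --> \oo] --> p x} ->
    {ae mu, forall x, D x -> forall n, (`|p_ n x|%:E <= H x)%E} ->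
    mu.-integrable D (EFin \o p) /\
    \int[mu]_(x in D) p_ n x @[n --> \oo] --> \int[mu]_(x in D) p x.
  move=> mp_ mp cp pH.
  have [] := @dominated_convergence _ _ _ mu D mP (fun n x => (p_ n x)%:E)
    (fun x => (p x)%:E) H.
  - by move=> n; apply/measurable_EFinP; exact: mp_.
  - exact/measurable_EFinP.
  - apply: (@filterS _ _ (ae_filter_ringOfSetsType mu) _ _ _ cp).
    by move=> x /= cx Dx; apply/cvg_EFin; [exact: nearW|exact: cx].
  - exact: iH.
  - apply: (@filterS _ _ (ae_filter_ringOfSetsType mu) _ _ _ pH).
    by move=> x /= px n Dx; have := px Dx n.
  move=> ip _ cv; split => //; rewrite /Rintegral.
  by apply: fine_cvg; rewrite fineK//; exact: integrable_fin_num ip.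
have [||||i1 c1] := real_case (fun n x => complex.Re (h_ n x)) (fun x => complex.Re (h x)).
- by move=> n; apply: (mh_ n).1.
- exact: mh.1.
- apply: (@filterS _ _ (ae_filter_ringOfSetsType mu) _ _ _ ch).
  by move=> x /= H0 Dx; apply: (H0 Dx).1.
- apply: (@filterS _ _ (ae_filter_ringOfSetsType mu) _ _ _ hH).
  by move=> x /= H0 Dx n; apply: le_trans (H0 Dx n); rewrite lee_fin Re_le_normc.
have [||||i2 c2] := real_case (fun n x => complex.Im (h_ n x)) (fun x => complex.Im (h x)).
- by move=> n; apply: (mh_ n).2.
- exact: mh.2.
- apply: (@filterS _ _ (ae_filter_ringOfSetsType mu) _ _ _ ch).
  by move=> x /= H0 Dx; apply: (H0 Dx).2.
- apply: (@filterS _ _ (ae_filter_ringOfSetsType mu) _ _ _ hH).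
  by move=> x /= H0 Dx n; apply: le_trans (H0 Dx n); rewrite lee_fin Im_le_normc.
by split.
Qed.

Lemma fourier_uniq f g : cintegrable f -> cintegrable g ->
  (forall k, fourier f k = fourier g k) -> {ae mu, forall x, D x -> f x = g x}.
Proof.
move=> If Ig fg.
pose h x := f x + (-1) * g x.
have Ih : cintegrable h.
  apply: cintegrableD => //.
  have := cintegrableM Ig (cmeasurable_cst (-1)) (cbounded_cst (-1)).
  by under eq_fun do rewrite mulrC.
have hk k : torus_int (fun x => h x * ek k x) = 0.
  have p2 : ((pi *+ 2 : R)^-1)%:C%C != 0.
    by rewrite fmorph_eq0 invr_eq0 gt_eqF// mulrn_wgt0// pi_gt0.
  have := fg (- k); rewrite !fourierE opprK => /(mulfI p2) E.
  have nf := cintegrableM If (cmeasurable_ek k) (cbounded_ek k).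
  have ng := cintegrableM Ig (cmeasurable_ek k) (cbounded_ek k).
  transitivity (torus_int (fun x => f x * ek k x + (-1) * (g x * ek k x))).
    by apply: eq_torus_int => x _; rewrite /h; ring.
  rewrite torus_intD//; first by rewrite torus_intZ// E mulN1r subrr.
  have := cintegrableM ng (cmeasurable_cst (-1)) (cbounded_cst (-1)).
  by under eq_fun do rewrite mulrC.
pose p x := complex.Re (h x); pose q x := complex.Im (h x).
have [ip iq] := Ih.
have icos (r : R -> R) k : mu.-integrable D (EFin \o r) ->
    mu.-integrable D (EFin \o (fun x => r x * cos (k%:~R * x))).
  move=> ir; apply: (@integrable_mul_bounded R _ _ 1 ir); first exact: (cmeasurable_ek k).1.
  by move=> x _; exact: cos_max.
have isin (r : R -> R) k : mu.-integrable D (EFin \o r) ->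
    mu.-integrable D (EFin \o (fun x => r x * sin (k%:~R * x))).
  move=> ir; apply: (@integrable_mul_bounded R _ _ 1 ir); first exact: (cmeasurable_ek k).2.
  by move=> x _; exact: sin_max.
have e1 (k : int) : \int[mu]_(x in D) (p x * cos (k%:~R * x)) -
             \int[mu]_(x in D) (q x * sin (k%:~R * x)) = 0.
  rewrite -RintegralB; [|exact: mP|exact: icos|exact: isin].
  have := congr1 (@complex.Re R) (hk k); rewrite /torus_int /= => <-.
  by apply: eq_Rintegral => x _; rewrite cReM.
have e2 (k : int) : \int[mu]_(x in D) (p x * sin (k%:~R * x)) +
             \int[mu]_(x in D) (q x * cos (k%:~R * x)) = 0.
  rewrite -RintegralD; [|exact: mP|exact: isin|exact: icos].
  have := congr1 (@complex.Im R) (hk k); rewrite /torus_int /= => <-.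
  by apply: eq_Rintegral => x _; rewrite cImM.
have int_cosN (r : R -> R) (k : int) : \int[mu]_(x in D) (r x * cos ((- k)%:~R * x)) =
    \int[mu]_(x in D) (r x * cos (k%:~R * x)).
  by apply: eq_Rintegral => x _; rewrite mulrNz mulNr cosN.
have int_sinN (r : R -> R) (k : int) : mu.-integrable D (EFin \o r) ->
   \int[mu]_(x in D) (r x * sin ((- k)%:~R * x)) =
    - \int[mu]_(x in D) (r x * sin (k%:~R * x)).
  move=> ir; rewrite -[RHS]mulN1r -RintegralZl; [|exact: mP|exact: isin].
  by apply: eq_Rintegral => x _; rewrite mulrNz mulNr sinN; ring.
(* Each complex coefficient mixes p and q. Comparing k with - k separates them, as cosine terms are
   even in k and sine terms odd. *)
have zero : (forall k : int, \int[mu]_(x in D) (p x * cos (k%:~R * x)) = 0) /\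
  (forall k : int, \int[mu]_(x in D) (p x * sin (k%:~R * x)) = 0) /\
  (forall k : int, \int[mu]_(x in D) (q x * cos (k%:~R * x)) = 0) /\
  (forall k : int, \int[mu]_(x in D) (q x * sin (k%:~R * x)) = 0).
  split; [|split; [|split]] => k;
  have := e1 k; have := e2 k; have := e1 (- k); have := e2 (- k);
  rewrite !int_cosN !int_sinN//; lra.
have [pc [ps [qc qs]]] := zero.
have := fourier_uniq_real iq qc qs; have := fourier_uniq_real ip pc ps.
apply: (@filterS2 _ _ (ae_filter_ringOfSetsType mu)) => x /= px qx Dx.
move: (px Dx) (qx Dx); rewrite /p /q /h; case: (f x) (g x) => [a b] [a' b'] /= E1 E2.
by apply/eqP; rewrite eq_complex/=; apply/andP; split; apply/eqP; lra.
Qed.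

Lemma in_L2_cmeasurable f : in_L2 f -> cmeasurable f.
Proof.
by move=> [_ m1 m2 _]; split; apply: (@measurable_funS _ _ _ _ setT).
Qed.

Lemma in_L2_cintegrable f : in_L2 f -> cintegrable f.
Proof.
move=> L; have [m1 m2] := in_L2_cmeasurable L; case: L => _ _ _ fin.
have msq : measurable_fun D (fun x => normc (f x) ^+ 2).
  under eq_fun do rewrite normc_sq.
  by apply: measurable_funD; exact: measurable_funX.
have isq : mu.-integrable D (EFin \o (fun x => normc (f x) ^+ 2)).
  apply/integrableP; split; first exact/measurable_EFinP.
  by under eq_integral do rewrite /= ger0_norm ?sqr_ge0//.
have i1 := @integrable_period_cst R 1.
have i := integrable_addR i1 isq.
have le (t s : R) : 0 <= s -> `|t| <= s -> `|t| <= `|1 + s ^+ 2|.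
  move=> s0 ts; apply: le_trans ts _; rewrite ger0_norm ?addr_ge0 ?sqr_ge0//.
  have := sqr_ge0 (s - 1); rewrite sqrrB; lra.
split; apply: le_integrable i => //; try exact/measurable_EFinP;
  by move=> x Dx /=; rewrite lee_fin; apply: le; rewrite ?normc_ge0 ?Re_le_normc ?Im_le_normc.
Qed.

End fourier_uniqueness.

(** * Fourier coefficients of the cubic nonlinearity *)

Section majorant.
Context {R : realType}.
Local Notation normc := (@ComplexField.Normc.normc R).
Local Notation jap := (@jap R).
Implicit Types c : int -> R[i].

(** The even, compactly supported majorant required by the estimates on the cubic term; a sum rather
    than a maximum, at the cost of a factor 4 in the energy. *)
Definition symnorm (n : nat) c (k : int) : R :=
  if (`|k| <= n)%N then normc (c k) + normc (c (- k)) else 0.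

Lemma symnorm_ge0 n c k : 0 <= symnorm n c k.
Proof. by rewrite /symnorm; case: ifP => // _; rewrite addr_ge0 ?normc_ge0. Qed.

Lemma symnorm_supp n c k : (n < `|k|)%N -> symnorm n c k = 0.
Proof. by rewrite /symnorm ltnNge => /negbTE ->. Qed.

Lemma symnorm_even n c k : symnorm n c (- k) = symnorm n c k.
Proof. by rewrite /symnorm abszN opprK addrC. Qed.

Lemma normc_le_symnorm n c k : (`|k| <= n)%N -> normc (c k) <= symnorm n c k.
Proof. by rewrite /symnorm => ->; rewrite lerDl normc_ge0. Qed.

Definition energy_partial c (n : nat) : R := h12sq (fun k => normc (c k)) n.

Lemma symnorm_energy n c : h12sq (symnorm n c) n <= 4 * energy_partial c n.
Proof.
rewrite /energy_partial /h12sq.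
have -> : 4 * \sum_(k <- zr n) jap k * normc (c k) ^+ 2 =
    2 * \sum_(k <- zr n) jap k * normc (c k) ^+ 2 +
    2 * \sum_(k <- zr n) jap (- k) * normc (c (- k)) ^+ 2.
  by rewrite (sum_zrN n (fun k => jap k * normc (c k) ^+ 2)); ring.
rewrite !mulr_sumr -big_split/= big_seq [leRHS]big_seq.
apply: ler_sum => k; rewrite mem_zr /symnorm => ->.
have -> : jap (- k) = jap k by rewrite /jap abszN.
have := jap_gt0 (R := R) k; move: (jap k) (normc (c k)) (normc (c (- k))) => j a b j0.
have -> : 2 * (j * a ^+ 2) + 2 * (j * b ^+ 2) = j * (2 * a ^+ 2 + 2 * b ^+ 2) by ring.
rewrite ler_wpM2l ?(ltW j0)//; have := sqr_ge0 (a - b); rewrite sqrrB sqrrD; lra.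
Qed.

Lemma energy_partial_trunc c n m : (n <= m)%N ->
  energy_partial (fun k => c k - trunc n c k) m = energy_partial c m - energy_partial c n.
Proof.
move=> nm; apply/eqP; rewrite eq_sym subr_eq; apply/eqP.
rewrite /energy_partial /h12sq.
have -> : \sum_(k <- zr n) jap k * normc (c k) ^+ 2 =
    \sum_(k <- zr m) jap k * normc (trunc n c k) ^+ 2.
  rewrite [RHS](sum_zr_widen nm).
    by rewrite (sum_zr_trunc n c (fun k z => jap k * normc z ^+ 2)).
  by move=> k kn; rewrite trunc_supp// ComplexField.Normc.normc0 expr0n mulr0.
rewrite -big_split/=; apply: eq_bigr => k _; rewrite -mulrDr; congr (_ * _).
rewrite /trunc; case: ifP => _; rewrite ?subrr ?subr0 ComplexField.Normc.normc0 expr0n/=.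
  by rewrite add0r.
by rewrite addr0.
Qed.

Lemma energy_partial_le c n m : (n <= m)%N -> energy_partial c n <= energy_partial c m.
Proof.
move=> nm; apply: sum_zr_le => // k.
by rewrite mulr_ge0 ?sqr_ge0// ltW// jap_gt0.
Qed.

Lemma energy_partial_ge0 c n : 0 <= energy_partial c n.
Proof. by apply: sumr_ge0 => k _; rewrite mulr_ge0 ?sqr_ge0// ltW// jap_gt0. Qed.

Lemma quartic_le_energy c n : quartic n c <= 512 * energy_partial c n ^+ 2.
Proof.
have := quartic_le (@symnorm_ge0 n c) (@symnorm_supp n c) (@normc_le_symnorm n c).
move=> /le_trans; apply.
have -> : 512 * energy_partial c n ^+ 2 = 32 * (4 * energy_partial c n) ^+ 2 by ring.
rewrite ler_wpM2l// lerXn2r ?nnegrE ?symnorm_energy ?mulr_ge0 ?energy_partial_ge0//.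
by apply: sumr_ge0 => k _; rewrite mulr_ge0 ?sqr_ge0// ltW// jap_gt0.
Qed.

End majorant.

Section trigpoly_limit.
Context {R : realType}.
Notation mu := (@lebesgue_measure R).
Notation D := (@period R).
Local Notation normc := (@ComplexField.Normc.normc R).
Variables (c : int -> R[i]) (B : R).
Hypothesis cB : forall n, energy_partial c n <= B.

Let mP := @measurable_period R.

Let p2ge0 : 0 <= (pi *+ 2 : R).
Proof. by rewrite mulrn_wge0// pi_ge0. Qed.

(** The difference is the polynomial whose coefficients are cut below n, so the L^4 bound applies
    with the energy between the two cut-offs. *)
Lemma trigpoly_diff_quartic n m : (n <= m)%N ->
  \int[mu]_(x in D) normc (trigpoly m c x - trigpoly n c x) ^+ 4 <=
  pi *+ 2 * (512 * (energy_partial c m - energy_partial c n) ^+ 2).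
Proof.
move=> nm; pose c' k := c k - trunc n c k.
have E x : trigpoly m c x - trigpoly n c x = trigpoly m c' x.
  rewrite /trigpoly; under [RHS]eq_bigr do rewrite mulrBl.
  rewrite sumrB; congr (_ - _).
  rewrite [RHS](sum_zr_widen nm) ?(sum_zr_trunc n c (fun k z => z * ek k x))//.
  by move=> k kn; rewrite trunc_supp// mul0r.
under eq_Rintegral do rewrite E.
rewrite int_quartic_trigpoly ler_wpM2l ?p2ge0//.
by rewrite -energy_partial_trunc// quartic_le_energy.
Qed.

Let energy_cauchy (e : R) : 0 < e -> exists n0, forall m n, (n0 <= n <= m)%N ->
  energy_partial c m - energy_partial c n <= e.
Proof.
move=> e0.
have : cvgn (energy_partial c).
  apply: nondecreasing_is_cvgn.
    by move=> n m nm; exact: energy_partial_le.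
  by exists B => _ [n _ <-].
move=> cv; have /cvgrPdist_le/(_ (e / 2)) := cv.
have e2 : 0 < e / 2 by rewrite divr_gt0.
move=> /(_ e2)[n0 _ H]; exists n0 => m n /andP[n0n nm].
have := H n n0n; have := H m (leq_trans n0n nm).
set l := limn _; rewrite !ler_norml => /andP[a1 a2] /andP[b1 b2]; lra.
Qed.

Lemma fast_subsequence : exists N_ : nat -> nat,
  [/\ forall j, (j <= N_ j)%N, forall j, (N_ j <= N_ j.+1)%N &
      forall j, energy_partial c (N_ j.+1) - energy_partial c (N_ j) <= 8^-1 ^+ j].
Proof.
have H j : exists n0, forall m n, (n0 <= n <= m)%N ->
    energy_partial c m - energy_partial c n <= 8^-1 ^+ j.
  by apply: energy_cauchy; rewrite exprn_gt0.
have [n0 Hn0] := choice H.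
(* Adding up the thresholds makes the indices monotone and past [n0 j]; the summand j makes them
   unbounded. *)
exists (fun j => j + \sum_(i < j.+1) n0 i)%N; split => j.
- exact: leq_addr.
- by rewrite [X in (_ <= _ + X)%N]big_ord_recr/= addSn; lia.
apply: Hn0; apply/andP; split.
  by rewrite big_ord_recr/=; lia.
by rewrite [X in (_ <= _ + X)%N]big_ord_recr/= addSn; lia.
Qed.


Section subsequence.
Variable N_ : nat -> nat.
Hypothesis N_ge : forall j, (j <= N_ j)%N.
Hypothesis N_nd : forall j, (N_ j <= N_ j.+1)%N.
Hypothesis N_fast : forall j,
  energy_partial c (N_ j.+1) - energy_partial c (N_ j) <= 8^-1 ^+ j.

Let S j := trigpoly (N_ j) c.
Let d j x := S j.+1 x - S j x.
(* G dominates: each |d_j| is at most G^(1/4) 2^-j, hence the subsequence converges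
   wherever G is finite, and G is integrable by the choice of N_. *)
Let term j x : \bar R := (16 ^+ j * normc (d j x) ^+ 4)%:E.
Let G x : \bar R := (\sum_(0 <= j <oo) term j x)%E.

Let term_ge0 j x : (0 <= term j x)%E.
Proof. by rewrite lee_fin mulr_ge0 ?exprn_ge0 ?normc_ge0. Qed.

Let md j : cmeasurable (d j).
Proof.
rewrite /d; under eq_fun do rewrite -mulN1r.
apply: cmeasurableD; first exact: cmeasurable_trigpoly.
by apply: cmeasurableM; [exact: cmeasurable_cst|exact: cmeasurable_trigpoly].
Qed.

Let bd j : cbounded (d j).
Proof.
rewrite /d; under eq_fun do rewrite -mulN1r.
apply: cboundedD; first exact: cbounded_trigpoly.
by apply: cboundedM; [exact: cbounded_cst|exact: cbounded_trigpoly].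
Qed.

Let mquart j : measurable_fun D (fun x => normc (d j x) ^+ 4).
Proof.
have [m1 m2] := md j; under eq_fun do rewrite (exprM _ 2 2) normc_sq.
by apply: measurable_funX; apply: measurable_funD; exact: measurable_funX.
Qed.

Let mterm j : measurable_fun D (term j).
Proof.
by apply/measurable_EFinP; apply: measurable_funM => //; exact: measurable_cst.
Qed.

Let iquart j : mu.-integrable D (EFin \o (fun x => normc (d j x) ^+ 4)).
Proof.
have [M dM] := bd j.
have i1 := @integrable_period_cst R 1.
have := @integrable_mul_bounded R (cst 1) _ (M ^+ 4) i1 (mquart j).
under eq_fun do rewrite mul1r; apply => x Dx.
rewrite ger0_norm ?exprn_ge0 ?normc_ge0// lerXn2r ?nnegrE ?normc_ge0 ?dM//.
exact: le_trans (normc_ge0 _) (dM _ Dx).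
Qed.

(** The L^4 bound is quadratic in the energy increment 8^(-j), and 16 / 64 = 1 / 4 keeps the
    weighted series summable. *)
Let int_term j : (\int[mu]_(x in D) term j x <= (pi *+ 2 * 512 * 4^-1 ^+ j)%:E)%E.
Proof.
have it : mu.-integrable D (EFin \o (fun x => 16 ^+ j * normc (d j x) ^+ 4)).
  by apply: integrable_scale.
rewrite -[leLHS]fineK; last exact: integrable_fin_num it.
rewrite lee_fin -/(Rintegral mu D (fun x => 16 ^+ j * normc (d j x) ^+ 4)).
rewrite RintegralZl//; have := trigpoly_diff_quartic (N_nd j) => H.
apply: le_trans (ler_wpM2l (_ : 0 <= 16 ^+ j) H) _; first by rewrite exprn_ge0.
have e0 : 0 <= energy_partial c (N_ j.+1) - energy_partial c (N_ j).
  by rewrite subr_ge0 energy_partial_le.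
have e1 := N_fast j.
have e2 : 4^-1 ^+ j = 16 ^+ j * (8^-1 ^+ j) ^+ 2 :> R.
  by rewrite -exprM mulnC exprM -exprMn; congr (_ ^+ j); lra.
have -> : pi *+ 2 * 512 * 4^-1 ^+ j = 16 ^+ j * (pi *+ 2 * (512 * (8^-1 ^+ j) ^+ 2)) :> R.
  by rewrite e2; ring.
apply: ler_wpM2l; first by rewrite exprn_ge0.
apply: ler_wpM2l; first exact: p2ge0.
apply: ler_wpM2l; first exact: ler0n.
move: (energy_partial c (N_ j.+1) - energy_partial c (N_ j)) (8^-1 ^+ j) e0 e1 => a b a0 ab.
by rewrite lerXn2r ?nnegrE// (le_trans a0).
Qed.

Let iG : mu.-integrable D G.
Proof.
have mG : measurable_fun D G.
  have := @ge0_emeasurable_sum _ _ R D term xpredT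
    (fun k x _ _ => term_ge0 k x) (fun k _ => mterm k).
  by apply: eq_measurable_fun => x _; apply: eq_eseriesl.
apply/integrableP; split => //.
have -> : (\int[mu]_(x in D) `|G x| = \int[mu]_(x in D) G x)%E.
  by apply: eq_integral => x _; rewrite gee0_abs//; apply: nneseries_ge0 => n _ _; exact: term_ge0.
rewrite integral_nneseries//.
suff H : (\sum_(0 <= j <oo) \int[mu]_(x in D) term j x <= (pi *+ 2 * 512 * 2)%:E)%E.
  by apply: le_lt_trans H _; rewrite ltry.
apply: lime_le.
  by apply: is_cvg_nneseries => n _ _; apply: integral_ge0 => x _; exact: term_ge0.
apply: nearW => n.
apply: (@le_trans _ _ (\sum_(0 <= j < n) (pi *+ 2 * 512 * 4^-1 ^+ j)%:E)%E).
  by apply: lee_sum => j _; exact: int_term.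
rewrite sumEFin lee_fin -mulr_sumr; apply: ler_wpM2l.
  by apply: mulr_ge0; [exact: p2ge0|exact: ler0n].
rewrite big_mkord; suff : \sum_(i < n) 4^-1 ^+ i <= 2 - 2 * 4^-1 ^+ n :> R.
  have : 0 <= 4^-1 ^+ n :> R by rewrite exprn_ge0.
  by lra.
elim: (n) => [|k IH]; first by rewrite big_ord0 expr0; lra.
rewrite big_ord_recr/= exprS; have : 0 <= 4^-1 ^+ k :> R by rewrite exprn_ge0.
by move: (4^-1 ^+ k) IH => q IH q0; lra.
Qed.

Let r x := Num.sqrt (Num.sqrt (fine (G x))).

Let d_le x j : G x \is a fin_num -> normc (d j x) <= r x * 2^-1 ^+ j.
Proof.
move=> Gx.
have tG : 16 ^+ j * normc (d j x) ^+ 4 <= fine (G x).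
  rewrite -lee_fin fineK//.
  have := @nneseries_lim_ge R (term^~ x) xpredT 0%N j.+1 (fun n _ _ => term_ge0 n x).
  rewrite big_nat_recr//=; apply: le_trans.
  by rewrite leeDr// sume_ge0// => i _; exact: term_ge0.
have G0 : 0 <= fine (G x).
  by apply: le_trans tG; rewrite mulr_ge0 ?exprn_ge0 ?normc_ge0.
have r4 : r x ^+ 4 = fine (G x).
  by rewrite (exprM _ 2 2) !sqr_sqrtr// sqrtr_ge0.
have r0 : 0 <= r x by exact: sqrtr_ge0.
rewrite -(@ler_pXn2r _ 4)// ?nnegrE ?normc_ge0 ?mulr_ge0 ?exprn_ge0//.
rewrite exprMn r4 -exprM mulnC exprM -[leLHS]mul1r.
have -> : (2^-1 : R) ^+ 4 = 16^-1 by field.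
rewrite exprVn ler_pdivlMr ?exprn_gt0// mul1r mulrC.
exact: tG.
Qed.

Let S_sum x j : S j x = S 0%N x + \sum_(i < j) d i x.
Proof.
elim: j => [|j IH]; first by rewrite big_ord0 addr0.
by rewrite big_ord_recr/= addrA -IH /d addrC subrK.
Qed.

Let geo_half j : \sum_(i < j) 2^-1 ^+ i <= 2 :> R.
Proof.
suff : \sum_(i < j) 2^-1 ^+ i <= 2 - 2 * 2^-1 ^+ j :> R.
  have : 0 <= 2^-1 ^+ j :> R by rewrite exprn_ge0.
  by lra.
elim: (j) => [|k IH]; first by rewrite big_ord0 expr0; lra.
rewrite big_ord_recr/= exprS; have : 0 <= 2^-1 ^+ k :> R by rewrite exprn_ge0.
by move: (2^-1 ^+ k) IH => q IH q0; lra.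
Qed.

Let S_cvg (pr : R[i] -> R) : (forall z w, pr (z + w) = pr z + pr w) ->
  (forall z, `|pr z| <= normc z) ->
  forall x, G x \is a fin_num -> cvgn (fun j => pr (S j x)).
Proof.
move=> prD prle x Gx.
have pr0 : pr 0 = 0 by have := prD 0 0; rewrite addr0; lra.
have E : (fun j => pr (S j x)) = (fun j => pr (S 0%N x) + series (fun i => pr (d i x)) j).
  apply/funext => j; rewrite [in LHS]S_sum prD; congr (_ + _).
  by rewrite /series/= big_mkord; apply: (big_morph pr prD pr0).
rewrite E; apply: is_cvgD; first exact: is_cvg_cst.
apply: normed_cvg.
have v0 i : 0 <= r x * 2^-1 ^+ i by apply: mulr_ge0; [exact: sqrtr_ge0|exact: exprn_ge0].
have u0 i : 0 <= `|pr (d i x)| by exact: normr_ge0.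
have uv i : `|pr (d i x)| <= r x * 2^-1 ^+ i.
  by apply: le_trans (prle _) (d_le _ Gx).
apply: (series_le_cvg u0 v0 uv).
rewrite (_ : (fun i => _) = geometric (r x) 2^-1); last by [].
by apply: is_cvg_geometric_series; rewrite ger0_norm//; lra.
Qed.

(** The quantity 1 + |S|^4 dominates both |S| and |S|^3, so a single H serves for the partial sums
    and for their cubic expressions. *)
Lemma trigpoly_dominated : exists H : R -> \bar R,
  [/\ mu.-integrable D H,
    {ae mu, forall x, D x -> forall j, ((1 + normc (S j x) ^+ 4)%:E <= H x)%E} &
    {ae mu, forall x, D x -> cvgn (fun j => complex.Re (S j x)) /\
                             cvgn (fun j => complex.Im (S j x))}].
Proof.
have [M SM] : cbounded (S 0) by exact: cbounded_trigpoly.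
have finG := integrable_ae mP iG.
(* From |S_j| <= M + 2 r with r^4 = G, and the convexity bound (M + 2 r)^4 <= 8 M^4 + 128 r^4. *)
exists (fun x => (1 + 8 * M ^+ 4)%:E + 128%:E * G x)%E; split.
- apply: integrableD => //; last exact: integrableZl.
  exact: integrable_period_cst.
- apply: (@filterS _ _ (ae_filter_ringOfSetsType mu) _ _ _ finG) => x Gx Dx j.
  have {}Gx := Gx Dx; rewrite -[G x]fineK// -EFinM -EFinD lee_fin.
  have r0 : 0 <= r x by exact: sqrtr_ge0.
  have sj : normc (S j x) <= M + 2 * r x.
    rewrite S_sum; apply: le_trans (normcD_le _ _) _; rewrite lerD ?SM//.
    apply: le_trans (normc_sum _ _ _) _.
    apply: (@le_trans _ _ (\sum_(i < j) r x * 2^-1 ^+ i)).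
      by apply: ler_sum => i _; exact: d_le.
    by rewrite -mulr_sumr mulrC ler_wpM2r.
  have G0 : 0 <= fine (G x).
    by rewrite fine_ge0//; apply: nneseries_ge0 => n _ _; exact: term_ge0.
  have r4 : r x ^+ 4 = fine (G x).
    by rewrite (exprM _ 2 2) !sqr_sqrtr// sqrtr_ge0.
  have M0 : 0 <= M by apply: le_trans (normc_ge0 _) (SM _ Dx).
  have n0 := normc_ge0 (S j x).
  rewrite -r4; move: (normc _) (r x) sj r0 n0 => s q sq q0 s0.
  have s4 : s ^+ 4 <= (M + 2 * q) ^+ 4 by rewrite lerXn2r ?nnegrE// addr_ge0// mulr_ge0.
  have : (M + 2 * q) ^+ 4 <= 8 * M ^+ 4 + 128 * q ^+ 4.
    have a1 : (M + 2 * q) ^+ 2 <= 2 * (M ^+ 2 + 4 * q ^+ 2).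
      by have := sqr_ge0 (M - 2 * q); rewrite sqrrB sqrrD !exprMn; lra.
    rewrite (exprM _ 2 2); apply: (@le_trans _ _ ((2 * (M ^+ 2 + 4 * q ^+ 2)) ^+ 2)).
      by rewrite lerXn2r ?nnegrE ?sqr_ge0// mulr_ge0// addr_ge0 ?mulr_ge0 ?sqr_ge0.
    have := sqr_ge0 (M ^+ 2 - 4 * q ^+ 2).
    rewrite (exprM M 2 2) (exprM q 2 2); move: (M ^+ 2) (q ^+ 2) => a b; nra.
  lra.
- apply: (@filterS _ _ (ae_filter_ringOfSetsType mu) _ _ _ finG) => x Gx Dx.
  split; apply: S_cvg; try exact: Gx.
  + exact: cReD.
  + exact: Re_le_normc.
  + exact: cImD.
  + exact: Im_le_normc.
Qed.

End subsequence.

End trigpoly_limit.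

Section complex_limits.
Context {R : realType}.
Local Notation normc := (@ComplexField.Normc.normc R).
Implicit Types (u v : nat -> R[i]) (z w : R[i]).

Definition ccvg u z :=
  complex.Re (u n) @[n --> \oo] --> complex.Re z /\
  complex.Im (u n) @[n --> \oo] --> complex.Im z.

Lemma ccvg_cst z : ccvg (fun=> z) z.
Proof. by split; exact: cvg_cst. Qed.

Lemma ccvgD u v z w : ccvg u z -> ccvg v w -> ccvg (fun n => u n + v n) (z + w).
Proof.
move=> [u1 u2] [v1 v2]; split.
  by rewrite cReD; under eq_fun do rewrite cReD; exact: cvgD.
by rewrite cImD; under eq_fun do rewrite cImD; exact: cvgD.
Qed.

Lemma ccvgM u v z w : ccvg u z -> ccvg v w -> ccvg (fun n => u n * v n) (z * w).
Proof.
move=> [u1 u2] [v1 v2]; split.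
  by rewrite cReM; under eq_fun do rewrite cReM; apply: cvgB; exact: cvgM.
by rewrite cImM; under eq_fun do rewrite cImM; apply: cvgD; exact: cvgM.
Qed.

Lemma ccvgJ u z : ccvg u z -> ccvg (fun n => conjc (u n)) (conjc z).
Proof.
move=> [u1 u2]; split.
  by rewrite cReJ; under eq_fun do rewrite cReJ.
by rewrite cImJ; under eq_fun do rewrite cImJ; exact: cvgN.
Qed.

Lemma ccvg_normc u z : ccvg u z -> normc (u n) @[n --> \oo] --> normc z.
Proof.
move=> [u1 u2].
have E y : normc y = Num.sqrt (complex.Re y ^+ 2 + complex.Im y ^+ 2) by case: y.
rewrite E; under eq_fun do rewrite E.
apply: (@continuous_cvg _ _ _ _ _ _ (fun x : R => Num.sqrt x)); first exact: sqrt_continuous.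
by apply: cvgD; apply: cvgM.
Qed.

End complex_limits.

Section cubic_limit.
Context {R : realType}.
Notation mu := (@lebesgue_measure R).
Notation D := (@period R).
Local Notation normc := (@ComplexField.Normc.normc R).

Let mP := @measurable_period R.

Lemma fourier_cubic_limit (f : R -> R[i]) (B : R) : in_L2 f ->
  (forall n, energy_partial (fourier f) n <= B) ->
  exists2 N_ : nat -> nat, (forall j, (j <= N_ j)%N) &
    forall k, ccvg (fun j => cub (N_ j) (fourier f) k) (fourier (cubic f) k).
Proof.
move=> L2f cB; set c := fourier f.
have [N_ [N_ge N_nd N_fast]] := fast_subsequence cB.
exists N_ => // k0.
have [H [iH HS cvS]] := trigpoly_dominated N_nd N_fast.
pose S j := trigpoly (N_ j) c.
(* The upper limit is defined and measurable everywhere, and equals the limit wherever the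
   subsequence converges. *)
pose gR x := fine (limn_esup (fun j => (complex.Re (S j x))%:E)).
pose gI x := fine (limn_esup (fun j => (complex.Im (S j x))%:E)).
pose g x : R[i] := (gR x +i* gI x)%C.
have mS j : cmeasurable (S j) by exact: cmeasurable_trigpoly.
have mg : cmeasurable g.
  split; apply: (measurableT_comp (fine_measurable measurableT));
    by apply: measurable_fun_limn_esup => j; apply/measurable_EFinP; apply: (mS j).1 || apply: (mS j).2.
have limE (u : nat -> R) : cvgn u -> u n @[n --> \oo] --> fine (limn_esup (fun j => (u j)%:E)).
  move=> cu; rewrite is_cvg_limn_esupE; last first.
    by apply/cvg_ex; exists (limn u)%:E; apply/cvg_EFin => //; exact: nearW.
  rewrite (_ : limn (fun j => (u j)%:E) = (limn u)%:E)//.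
  by apply/cvg_lim => //; apply/cvg_EFin => //; exact: nearW.
have cvg_g : {ae mu, forall x, D x -> ccvg (fun j => S j x) (g x)}.
  apply: (@filterS _ _ (ae_filter_ringOfSetsType mu) _ _ _ cvS) => x cx Dx.
  by have [c1 c2] := cx Dx; split; exact: limE.
have bek k : cbounded (ek k : R -> R[i]) by exact: cbounded_ek.
have mek k : cmeasurable (ek k : R -> R[i]) by exact: cmeasurable_ek.
have ccvg_ek k : {ae mu, forall x, D x -> ccvg (fun j => S j x * ek k x) (g x * ek k x)}.
  apply: (@filterS _ _ (ae_filter_ringOfSetsType mu) _ _ _ cvg_g) => x cx Dx.
  by apply: ccvgM; [exact: cx|exact: ccvg_cst].
have S_le : {ae mu, forall x, D x -> forall j k, ((normc (S j x * ek k x))%:E <= H x)%E}.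
  apply: (@filterS _ _ (ae_filter_ringOfSetsType mu) _ _ _ HS) => x Hx Dx j k.
  apply: le_trans (Hx Dx j); rewrite lee_fin ComplexField.Normc.normcM normc_ek mulr1.
  have n0 := normc_ge0 (S j x); rewrite -/(S j x); move: (normc _) n0 => s s0.
  have [s1|s1] := leP s 1; first by apply: le_trans s1 _; rewrite lerDl exprn_ge0.
  apply: (@le_trans _ _ (s ^+ 4)); last by rewrite lerDr.
  by rewrite -[leLHS]expr1 ler_weXn2l// ltW.
have dom k := torus_cdominated (fun n => cmeasurableM (mS n) (mek k))
   (cmeasurableM mg (mek k)) (ccvg_ek k) iH
   (@filterS _ _ (ae_filter_ringOfSetsType mu) _ _
     (fun x (Hx : D x -> forall j k, ((normc (S j x * ek k x))%:E <= H x)%E) Dx n => Hx Dx n k) S_le).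
have ig : cintegrable g.
  have [+ _ _] := dom 0; rewrite (_ : (fun x => g x * ek 0 x) = g)//.
  by apply/funext => x; rewrite ek0 mulr1.
(* The coefficients of S j converge to those of g by domination, and are eventually constant equal
   to [c k]. *)
have fg k : fourier g k = c k.
  have [_ d1 d2] := dom (- k).
  have cS : ccvg (fun j => fourier (S j) k) (fourier g k).
    rewrite fourierE; under eq_fun do rewrite fourierE.
    by apply: ccvgM; [exact: ccvg_cst|split].
  have cc : ccvg (fun j => fourier (S j) k) (c k).
    have E j : (`|k| <= j)%N -> fourier (S j) k = c k.
      by move=> kj; rewrite /S fourier_trigpoly /trunc (leq_trans kj).
    split; apply: cvg_near_cst; exists `|k|%N => // j kj.
      exact: (congr1 (@complex.Re R) (E j kj)).
    exact: (congr1 (@complex.Im R) (E j kj)).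
  apply/eqP; rewrite eq_complex; apply/andP; split; apply/eqP.
    exact: (cvg_unique _ cS.1 cc.1).
  exact: (cvg_unique _ cS.2 cc.2).
have fE := fourier_uniq ig (in_L2_cintegrable L2f) fg.
have mf := in_L2_cmeasurable L2f.
have cvg_f : {ae mu, forall x, D x -> ccvg (fun j => cubic (S j) x * ek (- k0) x)
                                           (cubic f x * ek (- k0) x)}.
  apply: (@filterS2 _ _ (ae_filter_ringOfSetsType mu) _ _ _ _ cvg_g fE) => x cx fx Dx.
  apply: ccvgM; last exact: ccvg_cst.
  rewrite cubicE; under eq_fun do rewrite cubicE.
  rewrite -(fx Dx); apply: ccvgM; last by apply: ccvgJ; exact: cx.
  by apply: ccvgM; exact: cx.
have cub_le : {ae mu, forall x, D x -> forall j, ((normc (cubic (S j) x * ek (- k0) x))%:E <= H x)%E}.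
  apply: (@filterS _ _ (ae_filter_ringOfSetsType mu) _ _ _ HS) => x Hx Dx j.
  apply: le_trans (Hx Dx j); rewrite lee_fin ComplexField.Normc.normcM normc_ek mulr1.
  rewrite cubicE !ComplexField.Normc.normcM normc_conj.
  have n0 := normc_ge0 (S j x); rewrite -/(S j x); move: (normc _) n0 => s s0.
  rewrite -!expr2 -exprSr.
  have [s1|s1] := leP s 1; first by apply: (@le_trans _ _ 1); [exact: exprn_ile1|rewrite lerDl exprn_ge0].
  apply: (@le_trans _ _ (s ^+ 4)); last by rewrite lerDr.
  by rewrite ler_weXn2l// ltW.
have [_ d1 d2] := torus_cdominated
  (fun n => cmeasurableM (cmeasurable_cubic (mS n)) (mek (- k0)))
  (cmeasurableM (cmeasurable_cubic mf) (mek (- k0))) cvg_f iH cub_le.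
have -> : (fun j => cub (N_ j) c k0) = (fun j => fourier (cubic (S j)) k0).
  by apply/funext => j; rewrite fourier_cubic_trigpoly.
rewrite fourierE; under eq_fun do rewrite fourierE.
by apply: ccvgM; [exact: ccvg_cst|split].
Qed.

End cubic_limit.

(** * Evolution of the truncated energy *)

Section complex_derivatives.
Context {R : realType}.
Local Notation normc := (@ComplexField.Normc.normc R).
Implicit Types (f g : R -> R[i]) (t : R) (a b z : R[i]).

Lemma is_derive_sum_seq (I : Type) (s : seq I) (F : I -> R -> R) (dF : I -> R) t :
  (forall i, is_derive t 1 (F i) (dF i)) ->
  is_derive t 1 (fun x => \sum_(i <- s) F i x) (\sum_(i <- s) dF i).
Proof.
move=> dFi; elim: s => [|i s IH].
  by rewrite big_nil; under eq_fun do rewrite big_nil; exact: is_derive_cst.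
rewrite big_cons; under eq_fun do rewrite big_cons.
exact: is_deriveD.
Qed.

Lemma is_Cderive_cst z t : is_Cderive (fun=> z) t 0.
Proof. by split; exact: is_derive_cst. Qed.

Lemma is_CderiveD f g t a b : is_Cderive f t a -> is_Cderive g t b ->
  is_Cderive (fun s => f s + g s) t (a + b).
Proof.
move=> [f1 f2] [g1 g2]; split.
  by rewrite cReD; under eq_fun do rewrite cReD; exact: is_deriveD.
by rewrite cImD; under eq_fun do rewrite cImD; exact: is_deriveD.
Qed.

Let is_derive_mul (p q : R -> R) t dp dq : is_derive t 1 p dp -> is_derive t 1 q dq ->
  is_derive t 1 (fun s => p s * q s) (dp * q t + p t * dq).
Proof.
move=> d1 d2; have := is_deriveM d1 d2.
by rewrite /GRing.scale/= addrC [q t * dp]mulrC.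
Qed.

Lemma is_CderiveM f g t a b : is_Cderive f t a -> is_Cderive g t b ->
  is_Cderive (fun s => f s * g s) t (a * g t + f t * b).
Proof.
move=> [f1 f2] [g1 g2]; split.
  under eq_fun do rewrite cReM.
  apply: (is_derive_eq (is_deriveB (is_derive_mul f1 g1) (is_derive_mul f2 g2))).
  by rewrite cReD !cReM; ring.
under eq_fun do rewrite cImM.
apply: (is_derive_eq (is_deriveD (is_derive_mul f1 g2) (is_derive_mul f2 g1))).
by rewrite cImD !cImM; ring.
Qed.

Lemma is_Cderive_sum (I : Type) (s : seq I) (F : I -> R -> R[i]) (dF : I -> R[i]) t :
  (forall i, is_Cderive (F i) t (dF i)) ->
  is_Cderive (fun x => \sum_(i <- s) F i x) t (\sum_(i <- s) dF i).
Proof.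
move=> dFi; elim: s => [|i s IH].
  by rewrite big_nil; under eq_fun do rewrite big_nil; exact: is_Cderive_cst.
rewrite big_cons; under eq_fun do rewrite big_cons.
exact: is_CderiveD.
Qed.

Lemma is_derive_normc_sq f t a : is_Cderive f t a ->
  is_derive t 1 (fun s => normc (f s) ^+ 2) (2 * complex.Re (conjc (f t) * a)).
Proof.
move=> [f1 f2]; under eq_fun do rewrite normc_sq.
apply: (is_derive_eq (is_deriveD (is_derive_mul f1 f1) (is_derive_mul f2 f2))).
by rewrite cReM cReJ cImJ; ring.
Qed.

End complex_derivatives.

Section truncated_energy.
Context {R : realType}.
Local Notation normc := (@ComplexField.Normc.normc R).
Implicit Types (c : int -> R[i]).

Definition negfreq (k : int) : R := if k < 0 then `|k|%N%:R else 0.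

Definition neg_energy (N : nat) c : R := \sum_(k <- zr N) negfreq k * normc (c k) ^+ 2.

(* The Hamiltonian minus half the momentum, for the truncated function: the
   quadratic part only sees the negative frequencies. *)
Definition trunc_energy (N : nat) c : R := neg_energy N c + 1 / 4 * quartic N c.

(* The derivative of [trunc_energy N] along dc is Re (\sum_k grad_k dc_k). *)
Definition grad (N : nat) c (k : int) : R[i] :=
  (2 * negfreq k)%:C%C * conjc (c k) + conjc (cub N c k).

Lemma is_derive_trunc_energy (N : nat) (c : R -> int -> R[i]) (dc : int -> R[i]) (t : R) :
  (forall k, is_Cderive (c^~ k) t (dc k)) ->
  is_derive t 1 (fun s => trunc_energy N (c s))
    (complex.Re (\sum_(k <- zr N) grad N (c t) k * dc k)).
Proof.
move=> dck.
have dtrunc k : is_Cderive (fun s => trunc N (c s) k) t (trunc N dc k).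
  by rewrite /trunc; case: ifP => _ //; exact: is_Cderive_cst.
have dG j : is_Cderive (fun s => cconv N (c s) j) t
    (2 * \sum_(a <- zr N) dc a * trunc N (c t) (j - a)).
  (* The two terms of the product rule are exchanged by the reflection a -> j - a. *)
  have E : 2 * \sum_(a <- zr N) dc a * trunc N (c t) (j - a) =
    \sum_(a <- zr N) (dc a * trunc N (c t) (j - a) + c t a * trunc N dc (j - a)).
    rewrite mulrDl mul1r big_split/=; congr (_ + _).
    rewrite (sum_zr_trunc N dc (fun a z => z * trunc N (c t) (j - a))).
    rewrite (sum_zr_trunc N (c t) (fun a z => z * trunc N dc (j - a))).
    pose F a := trunc N (c t) a * trunc N dc (j - a).
    rewrite -[RHS](@sum_zr_flip _ N (N + `|j|) j F)//; last first.
      by move=> k kN; rewrite /F trunc_supp ?mul0r.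
    rewrite [RHS](@sum_zr_widen _ N) ?leq_addr//.
      by apply: eq_bigr => k _; rewrite /F subKr mulrC.
    by move=> k kN; rewrite /F subKr (@trunc_supp _ N dc k)// mulr0.
  by rewrite E; apply: is_Cderive_sum => a; exact: is_CderiveM.
have dneg : is_derive t 1 (fun s => neg_energy N (c s))
   (\sum_(k <- zr N) negfreq k * (2 * complex.Re (conjc (c t k) * dc k))).
  apply: is_derive_sum_seq => k.
  have := is_deriveZ (negfreq k) (is_derive_normc_sq (dck k)).
  by rewrite /GRing.scale/=.
have dquart : is_derive t 1 (fun s => quartic N (c s))
   (\sum_(j <- zr (N + N)) 2 * complex.Re (conjc (cconv N (c t) j) *
      (2 * \sum_(a <- zr N) dc a * trunc N (c t) (j - a)))).
  by apply: is_derive_sum_seq => j; exact: is_derive_normc_sq (dG j).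
have dq4 := is_deriveZ (1 / 4) dquart.
apply: (is_derive_eq (is_deriveD dneg dq4)).
have -> : \sum_(k <- zr N) grad N (c t) k * dc k =
   \sum_(k <- zr N) (2 * negfreq k)%:C%C * (conjc (c t k) * dc k) +
   \sum_(k <- zr N) conjc (cub N (c t) k) * dc k.
  by rewrite -big_split/=; apply: eq_bigr => k _; rewrite /grad; ring.
rewrite cReD Re_sum; congr (_ + _).
  by apply: eq_bigr => k _; rewrite [RHS]cReM/= mul0r subr0; ring.
(* The coefficient 1 / 4 in the energy is compensated by one 2 from the squared modulus and one from
   the square S^2. *)
have -> : \sum_(k <- zr N) conjc (cub N (c t) k) * dc k =
    \sum_(j <- zr (N + N)) conjc (cconv N (c t) j) *
      (\sum_(a <- zr N) dc a * trunc N (c t) (j - a)).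
  under [RHS]eq_bigr do rewrite mulr_sumr.
  rewrite exchange_big/=; apply: eq_bigr => a _.
  rewrite cub_cconv rmorph_sum mulr_suml; apply: eq_bigr => j _.
  by rewrite rmorphM/= conjcK; ring.
rewrite Re_sum /GRing.scale/= mulr_sumr; apply: eq_bigr => j _.
set S := \sum_(a <- _) _; set G := conjc _.
have -> : complex.Re (G * (2 * S)) = 2 * complex.Re (G * S).
  by rewrite mulrCA [2 * (G * S)]mulr_natl mulr2n cReD; ring.
by field.
Qed.

(* Conservation of the truncated energy along the Galerkin flow; it reduces to
   conservation of momentum because 2 negfreq k - |k| = - k. *)
Lemma galerkin_energy_im (N : nat) c :
  complex.Im (\sum_(k <- zr N) grad N c k * ((`|k|%N%:R)%:C%C * c k + cub N c k)) = 0.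
Proof.
have E k : complex.Im (grad N c k * ((`|k|%N%:R)%:C%C * c k + cub N c k)) =
    - complex.Im (k%:~R * conjc (c k) * cub N c k).
  have -> : k%:~R = (k%:~R : R)%:C%C by rewrite rmorph_int.
  have lE : 2 * negfreq k - `|k|%N%:R = - k%:~R :> R.
    rewrite /negfreq; case: (ltP k 0) => k0.
      by rewrite -[k in RHS](opprK k) -[- k in RHS]gez0_abs; [rewrite mulrNz abszN opprK; ring|lia].
    by rewrite -[k in RHS]gez0_abs// mulr0 sub0r.
  have -> : k%:~R = `|k|%N%:R - 2 * negfreq k :> R by lra.
  rewrite /grad; case: (c k) (cub N c k) => [a b] [a' b'] /=.
  by move: (negfreq k) (`|k|%N%:R) => l m; ring.
rewrite Im_sum (eq_bigr _ (fun k _ => E k)) sumrN -Im_sum momentum_cub oppr0.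
by [].
Qed.

(** The equation gives the derivative of c_k as - i (|k| c_k + Nl_k). With [cub N] in place of Nl
    the pairing with the gradient would be zero, by [galerkin_energy_im], so only the difference of
    the two nonlinearities contributes. *)
Lemma trunc_energy_derive_le (N : nat) (c : R -> int -> R[i]) (Nl : int -> R[i]) (t : R) :
  (forall k, exists2 d, is_Cderive (c^~ k) t d & 'i%C * d - absD (c t) k = Nl k) ->
  exists2 D : R, is_derive t 1 (fun s => trunc_energy N (c s)) D &
    `|D| <= \sum_(k <- zr N) (2 * `|k|%N%:R * normc (c t k) + normc (cub N (c t) k)) *
               normc (Nl k - cub N (c t) k).
Proof.
move=> H; have /choice[dc dcP] : forall k, exists d, is_Cderive (c^~ k) t d /\
    'i%C * d - absD (c t) k = Nl k by move=> k; have [d d1 d2] := H k; exists d.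
have dE k : dc k = - 'i%C * ((`|k|%N%:R)%:C%C * c t k + Nl k).
  rewrite -(dcP k).2 /absD.
  have -> : (`|k|%:~R : R)%:C%C = (`|k|%N%:R : R)%:C%C by rewrite -abszE.
  rewrite addrC subrK mulrA mulNr -expr2 sqr_i opprK mul1r//.
eexists; first by apply: is_derive_trunc_energy => k; exact: (dcP k).1.
have -> : complex.Re (\sum_(k <- zr N) grad N (c t) k * dc k) =
  complex.Im (\sum_(k <- zr N) grad N (c t) k * (Nl k - cub N (c t) k)).
  transitivity (complex.Im (\sum_(k <- zr N) grad N (c t) k * ((`|k|%N%:R)%:C%C * c t k + Nl k))).
    rewrite Re_sum Im_sum; apply: eq_bigr => k _; rewrite dE.
    by case: (grad _ _ _) (_ + Nl k) => [a b] [a' b'] /=; ring.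
  rewrite -[RHS]addr0 -(galerkin_energy_im N (c t)) -cImD -big_split/=.
  by congr (complex.Im _); apply: eq_bigr => k _; ring.
apply: le_trans (Im_le_normc _) _; apply: le_trans (normc_sum _ _ _) _.
apply: ler_sum => k _; rewrite ComplexField.Normc.normcM ler_wpM2r ?normc_ge0//.
apply: le_trans (normcD_le _ _) _; rewrite ComplexField.Normc.normcM !normc_conj.
rewrite lerD2r ler_wpM2r ?normc_ge0//.
rewrite /= expr0n addr0 sqrtr_sqr normrM ger0_norm//.
rewrite ler_wpM2l// /negfreq; case: ifP => _; last by rewrite normr0.
by rewrite ger0_norm.
Qed.

End truncated_energy.

(** * Conclusion *)

Section h12_sums.
Context {R : realType}.
Local Notation normc := (@ComplexField.Normc.normc R).
Local Notation jap := (@jap R).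
Implicit Types (c : int -> R[i]) (F : int -> R).

Lemma esum_zr_ge F M : (\esum_(k in [set: int]) (F k)%:E <= M%:E)%E ->
  forall n, \sum_(k <- zr n) F k <= M.
Proof.
move=> FM n; rewrite -lee_fin; apply: le_trans FM; apply: esum_ge.
exists [set` zr n]; first by split => //; exact: finite_seq.
by rewrite -fsbig_seq ?zr_uniq// sumEFin.
Qed.

Lemma esum_zr_le F M : (forall k, 0 <= F k) ->
  (forall n, \sum_(k <- zr n) F k <= M) ->
  (\esum_(k in [set: int]) (F k)%:E <= M%:E)%E.
Proof.
move=> F0 FM; apply: ge_ereal_sup => _ [X [finX _] <-].
have [s Xs] := (finite_seqP X).1 finX.
have {}Xs : X = [set` undup s] by rewrite Xs; apply/seteqP; split => k /=; rewrite mem_undup.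
rewrite Xs -fsbig_seq ?undup_uniq// sumEFin lee_fin.
pose n := (\max_(k <- undup s) `|k|)%N.
apply: le_trans (FM n).
pose F' k := if k \in undup s then F k else 0.
have -> : \sum_(k <- undup s) F k = \sum_(k <- undup s) F' k.
  by rewrite big_seq [RHS]big_seq; apply: eq_bigr => k; rewrite /F' => ->.
rewrite (@sum_supp_eq _ _ (zr n)) ?undup_uniq ?zr_uniq//.
  by apply: ler_sum => k _; rewrite /F'; case: ifP.
move=> k; rewrite /F'; case: ifPn; last by rewrite eqxx.
move=> ks _; rewrite mem_zr /n.
exact: leq_bigmax_seq.
Qed.

Lemma jap_le_sqrt k : jap k <= 2 * Num.sqrt (1 + k%:~R ^+ 2).
Proof.
have s0 : 0 <= 1 + (k%:~R : R) ^+ 2 by rewrite addr_ge0 ?sqr_ge0.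
rewrite -ler_sqr ?nnegrE ?(ltW (jap_gt0 k)) ?mulr_ge0 ?sqrtr_ge0//.
rewrite exprMn sqr_sqrtr// /jap.
have -> : (k%:~R : R) ^+ 2 = `|k|%N%:R ^+ 2.
  have -> : (`|k|%N%:R : R) = `|k%:~R| by rewrite -intr_norm -abszE.
  by rewrite real_normK ?num_real.
by move: (`|k|%N%:R) => x; have := sqr_ge0 (x - 1); rewrite sqrrB sqrrD; have := sqr_ge0 x; lra.
Qed.

Lemma energy_partial_H12 c M : 0 <= M -> (H12_norm c <= M%:E)%E ->
  forall n, energy_partial c n <= 2 * M ^+ 2.
Proof.
move=> M0 HM n.
have e0 : (0 <= \esum_(k in [set: int])
    (Num.sqrt (1 + k%:~R ^+ 2) * normc (c k) ^+ 2)%:E)%E.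
  by apply: esum_ge0 => k _; rewrite lee_fin mulr_ge0 ?sqrtr_ge0 ?sqr_ge0.
have H : (\esum_(k in [set: int])
    (Num.sqrt (1 + k%:~R ^+ 2) * normc (c k) ^+ 2)%:E <= (M ^+ 2)%:E)%E.
  rewrite -lee_sqrt; last by rewrite lee_fin sqr_ge0.
  by apply: le_trans HM _; rewrite /sqrte sqrtr_sqr ger0_norm.
have := esum_zr_ge H n; move=> {}H.
apply: (@le_trans _ _ (2 * \sum_(k <- zr n) (Num.sqrt (1 + k%:~R ^+ 2) * normc (c k) ^+ 2))).
  rewrite mulr_sumr; apply: ler_sum => k _; rewrite mulrA.
  by rewrite ler_wpM2r ?sqr_ge0// jap_le_sqrt.
by rewrite ler_wpM2l.
Qed.

(** Negative frequencies satisfy |k| >= 1, where sqrt(1 + k^2) <= 2 |k|; hence the homogeneous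
    energy controls the full norm. *)
Lemma H12_Pi_minus_le c M : (forall n, neg_energy n c <= M) ->
  (H12_norm (Pi_minus c) <= (Num.sqrt (2 * M))%:E)%E.
Proof.
move=> cM; have M0 : 0 <= M.
  by apply: le_trans (cM 0%N); apply: sumr_ge0 => k _; rewrite mulr_ge0 ?sqr_ge0// /negfreq; case: ifP.
have -> : ((Num.sqrt (2 * M))%:E = sqrte (2 * M)%:E)%E by [].
rewrite /H12_norm lee_sqrt; last by rewrite lee_fin mulr_ge0.
apply: esum_zr_le => [k|n].
  by rewrite mulr_ge0 ?sqrtr_ge0 ?sqr_ge0.
apply: (@le_trans _ _ (2 * neg_energy n c)); last by rewrite ler_wpM2l.
rewrite mulr_sumr; apply: ler_sum => k _; rewrite /Pi_minus /Pi_plus /negfreq.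
have [k0|k0] := leP 0 k; first by rewrite subrr ComplexField.Normc.normc0 expr0n !mulr0 mul0r mulr0.
rewrite subr0 mulrA ler_wpM2r ?sqr_ge0//.
have k1 : 1 <= `|k|%N%:R :> R by rewrite ler1n; lia.
have -> : (k%:~R : R) ^+ 2 = `|k|%N%:R ^+ 2.
  have -> : (`|k|%N%:R : R) = `|k%:~R| by rewrite -intr_norm -abszE.
  by rewrite real_normK ?num_real.
move: (`|k|%N%:R) k1 => x x1.
rewrite -ler_sqr ?nnegrE ?sqrtr_ge0 ?mulr_ge0//; last by lra.
by rewrite sqr_sqrtr ?addr_ge0 ?sqr_ge0// exprMn; have : 1 <= x ^+ 2; [rewrite expr_ge1//; lra|lra].
Qed.

Lemma energy_partialD (c d : int -> R[i]) n :
  energy_partial (fun k => c k + d k) n <= 2 * energy_partial c n + 2 * energy_partial d n.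
Proof.
rewrite !mulr_sumr -big_split/=; apply: ler_sum => k _.
have := @jap_gt0 R k; have := normcD_le (c k) (d k).
have := normc_ge0 (c k + d k).
move: (normc (c k + d k)) (normc (c k)) (normc (d k)) (jap k) => s a b j s0 sab j0.
have -> : 2 * (j * a ^+ 2) + 2 * (j * b ^+ 2) = j * (2 * a ^+ 2 + 2 * b ^+ 2) by ring.
rewrite ler_wpM2l ?(ltW j0)//; apply: (@le_trans _ _ ((a + b) ^+ 2)).
  by rewrite lerXn2r ?nnegrE//; lra.
by have := sqr_ge0 (a - b); rewrite sqrrB sqrrD; lra.
Qed.

Lemma fourierB (f g : R -> R[i]) k : in_L2 f -> in_L2 g ->
  fourier (f \- g) k = fourier f k - fourier g k.
Proof.
move=> /in_L2_cintegrable If /in_L2_cintegrable Ig.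
rewrite !fourierE -mulrBr; congr (_ * _).
have If' := cintegrableM If (cmeasurable_ek (- k)) (cbounded_ek (- k)).
have Ig' := cintegrableM Ig (cmeasurable_ek (- k)) (cbounded_ek (- k)).
have := cintegrableM Ig' (cmeasurable_cst (-1)) (cbounded_cst (-1)).
under eq_fun do rewrite mulrC; move=> Ig''.
rewrite -[- torus_int _]mulN1r -torus_intZ// -torus_intD//.
by apply: eq_torus_int => x _; rewrite /=; ring.
Qed.

Lemma cvg_sum_seq (I : Type) (s : seq I) (F : I -> nat -> R) (l : I -> R) :
  (forall i, F i n @[n --> \oo] --> l i) ->
  \sum_(i <- s) F i n @[n --> \oo] --> \sum_(i <- s) l i.
Proof.
move=> Fl; elim: s => [|i s IH].
  by rewrite big_nil; under eq_fun do rewrite big_nil; exact: cvg_cst.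
by rewrite big_cons; under eq_fun do rewrite big_cons; exact: cvgD.
Qed.

Lemma harmonic_sum_unbounded (M : R) : exists2 K, (0 < K)%N & M < harmonic_sum K.
Proof.
apply: contrapT => H; apply: (@dvg_harmonic R).
apply: nondecreasing_is_cvgn.
  by apply/nondecreasing_seqP => n; rewrite /series/= big_nat_recr//= lerDl invr_ge0.
exists (Num.max M 0) => _ [n _ <-]; rewrite /series/= big_mkord le_max.
have [->|n0] := posnP n; first by rewrite big_ord0 lexx orbT.
apply/orP; left; rewrite leNgt; apply/negP => Mn; apply: H; exists n => //.
Qed.

End h12_sums.

(** * Almost conservation of the averaged energy along a solution *)

Section evolution.
Context {R : realType}.
Local Notation normc := (@ComplexField.Normc.normc R).
Variables (u0 : R -> R[i]) (u : R -> R -> R[i]).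
Hypothesis sol : solution u0 u.

Let c t := fourier (u t).

Let uL2 t : in_L2 (u t).
Proof. by have [[H _] _ _] := sol; exact: (H t).1. Qed.

Lemma energy_bounded_at t : exists M, forall n, energy_partial (c t) n <= M.
Proof.
have [[H _] _ _] := sol; have [_ fin] := H t.
have h0 : (0 <= H12_norm (c t))%E by exact: sqrte_ge0.
have ft : H12_norm (c t) \is a fin_num by rewrite ge0_fin_numE.
exists (2 * fine (H12_norm (c t)) ^+ 2); apply: energy_partial_H12; first exact: fine_ge0.
by rewrite fineK.
Qed.

Lemma energy_bounded_near (t0 : R) : exists M, \forall t \near t0,
  forall n, energy_partial (c t) n <= M.
Proof.
have [M cM] := energy_bounded_at t0.
(* Near t0 the difference has H^{1/2} norm below 1, hence partial energies at most 2, and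
   [energy_partialD] doubles both contributions. *)
exists (2 * 2 + 2 * M).
have [[_ H] _ _] := sol; have {}H := H t0.
have : \forall t \near t0, (H12_norm (fourier (u t \- u t0)%R) < 1%:E)%E.
  have nb : nbhs (0%E : \bar R) [set y | (y < 1%:E)%E].
    by apply: open_nbhs_nbhs; split; [exact: open_ereal_lt_ereal|rewrite /= lte_fin].
  exact: (H _ nb).
apply: filterS => t /ltW Ht n.
have -> : c t = (fun k => (c t k - c t0 k) + c t0 k).
  by apply/funext => k; rewrite subrK.
apply: le_trans (energy_partialD _ _ _) _; apply: lerD; apply: ler_wpM2l => //.
have := energy_partial_H12 ler01 Ht n; rewrite expr1n mulr1.
have -> : fourier (u t \- u t0) = (fun k => c t k - c t0 k) => //.
by apply/funext => k; rewrite fourierB.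
Qed.

(** Compactness turns the local bounds into one bound M. Its value is immaterial: it only enters the
    defect. *)
Lemma energy_bounded_segment (a b : R) : exists M, forall t, t \in `[a, b]%R ->
  forall n, energy_partial (c t) n <= M.
Proof.
have cov : \forall M \near +oo%R, `[a, b]%classic `<=`
    (fun t => forall n, energy_partial (c t) n <= M).
  apply: (compact_near_coveringP _).1; first exact: segment_compact.
  move=> x _; have [M HM] := energy_bounded_near x.
  exists ([set t | forall n, energy_partial (c t) n <= M], [set M' | M <= M']) => /=.
    by split; [exact: HM|apply: nbhs_pinfty_ge; exact: num_real].
  by move=> [t M'] /= [tM MM'] n; exact: le_trans MM'.
have [M [_ HM]] := cov; exists (M + 1) => t tab n.
by apply: (HM (M + 1)) => //; rewrite ltrDl.
Qed.

Let weighted_energy K t : R :=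
  \sum_(i < K) i.+1%:R^-1 * trunc_energy i.+1 (c t).

Let defect_bound (B : R) (K : nat) : R :=
  6 * Num.sqrt (3168 * (4 * B) ^+ 4 * harmonic_sum K) + 3456 * (4 * B) ^+ 3.

(** [energy_defect_le] concerns finitely many frequencies but is uniform in n. It is applied along
    the subsequence of [fourier_cubic_limit] and passed to the limit, all sums over cut-offs and
    frequencies being finite for fixed K. *)
Let weighted_energy_derive (K : nat) (B t : R) : (0 < K)%N ->
  (forall n, energy_partial (c t) n <= B) ->
  exists2 D, is_derive t 1 (weighted_energy K) D & `|D| <= defect_bound B K.
Proof.
move=> K0 cB; pose Nl k := fourier (cubic (u t)) k.
have [_ _ eqn] := sol.
have /choice[D DP] : forall i : nat, exists D : R,
    is_derive t 1 (fun s => trunc_energy i.+1 (c s)) D /\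
    `|D| <= \sum_(k <- zr i.+1) (2 * `|k|%N%:R * normc (c t k) + normc (cub i.+1 (c t) k)) *
               normc (Nl k - cub i.+1 (c t) k).
  by move=> i; have [D D1 D2] := trunc_energy_derive_le i.+1 (eqn t); exists D.
exists (\sum_(i < K) i.+1%:R^-1 * D i).
  rewrite /weighted_energy.
  have := @is_derive_sum_seq R 'I_K (index_enum 'I_K)
    (fun i s => i.+1%:R^-1 * trunc_energy i.+1 (c s)) (fun i => i.+1%:R^-1 * D i) t.
  apply => i; have := is_deriveZ (i.+1%:R^-1) (DP i).1.
  by rewrite /GRing.scale/=.
pose W (z : nat -> int -> R[i]) : R := \sum_(i < K) i.+1%:R^-1 * \sum_(k <- zr i.+1)
    (2 * `|k|%N%:R * normc (c t k) + normc (cub i.+1 (c t) k)) * normc (z i k).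
apply: (@le_trans _ _ (W (fun i k => Nl k - cub i.+1 (c t) k))).
  apply: le_trans (ler_norm_sum _ _ _) _; apply: ler_sum => i _.
  rewrite normrM ger0_norm ?invr_ge0//; apply: ler_wpM2l; first by rewrite invr_ge0.
  exact: (DP i).2.
have [N_ N_ge cvN] := fourier_cubic_limit (uL2 t) cB.
have cvW : W (fun i k => cub (N_ j) (c t) k - cub i.+1 (c t) k) @[j --> \oo] -->
    W (fun i k => Nl k - cub i.+1 (c t) k).
  apply: cvg_sum_seq => i; apply: cvgM; first exact: cvg_cst.
  apply: cvg_sum_seq => k; apply: cvgM; first exact: cvg_cst.
  apply: ccvg_normc; apply: ccvgD; first exact: cvN.
  exact: ccvg_cst.
rewrite -(cvg_lim (@Rhausdorff R) cvW); apply: limr_le; first by apply/cvg_ex; eexists; exact: cvW.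
(* The defect bound needs all cut-offs below the frequency range, which holds as soon as j >= K. *)
exists K => // j /= Kj; have KN : (K <= N_ j)%N := leq_trans Kj (N_ge j).
set n := N_ j in KN *.
have cy k : (`|k| <= n)%N -> normc (c t k) <= symnorm n (c t) k by exact: normc_le_symnorm.
have K1 : (0 < K <= n)%N by rewrite K0.
have := energy_defect_le (@symnorm_ge0 R n (c t)) (@symnorm_supp R n (c t))
  (@symnorm_even R n (c t)) cy K1.
move=> H; apply: (le_trans (le_trans _ H)).
  apply: ler_sum => i _; apply: ler_wpM2l; first by rewrite invr_ge0.
  rewrite big_seq [leRHS]big_seq; apply: ler_sum => k; rewrite mem_zr => ki.
  apply: ler_wpM2r; first exact: normc_ge0.
  rewrite lerD2r; apply: ler_wpM2l; first by rewrite mulr_ge0.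
  by apply: cy; apply: leq_trans ki _; apply: leq_trans KN.
have E0 : 0 <= h12sq (symnorm n (c t)) n.
  by apply: sumr_ge0 => k _; rewrite mulr_ge0 ?sqr_ge0// ltW// jap_gt0.
have EB : h12sq (symnorm n (c t)) n <= 4 * B.
  by apply: le_trans (symnorm_energy _ _) _; apply: ler_wpM2l.
have h0 := @harmonic_sum_ge0 R K.
rewrite /defect_bound; move: (h12sq _ _) (4 * B) E0 EB => e b e0 eb.
have b0 : 0 <= b by exact: le_trans eb.
apply: lerD; apply: ler_wpM2l; rewrite ?ler0n//.
  apply: ler_wsqrtr; apply: ler_wpM2r => //; apply: ler_wpM2l; first exact: ler0n.
  by rewrite lerXn2r ?nnegrE.
by rewrite lerXn2r ?nnegrE.
Qed.


Let weighted_energy_lipschitz (K : nat) (B a b : R) : (0 < K)%N -> a <= b ->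
  (forall t, t \in `[a, b]%R -> forall n, energy_partial (c t) n <= B) ->
  `|weighted_energy K b - weighted_energy K a| <= defect_bound B K * (b - a).
Proof.
move=> K0 ab cB.
have H x : x \in `[a, b]%R -> is_derive x 1 (weighted_energy K) ('D_1 (weighted_energy K) x) /\
    `|'D_1 (weighted_energy K) x| <= defect_bound B K.
  move=> /cB/(weighted_energy_derive K0)[D dD DB].
  by rewrite (@derive_val _ _ _ _ _ _ _ dD).
have [||x xab ->] := @MVT_segment R (weighted_energy K) (fun x => 'D_1 (weighted_energy K) x) a b ab.
- by move=> x xab; apply: (H x _).1; exact: subset_itv_oo_cc.
- apply: derivable_within_continuous => x xab.
  by have [[]] := H x xab.
by rewrite normrM [`|b - a|]ger0_norm ?subr_ge0// ler_wpM2r ?subr_ge0// (H x xab).2.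
Qed.

Let trunc_energy_ge n N t : (n <= N)%N -> neg_energy n (c t) <= trunc_energy N (c t).
Proof.
move=> nN; apply: (@le_trans _ _ (neg_energy N (c t))).
  apply: sum_zr_le => // k; rewrite mulr_ge0 ?sqr_ge0// /negfreq; case: ifP => // _.
by rewrite /trunc_energy lerDl mulr_ge0// quartic_ge0.
Qed.

(** Cut-offs above n see all of [neg_energy n] and carry the weight H(n + m) - H(n), with H the
    harmonic sum; the others contribute nonnegatively. *)
Let weighted_energy_ge n m t :
  neg_energy n (c t) * (harmonic_sum (n + m) - harmonic_sum n) <= weighted_energy (n + m) t.
Proof.
have -> : harmonic_sum (n + m) - harmonic_sum n = \sum_(i < m) (n + i).+1%:R^-1 :> R.
  by rewrite /harmonic_sum big_split_ord/= [LHS]addrC addKr.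
rewrite /weighted_energy big_split_ord/= mulr_sumr -[leLHS]add0r.
apply: lerD.
  apply: sumr_ge0 => i _; rewrite mulr_ge0 ?invr_ge0//.
  apply: le_trans (trunc_energy_ge t (leq0n _)).
  by apply: sumr_ge0 => k _; rewrite mulr_ge0 ?sqr_ge0// /negfreq; case: ifP.
apply: ler_sum => i _; rewrite mulrC; apply: ler_wpM2l; first by rewrite invr_ge0.
by apply: trunc_energy_ge; rewrite -addnS leq_addr.
Qed.

(** An excess delta over the bound would make the averaged energy grow between times 0 and t by
    about delta * h, with h the harmonic sum, whereas the accumulated defect is only of order sqrt
    h. Taking h large is a contradiction. *)
Lemma neg_energy_le (e : R) : (forall n, neg_energy n (c 0) = 0) ->
  (forall n, energy_partial (c 0) n <= e) ->
  forall t n, neg_energy n (c t) <= 128 * e ^+ 2.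
Proof.
move=> c0 ce t n; rewrite leNgt; apply/negP.
set Q := neg_energy n (c t) => Qe.
have e0 : 0 <= e by apply: le_trans (ce 0%N); exact: energy_partial_ge0.
pose tau := `|t|.
have [B cB] := energy_bounded_segment (- tau) tau.
have B0 : 0 <= B.
  have h : (0 : R) \in `[- tau, tau]%R by rewrite in_itv/= oppr_le0 normr_ge0.
  by apply: le_trans (cB 0 h 0%N); exact: energy_partial_ge0.
have init K : weighted_energy K 0 <= 128 * e ^+ 2 * harmonic_sum K.
  rewrite /weighted_energy /harmonic_sum mulr_sumr; apply: ler_sum => i _.
  rewrite mulrC; apply: ler_wpM2r; first by rewrite invr_ge0.
  rewrite /trunc_energy c0 add0r.
  (* At time 0 only the quartic term is left, whence 128 = 512 / 4. *)
  apply: (@le_trans _ _ (1 / 4 * (512 * energy_partial (c 0) i.+1 ^+ 2))).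
    by apply: ler_wpM2l => //; exact: quartic_le_energy.
  have H : energy_partial (c 0) i.+1 ^+ 2 <= e ^+ 2.
    by rewrite lerXn2r ?nnegrE// energy_partial_ge0.
  move: (_ ^+ 2) (e ^+ 2) H => x y xy; lra.
have lip K : (0 < K)%N -> weighted_energy K t - weighted_energy K 0 <= defect_bound B K * tau.
  move=> K0; apply: le_trans (ler_norm _) _; have [t0|t0] := leP 0 t.
    have -> : tau = t - 0 by rewrite /tau ger0_norm// subr0.
    apply: weighted_energy_lipschitz => // s st; apply: cB.
    by move: st; rewrite !in_itv/= /tau (ger0_norm t0); lra.
  have -> : tau = 0 - t by rewrite /tau ltr0_norm// sub0r.
  rewrite distrC; apply: weighted_energy_lipschitz => //; first exact: ltW.
  move=> s st; apply: cB.
  by move: st; rewrite !in_itv/= /tau (ltr0_norm t0); lra.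
have [A [A0 [C3 {}lip]]] : exists A, 0 <= A /\ exists C3, forall K, (0 < K)%N ->
    weighted_energy K t - weighted_energy K 0 <= (6 * Num.sqrt (A * harmonic_sum K) + C3) * tau.
  exists (3168 * (4 * B) ^+ 4); split; last by exists (3456 * (4 * B) ^+ 3); exact: lip.
  apply: mulr_ge0; first exact: ler0n.
  by apply: exprn_ge0; apply: mulr_ge0; [exact: ler0n|exact: B0].
pose delta := Q - 128 * e ^+ 2.
have d0 : 0 < delta by rewrite subr_gt0.
have tau0 : 0 <= tau by exact: normr_ge0.
(* Everything that does not grow with m: the weight lost below the cut-off n, the bounded part of
   the defect, and the remainder of [amgm]. *)
pose bound := Q * harmonic_sum n + tau * C3 + 18 * tau ^+ 2 * A / delta.
have [m m0 Hm] := harmonic_sum_unbounded (bound * 2 / delta).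
have := lip (n + m)%N; rewrite addn_gt0 m0 orbT => /(_ isT).
have := init (n + m)%N; have := weighted_energy_ge n m t; rewrite -/Q.
have : harmonic_sum m <= harmonic_sum (n + m) :> R.
  by rewrite addnC /harmonic_sum big_split_ord/= lerDl sumr_ge0.
move/(lt_le_trans Hm); have := @harmonic_sum_ge0 R (n + m).
set h := harmonic_sum (n + m) => h0 Hh.
move: (weighted_energy _ t) (weighted_energy _ 0) => Et E0 W1 W2 W3.
have sA : Num.sqrt (A * h) = Num.sqrt A * Num.sqrt h by rewrite sqrtrM.
have a2 : Num.sqrt A ^+ 2 = A by rewrite sqr_sqrtr.
have h2 : Num.sqrt h ^+ 2 = h by rewrite sqr_sqrtr.
rewrite sA in W3; move: (Num.sqrt A) (Num.sqrt h) a2 h2 W3 => al s a2 h2 W3.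
(* Half of the excess absorbs the term of order sqrt h, by expanding the square of delta * s - 6 *
   tau * al. *)
have amgm : 6 * (al * s) * tau <= delta * h / 2 + 18 * tau ^+ 2 * A / delta.
  have -> : delta * h / 2 + 18 * tau ^+ 2 * A / delta =
      (delta ^+ 2 * h + 36 * tau ^+ 2 * A) / (2 * delta) by field; rewrite gt_eqF.
  rewrite ler_pdivlMr ?mulr_gt0// -a2 -h2.
  have := sqr_ge0 (delta * s - 6 * tau * al); rewrite -subr_ge0 => {}H.
  rewrite -subr_ge0; move: H; rewrite subr0; congr (_ <= _); ring.
have key : delta * h <= bound + delta * h / 2.
  have W4 : (6 * (al * s) + C3) * tau = 6 * (al * s) * tau + tau * C3 by ring.
  rewrite W4 in W3.
  have W5 : Q * (h - harmonic_sum n) = Q * h - Q * harmonic_sum n by ring.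
  rewrite W5 in W1.
  have -> : delta * h = Q * h - 128 * e ^+ 2 * h by rewrite /delta; ring.
  rewrite /bound; move: amgm; rewrite {1}/delta; lra.
move: Hh; rewrite ltNge => /negP; apply.
rewrite ler_pdivlMr//; lra.
Qed.

End evolution.

Lemma fourier_ae (R : realType) (f g : R -> R[i]) : cmeasurable f -> cmeasurable g ->
  (\forall x \ae (@lebesgue_measure R), f x = g x) -> fourier f = fourier g.
Proof.
move=> mf mg fg; apply/funext => k; rewrite !fourierE; congr (_ * _).
have [f1 f2] := cmeasurableM mf (cmeasurable_ek (- k)).
have [g1 g2] := cmeasurableM mg (cmeasurable_ek (- k)).
rewrite /torus_int /Rintegral; congr (fine _ +i* fine _)%C.
  apply: ae_eq_integral; [exact: measurable_period|exact/measurable_EFinP|exact/measurable_EFinP|].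
  by apply: (@filterS _ _ (ae_filter_ringOfSetsType _) _ _ _ fg) => x /= ->.
apply: ae_eq_integral; [exact: measurable_period|exact/measurable_EFinP|exact/measurable_EFinP|].
by apply: (@filterS _ _ (ae_filter_ringOfSetsType _) _ _ _ fg) => x /= ->.
Qed.

Theorem proposition2 (R : realType) :
  forall C : R, 0 < C ->
  exists C' : R, 0 < C' /\
  forall (eps : R) (u0 : R -> R[i]) (u : R -> R -> R[i]),
    0 < eps -> eps <= 1 ->
    in_H12 u0 ->
    Pi_plus (fourier u0) = fourier u0 ->
    (H12_norm (fourier u0) <= (C * eps)%:E)%E ->
    solution u0 u ->
    (ereal_sup [set H12_norm (Pi_minus (fourier (u t))) | t in [set: R]]
       <= (C' * eps ^+ 2)%:E)%E.
Proof.
(* The initial partial energies are at most e = 2 (C eps)^2, and sqrt(2 * 128 * e^2) = 16 e = 32 C^2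
   eps^2. *)
move=> C C0; exists (32 * C ^+ 2); split; first by rewrite mulr_gt0 ?exprn_gt0.
move=> eps u0 u eps0 _ [u0L2 _] u0plus u0le sol.
have Ce0 : 0 <= C * eps by rewrite mulr_ge0// ltW.
have [[uH12 _] u00 _] := sol.
have E0 : fourier (u 0) = fourier u0.
  by apply: fourier_ae u00; apply: in_L2_cmeasurable => //; exact: (uH12 0).1.
apply: ge_ereal_sup => _ [t _ <-].
have neg0 n : neg_energy n (fourier (u 0)) = 0.
  rewrite E0; apply: big1 => k _; rewrite /negfreq; case: ifPn => k0; last by rewrite mul0r.
  by rewrite -u0plus /Pi_plus leNgt k0 ComplexField.Normc.normc0 expr0n mulr0.
have en0 n : energy_partial (fourier (u 0)) n <= 2 * (C * eps) ^+ 2.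
  by rewrite E0; exact: energy_partial_H12.
apply: le_trans (H12_Pi_minus_le (neg_energy_le sol neg0 en0 t)) _.
rewrite lee_fin.
have -> : 2 * (128 * (2 * (C * eps) ^+ 2) ^+ 2) = (32 * C ^+ 2 * eps ^+ 2) ^+ 2 by ring.
rewrite sqrtr_sqr ger0_norm; first exact: lexx.
by apply: mulr_ge0; [apply: mulr_ge0; [exact: ler0n|exact: sqr_ge0]|exact: sqr_ge0].
Qed.
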